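(* Let $u$ be the solution of the time fractional parabolic problem described in the context, let $U_h(t)$ be the continuous piecewise linear in time fully discrete L1 finite element approximation with nodal values $(U_h^n)_{n=0}^N$, let $U_{\mathcal R}$ be its linear space-time reconstruction, let $\rho(t):=u(t)-U_{\mathcal R}(t)$, and assume $\rho(0)\in D(\mathcal A)$. Fix any $\theta\in(0,\pi/2)$ and put $\varphi=\max(0,\pi-(\pi-\theta)/\alpha)$, $C_{\alpha,\varphi}=\frac1\pi(\cos\varphi)^{\alpha-1}\Gamma(1-\alpha)$. Then for $t\in I_n$, $n\ge1$, $$\begin{aligned} \|u(t)-U_h(t)\|\le{}&\max\{\mathcal E_{e0}(U_h^n),\mathcal E_{e0}(U_h^{n-1})\}+\|\rho(0)\|\\ &+\frac{1}{\sin\theta}C_{\alpha,\varphi}\int_0^t(t-\tau)^{\alpha-1}\Big(\|\partial_t^\alpha U_{\mathcal R}-\bar\partial_k^\alpha U_h^n\|+\|\mathcal AU_{\mathcal R}-\mathcal A_h^nU_h^n\|+\|f_h^n-f\|+\|\mathcal A\rho(0)\|\Big)d\tau, \end{aligned}$$ where inside the integral the functions are evaluated at $\tau$ and the superscript $n$ denotes the index with $\tau\in I_n$.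
   Context: Problem. $\alpha\in(0,1)$, $T<\infty$, $\Omega\subset\mathbb R^d$ is a bounded convex polygonal domain. $\partial_t^\alpha$ is the Caputo derivative $\partial_t^\alpha v(t)=\int_0^t\omega_{1-\alpha}(t-s)v'(s)\,ds$ with $\omega_\gamma(t)=t^{\gamma-1}/\Gamma(\gamma)$. The operator is $\mathcal Au=-\nabla\cdot(A(x)\nabla u)$, symmetric positive definite with smooth matrix $A$, with domain $D(\mathcal A)=\{v\in H_0^1(\Omega):\mathcal Av\in L^2(\Omega)\}$, and $a(\varphi,\chi)=\langle A\nabla\varphi,\nabla\chi\rangle$ on $H_0^1(\Omega)$. Here $\langle\cdot,\cdot\rangle$ and $\|\cdot\|$ are the $L^2(\Omega)$ inner product and norm, and $\|\cdot\|_1$ is the $H^1(\Omega)$ norm. The form $a$ is coercive and continuous: $a(\varphi,\varphi)\ge\eta\|\varphi\|_1^2$ and $|a(\varphi,\chi)|\le\beta\|\varphi\|_1\|\chi\|_1$ for all $\varphi,\chi\in H_0^1(\Omega)$, with $\eta,\beta>0$. With $f\in C(0,T;L^2(\Omega))$, the function $u\in C^1(0,T;H_0^1(\Omega))$ solves $\langle\partial_t^\alpha u,\varphi\rangle+a(u,\varphi)=\langle f,\varphi\rangle$ for all $\varphi\in H^1_0(\Omega)$, $t\in(0,T]$, with $u(0)=u_0$. Discretization. $0=t_0<t_1<\dots<t_N=T$, $I_n=(t_{n-1},t_n]$, $k_n=t_n-t_{n-1}$. $\{\mathcal T_n\}_{n=0}^N$ are conforming shape-regular triangulations of $\Omega$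 (possibly changing with $n$), $h_n(x)=\mathrm{diam}(K)$ for $x\in K\in\mathcal T_n$, $\Sigma_n$ is the union of the internal sides (edges if $d=2$, faces if $d=3$) of $\mathcal T_n$, and $V_0^n\subset H_0^1(\Omega)$ is the space of continuous functions vanishing on $\partial\Omega$ that are polynomials of degree at most $r$ ($r\ge1$) on each $K\in\mathcal T_n$. $P_0^n$ is the $L^2$-projection onto $V_0^n$; $\Pi_j^i:V_0^j\to V_0^i$ are suitable projections or interpolants. The discrete elliptic operator $\mathcal A_h^n:H_0^1\to V_0^n$ is $\langle\mathcal A_h^nv,\varphi_h\rangle=a(v,\varphi_h)$ for all $\varphi_h\in V_0^n$. L1 scheme. $\bar\partial U_h^j=(U_h^j-\Pi_{j-1}^jU_h^{j-1})/k_j$, $a_j(t)=\frac{1}{\Gamma(2-\alpha)}[(t-t_{j-1})^{1-\alpha}-(t-t_j)^{1-\alpha}]$, $\bar\partial_k^\alpha U_h^n=\sum_{j=1}^na_j(t_n)\Pi_j^n\bar\partial U_h^j$. Given $U_h^0\in V_0^0$, $U_h^n\in V_0^n$ satisfies $\bar\partial_k^\alpha U_h^n+\mathcal A_h^nU_h^n=f_h^n$, where $f_h^n=P_0^nf(t_n)$, $n=1,\dots,N$. Reconstructions. With $\ell_{n,0}(t)=(t-t_{n-1})/k_n$ and $\ell_{n,-1}(t)=(t_n-t)/k_n$, $U_h(t)=\ell_{n,0}(t)U_h^n+\ell_{n,-1}(t)U_h^{n-1}$ for $t\in I_n$. The elliptic reconstruction $\mathcal R^n:V_0^n\to H_0^1$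 is defined by $a(\mathcal R^nv,\varphi)=\langle\mathcal A_h^nv,\varphi\rangle$ for all $\varphi\in H_0^1$, and $U_{\mathcal R}(t)=\ell_{n,-1}(t)\mathcal R^{n-1}U_h^{n-1}+\ell_{n,0}(t)\mathcal R^nU_h^n$ for $t\in I_n$. Elliptic estimator. For $v\in V_0^n$, $\mathcal A_{el}v$ is the piecewise function equal to $-\mathrm{div}(A\nabla v)$ on each $K\in\mathcal T_n$, $J_A[v]$ is the jump of $A\nabla v$ in the normal direction across the sides in $\Sigma_n$, and $\mathcal E_{e0}(v)=C_{e0}\big(\|h_n^2(\mathcal A_{el}-\mathcal A_h^n)v\|+\|J_A[v]h_n^{3/2}\|_{\Sigma_n}\big)$, where $\|\cdot\|_{\Sigma_n}$ is the $L^2(\Sigma_n)$ norm and $C_{e0}$, depending only on the shape regularity, $\Omega$ and the problem data, is the (known to exist) constant for which $\|\mathcal R^nv-v\|\le\mathcal E_{e0}(v)$ for all $v\in V_0^n$ and all $n$. *)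

(* Defs.v *)
From HB Require Import structures.
From mathcomp Require Import all_boot all_order all_algebra.
From mathcomp Require Import all_classical all_reals all_analysis.
Set Implicit Arguments.
Unset Strict Implicit.
Unset Printing Implicit Defensive.
Import Order.TTheory GRing.Theory Num.Theory numFieldNormedType.Exports.
Local Open Scope classical_set_scope.
Local Open Scope ring_scope.

(* Lebesgue measure on R^n, first on n-tuples (iterated product of the
   one-dimensional measure), then carried over to row vectors. *)
Section lebesgue_tuple.
Context {R : realType}.
Local Notation mR := (measurableTypeR R).

Section cons.
Context (n : nat) (m : {sigma_finite_measure set (n.-tuple mR) -> \bar R}).

Let tcons (p : mR * n.-tuple mR) : n.+1.-tuple mR :=
  [the n.+1.-tuple mR of p.1 :: p.2].

Let mtcons : measurable_fun setT tcons.
Proof. exact: measurable_cons. Qed.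

Let leb_m : {measure set (mR * n.-tuple mR)%type -> \bar R} :=
  (@lebesgue_measure R \x m)%E.

Definition lebesgue_cons : set (n.+1.-tuple mR) -> \bar R :=
  pushforward (@lebesgue_measure R \x m)%E tcons.

Let lebesgue_cons0 : lebesgue_cons set0 = 0%E.
Proof. by rewrite /lebesgue_cons /pushforward preimage_set0 measure0. Qed.

Let lebesgue_cons_ge0 A : (0 <= lebesgue_cons A)%E.
Proof. exact: measure_ge0. Qed.

Let lebesgue_cons_sigma_additive : semi_sigma_additive lebesgue_cons.
Proof.
exact: (@measure_semi_sigma_additive _ _ _
  (measure_function_pushforward__canonical__measure_function_Measure leb_m mtcons)).
Qed.

HB.instance Definition _ := isMeasure.Build _ _ _ lebesgue_cons
  lebesgue_cons0 lebesgue_cons_ge0 lebesgue_cons_sigma_additive.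

Let lebesgue_cons_sigma_finite : sigma_finite setT lebesgue_cons.
Proof.
have /sigma_finiteP[F [TF ndF Foo]] := sigma_finiteT (@lebesgue_measure R).
have /sigma_finiteP[G [TG ndG Goo]] := sigma_finiteT m.
pose g (t : n.+1.-tuple mR) : mR * n.-tuple mR := (thead t, [tuple of behead t]).
have mg : measurable_fun setT g.
  apply/measurable_fun_pairP; split; first exact: measurable_tnth.
  exact: measurable_behead.
have tK p : g (tcons p) = p.
  case: p => x t; rewrite /g theadE; congr pair; exact/val_inj.
exists (fun k => g @^-1` (F k `*` G k)).
  apply/esym; rewrite -subTset => t _.
  have : [set: mR] (g t).1 by []. rewrite TF => -[i _ Fi].
  have : [set: n.-tuple mR] (g t).2 by []. rewrite TG => -[j _ Gj].
  exists (maxn i j) => //; split.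
    by move: Fi; exact/subsetPset/ndF/leq_maxl.
  by move: Gj; exact/subsetPset/ndG/leq_maxr.
move=> k; have [? ?] := Foo k; have [? ?] := Goo k; split.
  by rewrite -[X in measurable X]setTI; apply: mg => //; exact: measurableX.
rewrite /lebesgue_cons /pushforward -comp_preimage.
rewrite (_ : g \o tcons = id) ?preimage_id; last exact/funext.
by rewrite product_measure1E// lte_mul_pinfty// ge0_fin_numE.
Qed.

HB.instance Definition _ := @Measure_isSigmaFinite.Build _ _ _ lebesgue_cons
  lebesgue_cons_sigma_finite.
End cons.

Fixpoint lebesgue_tuple (n : nat) :
    {sigma_finite_measure set (n.-tuple mR) -> \bar R} :=
  if n is n'.+1 then lebesgue_cons (lebesgue_tuple n') else \d_([tuple]).

End lebesgue_tuple.

(* Borel sigma-algebra of 'rV_n, generated by the coordinates. *)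
Section measurable_rV.
Context {R : realType} {n : nat}.

Let coor : 'I_n -> 'rV[R]_n -> measurableTypeR R := fun i v => v ord0 i.

HB.instance Definition _ := @isMeasurable.Build
  (measure_tuple_display default_measure_display) 'rV[R]_n
  (g_sigma_preimage coor) (@sigma_algebra0 _ _ _) (@sigma_algebraC _ _)
  (@sigma_algebra_bigcup _ _ _).

Let row_of_tuple (t : n.-tuple (measurableTypeR R)) : 'rV[R]_n :=
  \row_i tnth t i.

Let measurable_row_of_tuple : measurable_fun setT row_of_tuple.
Proof.
move=> _ A mA.
have cE i : coor i \o row_of_tuple = @tnth n (measurableTypeR R) ^~ i.
  by apply/funext => t /=; rewrite /coor /row_of_tuple mxE.
have : preimage_set_system setT row_of_tuple (g_sigma_preimage coor)
    (setT `&` row_of_tuple @^-1` A) by exists A.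
rewrite -g_sigma_preimage_comp.
by under eq_fun do rewrite cE.
Qed.

Definition lebesgue_rV : set 'rV[R]_n -> \bar R :=
  pushforward (@lebesgue_tuple R n) row_of_tuple.

Let lebesgue_rV0 : lebesgue_rV set0 = 0%E.
Proof. by rewrite /lebesgue_rV /pushforward preimage_set0 measure0. Qed.

Let lebesgue_rV_ge0 A : (0 <= lebesgue_rV A)%E.
Proof. exact: measure_ge0. Qed.

Let lebesgue_rV_sigma_additive : semi_sigma_additive lebesgue_rV.
Proof.
exact: (@measure_semi_sigma_additive _ _ _
  (measure_function_pushforward__canonical__measure_function_Measure
    (@lebesgue_tuple R n) measurable_row_of_tuple)).
Qed.

HB.instance Definition _ := isMeasure.Build _ _ _ lebesgue_rV
  lebesgue_rV0 lebesgue_rV_ge0 lebesgue_rV_sigma_additive.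

End measurable_rV.

Section calculus.
Context {R : realType} {d : nat}.
Local Notation Rd := 'rV[R]_d.

Definition dot (x y : Rd) : R := (x *m y^T) ord0 ord0.
Definition enorm (x : Rd) : R := Num.sqrt (dot x x).

Definition partial (i : 'I_d) (f : Rd -> R) (x : Rd) : R :=
  'D_(delta_mx ord0 i) f x.
Definition cgrad (f : Rd -> R) (x : Rd) : Rd := \row_i partial i f x.
Definition cdiv (F : Rd -> Rd) (x : Rd) : R :=
  \sum_(i < d) partial i (fun y => F y ord0 i) x.

(* C^infinity: all iterated partial derivatives exist and are continuous *)
Definition smooth (f : Rd -> R) : Prop :=
  forall s : seq 'I_d, continuous (foldr partial f s) /\
    forall i x, derivable (foldr partial f s) x (delta_mx ord0 i).

(* C_c^infinity(Omega) *)
Definition test_function (Omega : set Rd) (phi : Rd -> R) : Prop :=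
  let supp := closure (phi @^-1` [set~ 0]) in
  [/\ smooth phi, compact supp & supp `<=` Omega].

End calculus.

(* R^o makes scalar fields a vector space under pointwise operations. *)
Notation scalar_field R d := ('rV[R]_d -> R^o).

(* An element of H^1_0 is carried by a pair (v, grad v). By [H10] below, such a
   pair is an L^2 limit of pairs (phi, grad phi) with phi a test function, so
   that its second component is the weak gradient of the first, determined
   almost everywhere by it. Operations on pairs are componentwise. *)
Notation sobolev R d := (('rV[R]_d -> R^o) * ('rV[R]_d -> 'rV[R]_d))%type.

Section sobolev.
Context {R : realType} {d : nat}.
Local Notation Rd := 'rV[R]_d.

Context (Omega : set Rd).
Local Notation leb := (@lebesgue_rV R d).

Definition ip (f g : scalar_field R d) : R := \int[leb]_(x in Omega) (f x * g x).
Definition l2norm (f : scalar_field R d) : R := Num.sqrt (ip f f).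
Definition L2 (f : scalar_field R d) : Prop :=
  measurable_fun Omega (f : Rd -> R) /\
  leb.-integrable Omega (fun x => (f x ^+ 2)%:E).

Definition lift_test (phi : Rd -> R) : sobolev R d :=
  (phi, cgrad phi).

Definition h1norm (v : sobolev R d) : R :=
  Num.sqrt (l2norm v.1 ^+ 2 + \int[leb]_(x in Omega) dot (v.2 x) (v.2 x)).

(* H^1_0(Omega), the closure of C_c^infinity(Omega) for the H^1 norm *)
Definition H10 (v : sobolev R d) : Prop :=
  [/\ L2 v.1, forall i, L2 (fun x => v.2 x ord0 i) &
      forall e : R, 0 < e -> exists2 phi, test_function Omega phi &
        h1norm (v - lift_test phi) < e].

(* the flux A grad v, as a row vector *)
Definition flux (A : Rd -> 'M[R]_d) (g : Rd -> Rd) (x : Rd) : Rd :=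
  g x *m (A x)^T.

(* a(v, w) = <A grad v, grad w> *)
Definition aform (A : Rd -> 'M[R]_d) (v w : sobolev R d) : R :=
  \int[leb]_(x in Omega) dot (flux A v.2 x) (w.2 x).

(* g = - div (A grad v) in the sense of distributions, with g in L^2 *)
Definition is_ellop A (v : sobolev R d) (g : scalar_field R d) : Prop :=
  L2 g /\ forall phi, test_function Omega phi ->
    aform A v (lift_test phi) = ip g phi.

Definition ellop_dom A v : Prop := H10 v /\ exists g, is_ellop A v g.

Definition ellop A v : scalar_field R d := xget 0 [set g | is_ellop A v g].

End sobolev.

Section time.
Context {R : realType}.
Local Notation mu := (@lebesgue_measure R).

(* time_index tt N t = n for t in (t_{n-1}, t_n], 1 <= n <= N, and 0 at t = t_0 *)
Definition time_index (tt : nat -> R) (N : nat) (t : R) : nat :=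
  (\sum_(j < N) (tt j < t)%R)%N.

Definition time_step (tt : nat -> R) (n : nat) : R := tt n - tt n.-1.

(* continuous piecewise linear interpolant of the nodal values W *)
Definition interpolant (E : lmodType R) (tt : nat -> R) (N : nat)
    (W : nat -> E) (t : R) : E :=
  let n := time_index tt N t in
  if n == 0%N then W 0%N else
    ((tt n - t) / time_step tt n) *: W n.-1 +
    ((t - tt n.-1) / time_step tt n) *: W n.

(* continuity and derivatives with respect to a (semi)norm nrm *)
Definition continuous_on (E : lmodType R) (nrm : E -> R) (D : set R)
    (w : R -> E) : Prop :=
  forall t, D t -> nrm (w s - w t) @[s --> within D (nbhs t)] --> (0 : R).

Definition has_derivative (E : lmodType R) (nrm : E -> R) (D : set R)
    (w : R -> E) (t : R) (w' : E) : Prop :=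
  nrm ((s - t)^-1 *: (w s - w t) - w')
    @[s --> within (D `\ t) (nbhs t)] --> (0 : R).

(* C^1(D; V) for a subspace V of E *)
Definition continuously_differentiable (E : lmodType R) (nrm : E -> R)
    (V : E -> Prop) (D : set R) (w : R -> E) : Prop :=
  (forall t, D t -> V (w t)) /\
  exists w' : R -> E, [/\ forall t, D t -> V (w' t),
    forall t, D t -> has_derivative nrm D w t (w' t) &
    continuous_on nrm D w'].

Definition Gamma (x : R) : R :=
  \int[mu]_(t in `]0, +oo[) (t `^ (x - 1) * expR (- t)).

Definition omega (gamma t : R) : R := t `^ (gamma - 1) / Gamma gamma.

End time.

Section caputo.
Context {R : realType} {d : nat} (Omega : set 'rV[R]_d).
Local Notation mu := (@lebesgue_measure R).
Local Notation nrm := (l2norm Omega).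

(* An L^2-valued simple function is given by the list of its pairs (B, x),
   denoting the sum of the 1_B x. *)
Definition simple_fun (S : seq (set (measurableTypeR R) * scalar_field R d))
    (s : R) : scalar_field R d :=
  \sum_(p <- S) (\1_(p.1) s : R) *: p.2.

Definition simple_integral (D : set R)
    (S : seq (set (measurableTypeR R) * scalar_field R d)) : scalar_field R d :=
  \sum_(p <- S) fine (mu (p.1 `&` D)) *: p.2.

(* w is the Bochner integral over D, a set of finite measure, of F *)
Definition is_bochner_integral (D : set R) (F : R -> scalar_field R d)
    (w : scalar_field R d) : Prop :=
  [/\ L2 Omega w, forall s, D s -> L2 Omega (F s) &
    exists S : nat -> seq (set (measurableTypeR R) * scalar_field R d),
    [/\ forall k p, p \in S k -> measurable p.1 /\ L2 Omega p.2,
        forall k, measurable_fun D (fun s => nrm (F s - simple_fun (S k) s)),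
        (\int[mu]_(s in D) (nrm (F s - simple_fun (S k) s))%:E)%E
          @[k --> \oo] --> 0%E &
        nrm (simple_integral D (S k) - w) @[k --> \oo] --> (0 : R)]].

(* w = int_0^t omega_{1-alpha}(t - s) v'(s) ds, where v' is the derivative of v
   in L^2 (almost everywhere: v may be piecewise linear) *)
Definition is_caputo (alpha : R) (v : R -> scalar_field R d) (t : R)
    (w : scalar_field R d) : Prop :=
  exists v' : R -> scalar_field R d,
  [/\ forall s, s \in `]0, t[ -> L2 Omega (v' s),
      {ae mu, forall s, s \in `]0, t[ ->
         has_derivative nrm `]0, t[ v s (v' s)} &
      is_bochner_integral `]0, t[
        (fun s => omega (1 - alpha) (t - s) *: v' s) w].

Definition caputo (alpha : R) (v : R -> scalar_field R d) (t : R) :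
    scalar_field R d :=
  xget 0 [set w | is_caputo alpha v t w].

End caputo.

Section geometry.
Context {R : realType} {d : nat}.
Local Notation Rd := 'rV[R]_d.

(* convex hull of the rows of P *)
Definition hull (m : nat) (P : 'M[R]_(m, d)) : set Rd :=
  [set x | exists l : 'rV[R]_m,
    [/\ forall i, 0 <= l ord0 i, \sum_i l ord0 i = 1 & x = l *m P]].

Definition diam (S : set Rd) : R :=
  sup [set enorm (x - y) | x in S & y in S].

(* nonempty open bounded convex polytope *)
Definition polytope (Omega : set Rd) : Prop :=
  Omega !=set0 /\ exists m (P : 'M[R]_(m, d)), Omega = interior (hull P).

End geometry.

(* Surface integral over the (n-1)-dimensional simplex in R^n whose vertices are
   the rows of F, by affine parametrization over the reference simplex of
   R^(n-1); here n = d.+1. *)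
Section surface.
Context {R : realType} {d : nat} (F : 'M[R]_d.+1).

Definition edges : 'M[R]_(d, d.+1) :=
  \matrix_(i < d, j < d.+1) (F (lift ord0 i) j - F ord0 j).

Definition reference_simplex : set 'rV[R]_d :=
  [set xi | (forall i, 0 <= xi ord0 i) /\ \sum_i xi ord0 i <= 1].

Definition surface_integral (g : 'rV[R]_d.+1 -> R) : R :=
  Num.sqrt (\det (edges *m edges^T)) *
  \int[@lebesgue_rV R d]_(xi in reference_simplex) g (row ord0 F + xi *m edges).

(* a unit normal; its orientation is irrelevant below *)
Definition normal : 'rV[R]_d.+1 :=
  xget 0 [set nu | enorm nu = 1 /\ edges *m nu^T = 0].

End surface.

Section mesh.
Context {R : realType} {d : nat}.
Local Notation Rd := 'rV[R]_d.+1.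

(* a simplex is given by the matrix of its vertices *)
Record mesh := Mesh { ncell : nat; cell : 'I_ncell -> 'M[R]_(d.+2, d.+1) }.

Definition nondegenerate (K : 'M[R]_(d.+2, d.+1)) : Prop :=
  (row_mx (const_mx 1 : 'cV[R]_d.+2) K : 'M[R]_d.+2) \in unitmx.

(* the face of K spanned by its common vertices with K' *)
Definition common_face (K K' : 'M[R]_(d.+2, d.+1)) : set Rd :=
  [set x | exists l : 'rV[R]_d.+2,
    [/\ forall i, 0 <= l ord0 i, \sum_i l ord0 i = 1, x = l *m K &
        forall i, l ord0 i != 0 -> exists j, row i K = row j K']].

Definition conforming_triangulation (Omega : set Rd) (M : mesh) : Prop :=
  [/\ forall i, nondegenerate (@cell M i),
      \bigcup_(i in [set: 'I_(ncell M)]) hull (@cell M i) = closure Omega,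
      forall i j : 'I_(ncell M), i != j -> hull (cell i) <> hull (cell j) &
      forall i j : 'I_(ncell M), i != j ->
        hull (cell i) `&` hull (cell j) = common_face (cell i) (cell j)].

(* every K contains a ball of radius at least diam K / kappa *)
Definition shape_regular (kappa : R) (M : mesh) : Prop :=
  forall i : 'I_(ncell M), exists (c : Rd) (r : R),
    [/\ 0 < r, [set x | enorm (x - c) < r] `<=` hull (cell i) &
        diam (hull (cell i)) <= kappa * r].

(* h(x) = diam K for x in K; the larger value is taken on common sides *)
Definition meshsize (M : mesh) (x : Rd) : R :=
  \big[Num.max/0]_(i < ncell M | `[< hull (cell i) x >]) diam (hull (cell i)).

(* f is a polynomial of total degree at most r on S; m ranges over exponents *)
Definition polynomial_on (r : nat) (S : set Rd) (f : Rd -> R) : Prop :=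
  exists c : {ffun 'I_d.+1 -> 'I_r.+1} -> R, forall x, S x ->
    f x = \sum_(m : {ffun 'I_d.+1 -> 'I_r.+1} | (\sum_j m j <= r)%N)
            c m * \prod_j x ord0 j ^+ m j.

Definition fe_space (Omega : set Rd) (r : nat) (M : mesh)
    (v : sobolev R d.+1) : Prop :=
  [/\ H10 Omega v, {within closure Omega, continuous (v.1 : Rd -> R)},
      forall x, (closure Omega `\` Omega) x -> v.1 x = 0 &
      forall i : 'I_(ncell M), polynomial_on r (hull (cell i)) v.1].

Definition facet (K : 'M[R]_(d.+2, d.+1)) (k : 'I_d.+2) : 'M[R]_d.+1 :=
  row' k K.

(* cells i < j share the facet of cell i opposite to its vertex k; the order of
   i and j makes each internal side be counted once *)
Definition internal_side (M : mesh) (i j : 'I_(ncell M)) (k : 'I_d.+2) : Prop :=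
  (i < j)%N /\ hull (facet (cell i) k) = hull (cell i) `&` hull (cell j).

Definition skeleton_integral (M : mesh)
    (q : 'I_(ncell M) -> 'I_(ncell M) -> 'I_d.+2 -> Rd -> R) : R :=
  \sum_(i < ncell M) \sum_(j < ncell M)
    \sum_(k < d.+2 | `[< internal_side i j k >])
      surface_integral (facet (cell i) k) (q i j k).

(* A grad v on the side x of K, as limit from the interior of K *)
Definition flux_trace (A : Rd -> 'M[R]_d.+1) (v : Rd -> R)
    (K : 'M[R]_(d.+2, d.+1)) (x : Rd) : Rd :=
  lim (flux A (cgrad v) y @[y --> within (interior (hull K)) (nbhs x)]).

(* J_A[v] *)
Definition jump (A : Rd -> 'M[R]_d.+1) (M : mesh) (v : Rd -> R)
    (i j : 'I_(ncell M)) (k : 'I_d.+2) (x : Rd) : R :=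
  dot (flux_trace A v (cell i) x - flux_trace A v (cell j) x)
      (normal (facet (cell i) k)).

(* A_el v; the cells' boundaries, where v need not be differentiable, are
   negligible *)
Definition ellop_cellwise (A : Rd -> 'M[R]_d.+1) (v : Rd -> R) (x : Rd) : R :=
  - cdiv (flux A (cgrad v)) x.

(* E_e0(v), where Av stands for A_h v *)
Definition estimator (C : R) (A : Rd -> 'M[R]_d.+1) (Omega : set Rd) (M : mesh)
    (v Av : sobolev R d.+1) : R :=
  C * (l2norm Omega (fun x => meshsize M x ^+ 2 *
                       (ellop_cellwise A v.1 x - Av.1 x)) +
       Num.sqrt (skeleton_integral (M := M) (fun i j k x =>
         (jump (M := M) A v.1 i j k x * meshsize M x `^ (3 / 2)) ^+ 2))).

End mesh.
Arguments mesh : clear implicits.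

Section scheme.
Context {R : realType} {d : nat}.

Definition l1_weight (alpha : R) (tt : nat -> R) (j : nat) (t : R) : R :=
  (Gamma (2 - alpha))^-1 *
  ((t - tt j.-1) `^ (1 - alpha) - (t - tt j) `^ (1 - alpha)).

(* Pi j i maps V^j to V^i *)
Definition backward_diff (tt : nat -> R)
    (Pi : nat -> nat -> sobolev R d -> sobolev R d) (U : nat -> sobolev R d)
    (j : nat) : sobolev R d :=
  (time_step tt j)^-1 *: (U j - Pi j.-1 j (U j.-1)).

Definition l1_caputo (alpha : R) (tt : nat -> R)
    (Pi : nat -> nat -> sobolev R d -> sobolev R d) (U : nat -> sobolev R d)
    (n : nat) : sobolev R d :=
  \sum_(1 <= j < n.+1)
    l1_weight alpha tt j (tt n) *: Pi j n (backward_diff tt Pi U j).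

End scheme.

(* Main.v *)
Require Import Defs.
From HB Require Import structures.
From mathcomp Require Import all_boot all_order all_algebra finmap.
From mathcomp Require Import all_classical all_reals all_analysis.
From mathcomp Require Import measurable_realfun ring lra.
Set Implicit Arguments.
Unset Strict Implicit.
Unset Printing Implicit Defensive.
Import Order.TTheory GRing.Theory Num.Theory numFieldNormedType.Exports.
Local Open Scope classical_set_scope.
Local Open Scope ring_scope.

(** The error rho = u - U_R is estimated by an energy argument.

Let psi in H10, let tau lie in the time step of index m, and write a(., .) for
the bilinear form. The equation of u, the definition of the elliptic
reconstruction and the scheme give
  <D rho(tau), psi> + a(rho(tau), psi) = <r(tau), psi>,
  r = (l1 - D U_R) + (A_h U^m - A U_R) + (f - f_h),
where D is the Caputo derivative and l1 its discrete counterpart. For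
psi = rho(tau) coercivity makes the second term nonnegative, so that
<D rho, rho>(tau) <= |rho(tau)| G(tau) with G the sum of the norms under the
integral sign: ip_residual_le, with ellop_interpolant for the elliptic part.

It remains to pass from this pointwise bound to a bound on |rho(t)|. Let
y(s) be the square root of |rho(s)|^2 + e^2. For a fixed tau the function
  m(s) = <rho(s), rho(tau)> + e^2 - y(s) y(tau)
is nonpositive by the Cauchy-Schwarz inequality and vanishes at s = tau.
Integration by parts against (tau - s)^(-alpha), which increases up to tau,
shows that the convolution of this kernel with m' is nonnegative
(power_kernel_sign). Hence the convolution with y' is at most
Gamma(1 - alpha) G(tau) (regnorm_kernel_le). Multiply by (t - tau)^(alpha - 1)
and integrate over tau in (0, t): by Tonelli's theorem and Abel's identity
(integral_abel_kernel) the left-hand side becomes B (y(t) - y(0)), where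
B = B(1 - alpha, alpha) is a value of Euler's beta function, and B >= pi
(pi_le_euler_beta). Letting e tend to 0, one gets (energy_estimate)
  |rho(t)| <= |rho(0)| +
    Gamma(1 - alpha) / pi * int_0^t (t - tau)^(alpha - 1) G(tau) dtau.
The constant is at most C_{alpha,phi} / sin theta for every theta, because
sin theta and cos phi lie in (0, 1] and alpha < 1 (fractional_constant_le).

The difference of U_R and U_h is a convex combination of the errors of the
elliptic reconstruction at two nodes (l2norm_convex_le).

Caputo derivatives are Bochner integrals. Testing them with a fixed field turns
them into the scalar convolutions used above (ip_bochner, ip_caputo), and that
of U_R exists because the derivative of U_R takes finitely many values
(caputo_interpolant_exists). *)

(** * The semi-inner product on L2 *)
Section L2_theory.
Context {R : realType} {d : nat} (Omega : set 'rV[R]_d).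
Hypothesis mOmega : measurable Omega.
Local Notation leb := (@lebesgue_rV R d).
Local Notation L2 := (L2 Omega).
Local Notation ip := (ip Omega).
Local Notation nrm := (l2norm Omega).
Implicit Types f g h : scalar_field R d.

Lemma L2_integrableM f g : L2 f -> L2 g ->
  leb.-integrable Omega (fun x => (f x * g x)%:E).
Proof.
move=> [mf f2] [mg g2].
have sq : leb.-integrable Omega (fun x => (f x ^+ 2)%:E + (g x ^+ 2)%:E)%E.
  exact: integrableD.
apply: le_integrable sq => //.
  by apply/measurable_EFinP; apply: measurable_funM.
move=> x _; rewrite -EFinD !abse_EFin lee_fin.
have fg0 : 0 <= f x ^+ 2 + g x ^+ 2 by rewrite addr_ge0// sqr_ge0.
rewrite (ger0_norm fg0) ler_norml; apply/andP; split.
  by have := sqr_ge0 (f x + g x); nra.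
by have := sqr_ge0 (f x - g x); nra.
Qed.

Lemma L20 : L2 0.
Proof.
split; first exact: measurable_cst.
by under eq_fun do rewrite /= /GRing.zero/= expr0n/=; exact: integrable0.
Qed.

Lemma L2D f g : L2 f -> L2 g -> L2 (f + g).
Proof.
move=> Lf Lg; have ifg := L2_integrableM Lf Lg.
case: Lf Lg => [mf f2] [mg g2]; split; first exact: measurable_funD.
have : leb.-integrable Omega
    (fun x => ((f x ^+ 2)%:E + 2%:E * (f x * g x)%:E) + (g x ^+ 2)%:E)%E.
  by apply: integrableD => //; apply: integrableD => //; exact: integrableZl.
apply: eq_integrable => // x _; rewrite -EFinM -!EFinD; congr EFin.
by rewrite sqrrD mulr_natl.
Qed.

Lemma L2Z (c : R) f : L2 f -> L2 (c *: f).
Proof.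
move=> [mf f2]; split; first exact: measurable_funM.
have := integrableZl mOmega (c ^+ 2) f2.
by apply: eq_integrable => // x _; rewrite -EFinM -exprMn.
Qed.

Lemma L2N f : L2 f -> L2 (- f).
Proof. by move=> Lf; rewrite -scaleN1r; exact: L2Z. Qed.

Lemma L2B f g : L2 f -> L2 g -> L2 (f - g).
Proof. by move=> Lf Lg; apply: L2D => //; exact: L2N. Qed.

Lemma L2_sum (I : eqType) (s : seq I) (P : pred I) (F : I -> scalar_field R d) :
  (forall i, i \in s -> P i -> L2 (F i)) -> L2 (\sum_(i <- s | P i) F i).
Proof.
move=> LF; rewrite big_seq_cond; apply: (big_ind L2); first exact: L20.
  by move=> ? ?; exact: L2D.
by move=> i /andP[]; exact: LF.
Qed.

Lemma ipC f g : ip f g = ip g f.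
Proof. by rewrite /Defs.ip; apply: eq_Rintegral => x _; rewrite mulrC. Qed.

Lemma ipDl f g h : L2 f -> L2 g -> L2 h -> ip (f + g) h = ip f h + ip g h.
Proof.
move=> Lf Lg Lh; rewrite /Defs.ip -RintegralD//; last 2 first.
  exact: (L2_integrableM Lf).
  exact: (L2_integrableM Lg).
by apply: eq_Rintegral => x _; rewrite -mulrDl.
Qed.

Lemma ipZl c f g : L2 f -> L2 g -> ip (c *: f) g = c * ip f g.
Proof.
move=> Lf Lg; rewrite /Defs.ip -RintegralZl//; last exact: L2_integrableM.
by apply: eq_Rintegral => x _; rewrite mulrA.
Qed.

Lemma ipNl f g : L2 f -> L2 g -> ip (- f) g = - ip f g.
Proof. by move=> Lf Lg; rewrite -scaleN1r ipZl// mulN1r. Qed.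

Lemma ipBl f g h : L2 f -> L2 g -> L2 h -> ip (f - g) h = ip f h - ip g h.
Proof. by move=> Lf Lg Lh; rewrite ipDl ?ipNl//; exact: L2N. Qed.

Lemma ipDr f g h : L2 f -> L2 g -> L2 h -> ip h (f + g) = ip h f + ip h g.
Proof. by move=> *; rewrite ipC ipDl// ![ip _ h]ipC. Qed.

Lemma ipZr c f g : L2 f -> L2 g -> ip g (c *: f) = c * ip g f.
Proof. by move=> *; rewrite ipC ipZl// [ip _ g]ipC. Qed.

Lemma ipBr f g h : L2 f -> L2 g -> L2 h -> ip h (f - g) = ip h f - ip h g.
Proof. by move=> *; rewrite ipC ipBl// ![ip _ h]ipC. Qed.

Lemma ip0l f : ip 0 f = 0.
Proof.
rewrite /Defs.ip (_ : (fun _ => _) = cst 0); last first.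
  by apply/funext => x; rewrite /= mul0r.
by rewrite /Rintegral integral0.
Qed.

Lemma ip_suml (I : eqType) (s : seq I) (P : pred I) (F : I -> scalar_field R d) f :
  (forall i, i \in s -> P i -> L2 (F i)) -> L2 f ->
  ip (\sum_(i <- s | P i) F i) f = \sum_(i <- s | P i) ip (F i) f.
Proof.
move=> LF Lf.
elim: s LF => [|i s ih] LF; first by rewrite !big_nil ip0l.
have LF' j : j \in s -> P j -> L2 (F j).
  by move=> js; apply: LF; rewrite inE js orbT.
rewrite !big_cons; case: ifPn => Pi; last exact: ih.
rewrite ipDl//; first by rewrite ih.
  by apply: LF => //; rewrite mem_head.
exact: L2_sum.
Qed.

Lemma ip_ge0 f : 0 <= ip f f.
Proof. by apply: Rintegral_ge0 => x _; rewrite -expr2 sqr_ge0. Qed.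

Lemma sqr_l2norm f : nrm f ^+ 2 = ip f f.
Proof. by rewrite sqr_sqrtr// ip_ge0. Qed.

Lemma l2norm_ge0 f : 0 <= nrm f.
Proof. exact: sqrtr_ge0. Qed.

Lemma l2norm0 : nrm 0 = 0.
Proof. by rewrite /l2norm ip0l sqrtr0. Qed.

Lemma l2normZ c f : L2 f -> nrm (c *: f) = `|c| * nrm f.
Proof.
move=> Lf; rewrite /l2norm ipZl ?ipZr//; last exact: L2Z.
by rewrite mulrA -expr2 sqrtrM ?sqr_ge0// sqrtr_sqr.
Qed.

Lemma l2normN f : L2 f -> nrm (- f) = nrm f.
Proof. by move=> Lf; rewrite -scaleN1r l2normZ// normrN1 mul1r. Qed.

Lemma l2norm_distC f g : L2 f -> L2 g -> nrm (f - g) = nrm (g - f).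
Proof. by move=> Lf Lg; rewrite -l2normN ?opprB//; exact: L2B. Qed.

Lemma cauchy_schwarz f g : L2 f -> L2 g -> `|ip f g| <= nrm f * nrm g.
Proof.
move=> Lf Lg.
suff fg : ip f g ^+ 2 <= ip f f * ip g g.
  by rewrite -sqrtr_sqr -sqrtrM ?ip_ge0// ler_wsqrtr.
have q (s t : R) : 0 <= s ^+ 2 * ip f f + 2 * s * t * ip f g + t ^+ 2 * ip g g.
  have := ip_ge0 (s *: f + t *: g).
  have Lsf := L2Z s Lf; have Ltg := L2Z t Lg.
  rewrite ipDl ?ipDr ?ipZl ?ipZr//; try exact: L2D.
  by rewrite (ipC g f); lra.
have [g0|gN0] := eqVneq (ip g g) 0.
  have [->|fgN0] := eqVneq (ip f g) 0.
    by rewrite expr0n/= mulr_ge0 ?ip_ge0.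
  have := q 1 (- (ip f f + 1) / (2 * ip f g)).
  rewrite g0 mulr0 addr0 expr1n mul1r mulr1.
  have -> : 2 * (- (ip f f + 1) / (2 * ip f g)) * ip f g = - (ip f f + 1).
    by field.
  by lra.
have g_gt0 : 0 < ip g g by rewrite lt_def gN0 ip_ge0.
have := q (ip g g) (- ip f g).
have -> : ip g g ^+ 2 * ip f f + 2 * ip g g * - ip f g * ip f g +
  (- ip f g) ^+ 2 * ip g g = ip g g * (ip f f * ip g g - ip f g ^+ 2) by ring.
by rewrite pmulr_rge0// subr_ge0.
Qed.

Lemma ip_le_l2norm f g : L2 f -> L2 g -> ip f g <= nrm f * nrm g.
Proof. by move=> Lf Lg; rewrite (le_trans (ler_norm _))// cauchy_schwarz. Qed.

Lemma l2normD f g : L2 f -> L2 g -> nrm (f + g) <= nrm f + nrm g.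
Proof.
move=> Lf Lg; rewrite -(@ler_pXn2r _ 2)// ?nnegrE ?addr_ge0 ?l2norm_ge0//.
rewrite sqr_l2norm ipDl ?ipDr//; last exact: L2D.
rewrite sqrrD !sqr_l2norm (ipC g f).
by have := ip_le_l2norm Lf Lg; lra.
Qed.

Lemma l2normB f g : L2 f -> L2 g -> nrm (f - g) <= nrm f + nrm g.
Proof.
move=> Lf Lg; rewrite -[X in _ <= _ + X]l2normN//.
by apply: l2normD => //; exact: L2N.
Qed.

Lemma l2norm_sum (I : eqType) (s : seq I) (F : I -> scalar_field R d) :
  (forall i, i \in s -> L2 (F i)) ->
  nrm (\sum_(i <- s) F i) <= \sum_(i <- s) nrm (F i).
Proof.
elim: s => [|i s ih] LF; first by rewrite !big_nil l2norm0.
have LF' j : j \in s -> L2 (F j) by move=> js; apply: LF; rewrite inE js orbT.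
rewrite !big_cons (le_trans (l2normD _ _))//.
- by apply: LF; rewrite mem_head.
- by apply: L2_sum => j js _; exact: LF'.
- by rewrite lerD2l ih.
Qed.

Lemma ip_eq0 f g : L2 f -> L2 g -> nrm f = 0 -> ip f g = 0.
Proof.
move=> Lf Lg f0; apply/eqP; rewrite -normr_le0.
by rewrite (le_trans (cauchy_schwarz Lf Lg))// f0 mul0r.
Qed.

Lemma ip_eql f f' g : L2 f -> L2 f' -> L2 g -> nrm (f - f') = 0 ->
  ip f g = ip f' g.
Proof.
move=> Lf Lf' Lg ff'; apply/eqP; rewrite -subr_eq0 -ipBl//.
by rewrite ip_eq0//; exact: L2B.
Qed.

Lemma ip_ae_eql f f' g : L2 f -> L2 f' -> L2 g -> ae_eq leb Omega f f' ->
  ip f g = ip f' g.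
Proof.
move=> Lf Lf' Lg ff'; rewrite /Defs.ip /Rintegral; congr fine.
apply: ae_eq_integral => //.
- by apply/measurable_EFinP; apply: measurable_funM; [case: Lf|case: Lg].
- by apply/measurable_EFinP; apply: measurable_funM; [case: Lf'|case: Lg].
- by apply: filterS ff' => x xy Ox /=; rewrite xy.
Qed.

End L2_theory.

(** * Lebesgue measure on row vectors *)
Section rV_measure.
Context {R : realType} {n : nat}.
Local Notation Rn := 'rV[R]_n.
Local Notation leb := (@lebesgue_rV R n).

Lemma measurable_coord (i : 'I_n) :
  measurable_fun [set: Rn] (fun v : Rn => v ord0 i).
Proof.
move=> _ B mB; rewrite setTI; apply: sub_sigma_algebra.
by rewrite (bigD1 i)//=; left; exists B => //; rewrite setTI.
Qed.

Let box (q : 'rV[rat]_n) (k : nat) : set Rn :=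
  [set v | forall i, `|ratr (q ord0 i) - v ord0 i| < k.+1%:R^-1].

Let measurable_box q k : measurable (box q k).
Proof.
rewrite (_ : box q k = \bigcap_(i in [set: 'I_n])
    ((fun v : Rn => v ord0 i) @^-1` (ball (ratr (q ord0 i) : R) k.+1%:R^-1))); last first.
  by apply/seteqP; split => v /= h i; [move=> _|]; apply: h.
apply: fin_bigcap_measurable; first exact: finite_finset.
move=> i _; rewrite -[X in measurable X]setTI.
by apply: measurable_coord => //; exact: measurable_ball.
Qed.

(** The sigma-algebra is generated by the coordinates, while the topology is that
of the product; they are related by the countably many boxes with rational
center and radius 1/(k+1). *)
Lemma open_rV_measurable (U : set Rn) : open U -> measurable U.
Proof.
move=> oU.
pose P (p : 'rV[rat]_n * nat) := box p.1 p.2 `<=` U.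
rewrite (_ : U = \bigcup_p (if `[< P p >] then box p.1 p.2 else set0)).
  apply: countable_bigcupT_measurable; first exact: countableP.
  by move=> p; case: ifP => // _.
apply/seteqP; split => [v Uv|v [p _]]; last first.
  by case: ifPn => // /asboolP + ; exact.
have /nbhs_ballP[e /= e0 eU] : nbhs v U by exact: open_nbhs_nbhs.
(* The factor 2 leaves room for the center of the box, which is not v itself. *)
have [k ke] : exists k : nat, 2 * (k.+1%:R^-1 : R) < e.
  have e2 : 0 < e / 2 by rewrite divr_gt0.
  have [k] := ltr_add_invr e2; rewrite add0r ltr_pdivlMr// => ke.
  by exists k; rewrite mulrC.
have k0 : (0 : R) < k.+1%:R^-1 by rewrite invr_gt0.
have ex i : exists q : rat, `|ratr q - v ord0 i| < k.+1%:R^-1 :> R.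
  have : v ord0 i < v ord0 i + k.+1%:R^-1 by rewrite ltrDl.
  move=> /rat_in_itvoo[q]; rewrite in_itv/= => /andP[q1 q2]; exists q.
  move: (k.+1%:R^-1 : R) (ratr q : R) k0 q1 q2 => x y x0 y1 y2.
  by rewrite ltr_norml; apply/andP; split; lra.
have [q hq] := choice ex.
exists ((\row_i q i), k) => //=; case: ifPn => [_|/asboolPn].
  by move=> i; rewrite mxE.
case; move=> w /= bw; apply: eU; split => // i j; rewrite (ord1 i).
have := bw j; rewrite mxE => b1; have := hq j => b2.
rewrite /ball/= -(subrK (ratr (q j)) (v ord0 j)) -addrA.
apply: le_lt_trans (ler_normD _ _) _; rewrite distrC.
by move: (k.+1%:R^-1 : R) ke b1 b2 => x *; lra.
Qed.

Lemma continuous_rV_measurable_fun (D : set Rn) (f : Rn -> R) :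
  measurable D -> continuous f -> measurable_fun D f.
Proof.
move=> mD /continuousP cf; apply: (measurability _ (RGenOpens.measurableE R)).
move=> _ [_ [a [b ->] <-]]; apply: measurableI => //.
by apply: open_rV_measurable; apply: cf; exact: interval_open.
Qed.

Lemma lebesgue_rV_box_lty (c : R) :
  (leb [set v | forall i, (- c <= v ord0 i <= c)%R] < +oo)%E.
Proof.
pose tbox m := [set s : m.-tuple (measurableTypeR R) | forall i, - c <= tnth s i <= c].
have mtbox m : measurable (tbox m).
  rewrite (_ : tbox m = \bigcap_(i in [set: 'I_m])
      ((fun s : m.-tuple (measurableTypeR R) => tnth s i) @^-1` `[- c, c])); last first.
    apply/seteqP; split => v /= h i; last by have := h i I; rewrite /= in_itv.
    by move=> _ /=; rewrite in_itv; exact: h.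
  apply: fin_bigcap_measurable; first exact: finite_finset.
  move=> i _; rewrite -[X in measurable X]setTI.
  by apply: measurable_tnth => //; exact: measurable_itv.
have tbox_lty m : (@lebesgue_tuple R m (tbox m) < +oo)%E.
  elim: m => [|m ih].
    by rewrite /= diracE ltry.
  rewrite /= /lebesgue_cons /pushforward.
  rewrite (_ : _ @^-1` _ = `[- c, c]%classic `*` tbox m); last first.
    apply/seteqP; split=> -[x s] /= h.
      split; first by have := h ord0; rewrite in_itv.
      by move=> i; have := h (lift ord0 i); rewrite tnthS.
    case: h => /= + h i; rewrite in_itv/= => hx.
    case: (unliftP ord0 i) => [j ->|->]; last by rewrite (tnth_nth 0).
    by rewrite tnthS.
  rewrite product_measure1E; [|exact: measurable_itv|exact: mtbox].
  have cfin : (lebesgue_measure (`[(- c)%R, c]%classic : set R) < +oo)%E.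
    by rewrite lebesgue_measure_itv/=; case: ifP => _; rewrite -?EFinB ltry.
  by rewrite lte_mul_pinfty// ge0_fin_numE.
suff : [set s : n.-tuple (measurableTypeR R) |
    forall i, - c <= (\row_j tnth s j : Rn) ord0 i <= c] = tbox n.
  by move=> h; have := tbox_lty n; rewrite -h.
by apply/seteqP; split => s /= h i; have := h i; rewrite mxE.
Qed.
End rV_measure.

(** * Singular integrals on an interval *)

Ltac chain_lra :=
  intros; repeat match goal with
  | H : is_true (andb _ _) |- _ => move/andP: H => [? ?] end;
  repeat match goal with |- is_true (andb _ _) => apply/andP; split end; lra.

Section change_of_variables.
Context {R : realType}.
Local Notation mu := (@lebesgue_measure R).

(** Both sides are measures in A that agree on half-open intervals. *)
Lemma lebesgue_measure_affine (a b : R) (A : set (measurableTypeR R)) :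
  b != 0 -> measurable A ->
  (`|b|%:E * mu ((fun x : R => (a + b * x)%R) @^-1` A) = mu A)%E.
Proof.
move=> b0 mA.
pose phi : measurableTypeR R -> measurableTypeR R := fun x => a + b * x.
have mphi : measurable_fun setT phi.
  by apply: measurable_funD => //; exact: measurable_funM.
pose m : {measure set (measurableTypeR R) -> \bar R} :=
  mscale (NngNum (normr_ge0 b))
    (measure_function_pushforward__canonical__measure_function_Measure mu mphi).
suff mE : mu A = m A by rewrite mE.
have bV0 : b^-1 != 0 by rewrite invr_eq0.
apply: lebesgue_measure_unique => // X [[x y]] _ <- /=.
rewrite /m /mscale /= /pushforward /= lebesgue_measure_itv /=.
have [b_gt0|b_lt0|b00] := ltgtP 0 b; last by rewrite b00 eqxx in b0.
  have -> : phi @^-1` `]x, y] = `](x - a) / b, (y - a) / b]%classic.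
    apply/seteqP; split => z; rewrite /phi /= !in_itv/= ltr_pdivrMr// ler_pdivlMr//;
    by rewrite ltrBlDl lerBrDl (mulrC z).
  rewrite lebesgue_measure_itv/= !lte_fin ltr_pM2r ?invr_gt0// ltrD2r.
  case: ifPn => xy; last by rewrite mule0.
  rewrite -!EFinB -EFinM; congr EFin; rewrite gtr0_norm//.
  by field; exact: b0.
have -> : phi @^-1` `]x, y] = `[(y - a) / b, (x - a) / b[%classic.
  apply/seteqP; split => z; rewrite /phi /= !in_itv/= ltr_ndivlMr// ler_ndivrMr//;
  by rewrite ltrBlDl lerBrDl (mulrC z) andbC.
rewrite lebesgue_measure_itv/= !lte_fin ltr_nM2r ?invr_lt0// ltrD2r.
case: ifPn => xy; last by rewrite mule0.
rewrite -!EFinB -EFinM; congr EFin; rewrite ltr0_norm//.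
by field; exact: b0.
Qed.

Lemma ge0_integral_affine (a b : R) (D : set R) (f : R -> \bar R) :
  b != 0 -> measurable D -> measurable_fun D f -> (forall x, D x -> 0 <= f x)%E ->
  (\int[mu]_(x in D) f x =
   `|b|%:E * \int[mu]_(x in (fun x : R => (a + b * x)%R) @^-1` D) f (a + b * x)%R)%E.
Proof.
move=> b0 mD mf f0.
pose phi : measurableTypeR R -> measurableTypeR R := fun x => a + b * x.
have mphi : measurable_fun setT phi.
  by apply: measurable_funD => //; exact: measurable_funM.
pose m : {measure set (measurableTypeR R) -> \bar R} :=
  measure_function_pushforward__canonical__measure_function_Measure mu mphi.
transitivity (\int[mscale (NngNum (normr_ge0 b)) m]_(x in D) f x)%E.
  apply: eq_measure_integral => A mA _.
  by apply/esym; exact: (lebesgue_measure_affine a b0 mA).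
rewrite ge0_integral_mscale//=; congr (_ * _)%E.
by rewrite ge0_integral_pushforward// => x /set_mem; exact: f0.
Qed.

(** The fundamental theorem of calculus for a derivative that may blow up at
both ends, by monotone convergence from compact subintervals. *)
Lemma ge0_FTC2_oo (f F : R -> R) (a b : R) : a < b ->
  (forall x, a < x < b -> 0 <= f x) ->
  {in `]a, b[, continuous f} ->
  (forall x, a < x < b -> is_derive x 1 F (f x)) ->
  F x @[x --> a^'+] --> F a -> F x @[x --> b^'-] --> F b ->
  (\int[mu]_(x in `]a, b[) (f x)%:E = (F b - F a)%:E)%E.
Proof.
move=> ab f0 cf dF Fa Fb.
pose e (n : nat) : R := (b - a) / n.+3%:R.
have ba : 0 < b - a by rewrite subr_gt0.
have e_gt0 n : 0 < e n by rewrite divr_gt0.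
have e_le n : e n <= (b - a) / 3.
  by rewrite ler_pM2l// lef_pV2 ?posrE// ler_nat.
have e0 : e n @[n --> \oo] --> (0 : R).
  rewrite -(mulr0 (b - a)); apply: cvgMr.
  have := @cvg_harmonic R; rewrite -(cvg_shiftn 2).
  by under eq_fun do rewrite /harmonic addn2.
have e_ni n m : (n <= m)%N -> e m <= e n.
  by move=> nm; rewrite ler_pM2l// lef_pV2 ?posrE// ler_nat.
clearbody e.
pose E n := `[a + e n, b - e n]%classic.
have UE : \bigcup_n E n = `]a, b[%classic.
  apply/seteqP; split => x.
    move=> [n _]; rewrite /E /= !in_itv/= => xn.
    by have := e_gt0 n; chain_lra.
  rewrite /= in_itv/= => /andP[ax xb].
  have m0 : 0 < Num.min (x - a) (b - x) by rewrite lt_min !subr_gt0 ax.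
  move/cvgr_lt : e0 => /(_ _ m0)[n _ /(_ n (leqnn n))].
  rewrite lt_min => /andP[h1 h2]; exists n => //; rewrite /E /= in_itv/=; apply/andP; split; lra.
have En n : (\int[mu]_(x in E n) (f x)%:E = (F (b - e n) - F (a + e n))%:E)%E.
  have lt : a + e n < b - e n by have := e_le n; lra.
  have sub x : a + e n <= x <= b - e n -> a < x < b.
    by have := e_gt0 n; chain_lra.
  have cF x : a + e n <= x <= b - e n -> F y @[y --> x] --> F x.
    move=> /sub /dF; move=> [/derivable1_diffP/differentiable_continuous]; exact.
  rewrite EFinB; apply: continuous_FTC2 => //.
  - apply: continuous_in_subspaceT => x; rewrite inE/= in_itv/= => /sub xab.
    by apply: cf; rewrite in_itv.
  - split.
    + move=> x; rewrite in_itv/= => xe.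
      by case: (dF x _) => //; apply: sub; chain_lra.
    + by apply: cvg_at_right_filter; apply: cF; chain_lra.
    + by apply: cvg_at_left_filter; apply: cF; chain_lra.
  - move=> x; rewrite in_itv/= => xe.
    rewrite derive1E; case: (dF x _) => //; apply: sub; chain_lra.
have cv1 : (\int[mu]_(x in E n) (f x)%:E)%E @[n --> \oo] -->
    (\int[mu]_(x in `]a, b[) (f x)%:E)%E.
  rewrite -UE; apply: ge0_nondecreasing_set_cvg_integral => //.
  - apply/nondecreasing_seqP => n; rewrite subsetEset; apply: subset_itv;
      by rewrite bnd_simp ?lerD2l ?lerN2 e_ni.
  - by move=> n; exact: measurable_itv.
  - move=> n; apply/measurable_EFinP.
    apply: (@measurable_funS _ _ _ _ `]a, b[) => //.
      rewrite -UE; exact: bigcup_sup.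
    apply: open_continuous_measurable_fun => // x /set_mem; exact: cf.
  - move=> n x Ex; rewrite lee_fin f0//.
    have : (\bigcup_n E n) x by exists n.
    by rewrite UE /= in_itv.
have cv2 : (\int[mu]_(x in E n) (f x)%:E)%E @[n --> \oo] --> (F b - F a)%:E.
  under eq_fun do rewrite En.
  apply: cvg_EFin; first exact: nearW.
  apply: cvgB.
    move/cvg_at_leftP : Fb; apply; split.
      by move=> n; rewrite ltrBlDr ltrDl.
    by rewrite -[X in _ --> X]subr0; apply: cvgB => //; exact: cvg_cst.
  move/cvg_at_rightP : Fa; apply; split.
    by move=> n; rewrite ltrDl.
  by rewrite -[X in _ --> X]addr0; apply: cvgD => //; exact: cvg_cst.
exact: cvg_unique cv1 cv2.
Qed.
End change_of_variables.

(** * The Abel kernel and Euler's beta function *)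
Section beta_kernel.
Context {R : realType}.
Local Notation mu := (@lebesgue_measure R).

Lemma integral_powR (p c : R) : 0 < p -> 0 < c ->
  (\int[mu]_(x in `]0%R, c[) (x `^ (p - 1))%:E = (c `^ p / p)%:E)%E.
Proof.
move=> p0 c0; pose F (x : R) := p^-1 * x `^ p.
have dF (x : R) : 0 < x -> is_derive x 1 F (x `^ (p - 1)).
  move=> x0; rewrite /F.
  have -> : x `^ (p - 1) = p^-1 *: (p * x `^ (p - 1)).
    by rewrite /GRing.scale/= mulrA mulVf ?mul1r// gt_eqF.
  by apply: is_deriveZ; exact: is_derive1_powR.
transitivity (F c - F 0)%:E; last first.
  by rewrite /F powR0 ?gt_eqF// mulr0 subr0 mulrC.
apply: (@ge0_FTC2_oo _ _ F) => //.
- by move=> x _; exact: powR_ge0.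
- move=> x; rewrite in_itv/= => /andP[x0 _].
  apply/differentiable_continuous/derivable1_diffP.
  by apply: derivable_powR; rewrite in_itv/= x0.
- by move=> x /andP[x0 _]; exact: dF.
- rewrite /F powR0 ?gt_eqF// mulr0 -[X in _ --> X](mulr0 p^-1).
  by apply: cvgMr; exact: powR_cvg0.
- apply: cvg_at_left_filter.
  by have [/derivable1_diffP/differentiable_continuous] := dF _ c0.
Qed.

Lemma measurable_powR_comp (d : measure_display) (T : measurableType d)
    (D : set T) (g : T -> R) (p : R) :
  measurable_fun D g -> measurable_fun D (fun x => g x `^ p).
Proof.
move=> mg.
exact: (@measurableT_comp _ _ _ T _ _ (fun y : R => y `^ p) D g
  (@measurable_powR R p) mg).
Qed.

Lemma integral_powR_left (p s t : R) : 0 < p -> s < t ->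
  (\int[mu]_(x in `]s, t[) ((t - x) `^ (p - 1))%:E = ((t - s) `^ p / p)%:E)%E.
Proof.
move=> p0 st; rewrite (@ge0_integral_affine _ t (-1))//; last 2 first.
- apply/measurable_EFinP; apply: measurable_powR_comp.
  exact: measurable_funB.
- by move=> x _; rewrite lee_fin powR_ge0.
have -> : (fun x : R => t + -1 * x) @^-1` `]s, t[ = `]0, t - s[%classic.
  by apply/seteqP; split => x; rewrite /= !in_itv/= => ?; chain_lra.
have ts : 0 < t - s by rewrite subr_gt0.
rewrite normrN1 mul1e -(integral_powR p0 ts).
by apply: eq_integral => x _; congr (_ `^ _)%:E; lra.
Qed.

(** The value B(1 - a, a) of Euler's beta function. *)
Definition euler_beta (a : R) : \bar R :=
  (\int[mu]_(x in `]0%R, 1%R[) (x `^ (- a) * (1 - x) `^ (a - 1))%:E)%E.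

Lemma measurable_abel_kernel (D : set R) (s t p q : R) :
  measurable_fun D (fun x => ((t - x) `^ p * (x - s) `^ q)%:E).
Proof.
apply/measurable_EFinP; apply: measurable_funM;
  by apply: measurable_powR_comp; exact: measurable_funB.
Qed.

(** Abel's identity: the convolution of the kernels of the fractional integral
and of the fractional derivative is constant, since the exponents add up to
-1. *)
Lemma integral_abel_kernel (a s t : R) : s < t ->
  (\int[mu]_(x in `]s, t[) ((t - x) `^ (a - 1) * (x - s) `^ (- a))%:E =
   euler_beta a)%E.
Proof.
move=> st; have ts : 0 < t - s by rewrite subr_gt0.
rewrite (@ge0_integral_affine _ s (t - s))//; last 3 first.
- by rewrite gt_eqF.
- exact: measurable_abel_kernel.
- by move=> x _; rewrite lee_fin mulr_ge0// powR_ge0.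
have -> : (fun x : R => s + (t - s) * x) @^-1` `]s, t[ = `]0, 1[%classic.
  apply/seteqP; split => x; rewrite /= !in_itv/= => /andP[x0 x1].
    by apply/andP; split; nra.
  by apply/andP; split; nra.
rewrite gtr0_norm// -ge0_integralZl_EFin//; last 3 first.
- by move=> x _; rewrite lee_fin mulr_ge0// powR_ge0.
- apply/measurable_EFinP; apply: measurable_funM; apply: measurable_powR_comp.
    by apply: measurable_funB => //; apply: measurable_funD => //; exact: measurable_funM.
  by apply: measurable_funB => //; apply: measurable_funD => //; exact: measurable_funM.
- exact: ltW.
apply: eq_integral => x; rewrite inE/= in_itv/= => /andP[x0 x1].
rewrite -EFinM; congr EFin.
have -> : t - (s + (t - s) * x) = (t - s) * (1 - x) by ring.
have -> : s + (t - s) * x - s = (t - s) * x by ring.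
rewrite !powRM ?ltW ?subr_gt0//.
have -> : (t - s) * ((t - s) `^ (a - 1) * (1 - x) `^ (a - 1) *
  ((t - s) `^ (- a) * x `^ (- a))) = (t - s) * (t - s) `^ (a - 1) * (t - s) `^ (- a)
   * (x `^ (- a) * (1 - x) `^ (a - 1)) by ring.
suff -> : (t - s) * (t - s) `^ (a - 1) * (t - s) `^ (- a) = 1 by rewrite mul1r.
have tsN0 : t - s != 0 by rewrite gt_eqF.
rewrite -{1}(powRr1 (ltW ts)) -!powRD ?tsN0 ?implybT//.
have -> : 1 + (a - 1) + - a = 0 by ring.
by rewrite powRr0.
Qed.

(** On each half of the unit interval one of the two factors is bounded, so that
the integrand is at most a multiple of the sum of the two powers. *)
Lemma euler_beta_lty (a : R) : 0 < a < 1 -> (euler_beta a < +oo)%E.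
Proof.
move=> /andP[a0 a1].
have g0 (x : R) : (0 <= (x `^ (- a) + (1 - x) `^ (a - 1))%:E)%E.
  by rewrite lee_fin addr_ge0// powR_ge0.
pose c : R := (2^-1 `^ a)^-1 + (2^-1 `^ (1 - a))^-1.
have c0 : 0 <= c by rewrite addr_ge0// invr_ge0 powR_ge0.
have m1 : measurable_fun (`]0, 1[%classic : set R) (fun x : R => (x `^ (- a))%:E).
  by apply/measurable_EFinP; exact: measurable_powR_comp.
have m2 : measurable_fun (`]0, 1[%classic : set R) (fun x : R => ((1 - x) `^ (a - 1))%:E).
  by apply/measurable_EFinP; apply: measurable_powR_comp; exact: measurable_funB.
apply: (@le_lt_trans _ _ (\int[mu]_(x in `]0%R, 1%R[)
   (c%:E * ((x `^ (- a))%:E + ((1 - x) `^ (a - 1))%:E))))%E.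
  apply: ge0_le_integral => //.
  - by move=> x _; rewrite lee_fin mulr_ge0// powR_ge0.
  - apply/measurable_EFinP; apply: measurable_funM; apply: measurable_powR_comp => //.
    exact: measurable_funB.
  - by apply: measurable_funeM; exact: emeasurable_funD.
  - move=> x; rewrite /= in_itv/= => /andP[x0 x1].
    rewrite -EFinD -EFinM lee_fin.
    have h (y p : R) : 2^-1 <= y -> 0 <= p -> y `^ (- p) <= (2^-1 `^ p)^-1.
      move=> y2 p0; have h0 : (0 : R) < 2^-1 by rewrite invr_gt0.
      have y0 : 0 < y by rewrite (lt_le_trans h0).
      rewrite powRN lef_pV2 ?posrE ?powR_gt0//.
      by rewrite ge0_ler_powR// nnegrE ltW.
    have pa := powR_ge0 x (- a); have pb := powR_ge0 (1 - x) (a - 1).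
    have ca : 0 <= (2^-1 `^ a : R)^-1 by rewrite invr_ge0 powR_ge0.
    have cb : 0 <= (2^-1 `^ (1 - a) : R)^-1 by rewrite invr_ge0 powR_ge0.
    have [x2|x2] := leP x 2^-1.
      have : (1 - x) `^ (a - 1) <= (2^-1 `^ (1 - a))^-1.
        by rewrite -[a - 1]opprB h//; lra.
      by rewrite /c; nra.
    have : x `^ (- a) <= (2^-1 `^ a)^-1 by apply: h; lra.
    by rewrite /c; nra.
rewrite ge0_integralZl_EFin//; last exact: emeasurable_funD.
rewrite ge0_integralD//; last 2 first.
- by move=> x _; rewrite lee_fin powR_ge0.
- by move=> x _; rewrite lee_fin powR_ge0.
have -> : - a = (1 - a) - 1 by ring.
rewrite (integral_powR _ ltr01) ?subr_gt0//.
by rewrite (integral_powR_left a0 ltr01) -EFinD -EFinM ltry.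
by move=> x _; exact: g0.
Qed.

Lemma powR_kernel_inv (a y : R) : 0 < y -> y `^ (- a) * y `^ (a - 1) = y^-1.
Proof.
move=> y0; have yN0 : y != 0 by rewrite gt_eqF.
rewrite -powRD; last by rewrite yN0 implybT.
rewrite (_ : - a + (a - 1) = -1); last by ring.
by rewrite powR_inv1// ltW.
Qed.

Lemma is_derive_asin_affine (x : R) : 0 < x < 1 ->
  is_derive x 1 (fun y : R => asin (2 * y - 1)) (Num.sqrt (x * (1 - x)))^-1.
Proof.
move=> /andP[x0 x1].
have x11 : -1 < 2 * x - 1 < 1 by apply/andP; split; lra.
have dl : is_derive x 1 (fun y : R => 2 * y - 1) 2.
  by apply: is_derive_eq; rewrite subr0 scaler1.
have := @is_derive1_comp _ (@asin R) _ x _ _ (is_derive1_asin x11) dl.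
have n2 : (2 : R) != 0 by [].
have n20 : (0 : R) <= 2 by [].
have -> : 1 - (2 * x - 1) ^+ 2 = 2 ^+ 2 * (x * (1 - x)) by ring.
rewrite (sqrtrM _ (sqr_ge0 2)) sqrtr_sqr (ger0_norm n20) invfM.
by rewrite mulrAC (mulVf n2) mul1r.
Qed.

Lemma sqrt_am_gm (p q r : R) : 0 <= p -> 0 <= q -> 0 <= r -> p * q = r ^+ 2 ->
  2 * r <= p + q.
Proof.
move=> p0 q0 r0 pq; have pq0 : 0 <= p + q by rewrite addr_ge0.
have r20 : 0 <= 2 * r by rewrite mulr_ge0.
rewrite -(@ler_pXn2r _ 2)//.
by have := sqr_ge0 (p - q); rewrite exprMn -pq; lra.
Qed.

Lemma sin_pihalf_lt1 (z : R) : 0 < z < pi / 2 -> 0 < sin z /\ sin z < 1.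
Proof.
move=> /[dup] z02 /andP[z0 zpi]; split; first exact: sin_gt0_pihalf.
have zpi' : - (pi / 2) < z < pi / 2 by apply/andP; split; lra.
have c0 : 0 < cos z by exact: cos_gt0_pihalf.
have := cos2Dsin2 z; have := exprn_gt0 2 c0.
by move: (cos z ^+ 2) => c; nra.
Qed.

(** With the primitive asin (2 x - 1). The interval exhausts the unit interval as z
tends to pi / 2, which gives the value pi for the full integral without a limit
at the singular end points. *)
Lemma integral_arcsine (z : R) : 0 < z < pi / 2 ->
  (\int[mu]_(x in `[((1 - sin z) / 2)%R, ((1 + sin z) / 2)%R])
     (Num.sqrt (x * (1 - x)))^-1%:E = (2 * z)%:E)%E.
Proof.
move=> /andP[z0 zpi].
have z02 : 0 < z < pi / 2 by rewrite z0.
have [s0 s1] := sin_pihalf_lt1 z02.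
move: (sin z) (@sinK R z) (@sinK R (- z)) (sinN z) s0 s1.
move=> s sK sNK sN s0 s1; rewrite sN in sNK.
set l := (1 - s) / 2; set r := (1 + s) / 2.
have l0 : 0 < l by rewrite /l; lra.
have r1 : r < 1 by rewrite /r; lra.
have lr : l < r by rewrite /l/r; lra.
have rE : 2 * r - 1 = s by rewrite /r; field.
have lE : 2 * l - 1 = - s by rewrite /l; field.
pose g (x : R) : R := (Num.sqrt (x * (1 - x)))^-1.
have dG (x : R) : 0 < x < 1 -> is_derive x 1 (fun y : R => asin (2 * y - 1)) (g x).
  exact: is_derive_asin_affine.
have cg : {within `[l, r], continuous g}.
  apply: continuous_in_subspaceT => x; rewrite inE/= in_itv/= => /andP[lx xr].
  apply: cvgV.
    have : 0 < x * (1 - x) by apply: mulr_gt0; lra.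
    by rewrite -sqrtr_gt0 => /gt_eqF ->.
  apply: (@continuous_comp _ _ _ (fun x : R => x * (1 - x)) Num.sqrt).
    apply: cvgM; first exact: cvg_id.
    by apply: cvgB; [exact: cvg_cst|exact: cvg_id].
  exact: sqrt_continuous.
have cG (x : R) : 0 < x < 1 ->
    (fun y : R => asin (2 * y - 1)) y @[y --> x] --> asin (2 * x - 1).
  by move=> x01; have [/derivable1_diffP/differentiable_continuous] := dG _ x01.
rewrite (@continuous_FTC2 _ g (fun y : R => asin (2 * y - 1)))//.
- rewrite rE lE sK ?sNK ?in_itv/=; last 2 first.
  + by apply/andP; split; lra.
  + by apply/andP; split; lra.
  by rewrite -EFinB; congr EFin; ring.
- split.
  + move=> x; rewrite in_itv/= => /andP[lx xr].
    by case: (dG x _) => //; apply/andP; split; lra.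
  + by apply: cvg_at_right_filter; apply: cG; apply/andP; split; lra.
  + by apply: cvg_at_left_filter; apply: cG; apply/andP; split; lra.
- move=> x; rewrite in_itv/= => /andP[lx xr].
  have x01 : 0 < x < 1 by apply/andP; split; lra.
  by rewrite derive1E (@derive_val _ _ _ _ _ _ _ (dG x x01)).
Qed.

Lemma euler_beta_ge0 (a : R) : (0 <= euler_beta a)%E.
Proof.
apply: integral_ge0 => x _; rewrite lee_fin.
by apply: mulr_ge0; exact: powR_ge0.
Qed.

(** Symmetry doubles the integral of k into that of x |-> k x + k (1 - x), which
dominates 2 g pointwise. *)
Lemma le_integral_symmetrization (g k : R -> R) (D : set R) :
  measurable D -> D `<=` `]0, 1[ ->
  (forall D, measurable_fun D g) -> (forall D, measurable_fun D k) ->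
  (forall x, 0 <= g x) -> (forall x, 0 <= k x) ->
  (\int[mu]_(x in `]0%R, 1%R[) (k x)%:E =
   \int[mu]_(x in `]0%R, 1%R[) (k (1 - x))%:E)%E ->
  (forall x, 0 < x < 1 -> 2 * g x <= k x + k (1 - x)) ->
  (\int[mu]_(x in D) (g x)%:E <= \int[mu]_(x in `]0%R, 1%R[) (k x)%:E)%E.
Proof.
move=> mD D01 mg mk g0 k0 sym gk.
have mk' E : measurable_fun E (fun x => (k x)%:E) by apply/measurable_EFinP.
have mg' E : measurable_fun E (fun x => (g x)%:E) by apply/measurable_EFinP.
have mk1 E : measurable_fun E (fun x : R => (k (1 - x))%:E).
  apply/measurable_EFinP; apply: measurableT_comp; first exact: mk.
  exact: measurable_funB.
have ge0k x : (0 <= (k x)%:E)%E by rewrite lee_fin.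
have ge0g x : (0 <= (g x)%:E)%E by rewrite lee_fin.
have two : (2%:E = 1%:E + 1%:E :> \bar R)%E by rewrite -EFinD.
have kk : (2%:E * \int[mu]_(x in `]0%R, 1%R[) (k x)%:E =
    \int[mu]_(x in `]0%R, 1%R[) ((k x)%:E + (k (1 - x))%:E))%E.
  rewrite two ge0_muleDl// !mul1e [X in (_ + X = _)%E]sym ge0_integralD//.
    exact: mk'.
  exact: mk1.
have gg : (2%:E * \int[mu]_(x in D) (g x)%:E =
    \int[mu]_(x in D) (2%:E * (g x)%:E))%E.
  by rewrite ge0_integralZl_EFin//; exact: mg'.
have : (2%:E * \int[mu]_(x in D) (g x)%:E <=
    2%:E * \int[mu]_(x in `]0%R, 1%R[) (k x)%:E)%E.
  rewrite kk gg.
  apply: (@le_trans _ _ (\int[mu]_(x in D) ((k x)%:E + (k (1 - x))%:E))%E).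
    apply: ge0_le_integral => //.
    - by move=> x _; apply: mule_ge0.
    - by apply: measurable_funeM; exact: mg'.
    - by apply: emeasurable_funD; [exact: mk'|exact: mk1].
    - by move=> x /D01; rewrite /= in_itv/= => x01; rewrite -EFinM -EFinD lee_fin gk.
  apply: ge0_subset_integral => //.
    by apply: emeasurable_funD; [exact: mk'|exact: mk1].
  by move=> x _; apply: adde_ge0.
have fin2 : (2%:E : \bar R) \is a fin_num by [].
have gt02 : (0 < (2%:E : \bar R))%E by rewrite lte_fin.
by rewrite (lee_pmul2l fin2 gt02).
Qed.

Lemma pi_le_ereal (b : \bar R) : (0 <= b)%E ->
  (forall z, 0 < z < pi / 2 -> ((2 * z)%:E <= b)%E) -> (pi%:E <= b)%E.
Proof.
case: b => [b||] b0 bound; last 2 first.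
- by rewrite leey.
- by [].
rewrite lee_fin in b0; rewrite leNgt; apply/negP; rewrite lte_fin => bpi.
have p0 := @pi_gt0 R.
have /bound : 0 < (b + pi) / 4 < pi / 2 by apply/andP; split; lra.
by rewrite lee_fin; lra.
Qed.

(** For 0 < a < 1 Euler's reflection formula gives the value pi / sin (pi a). The
lower bound follows from symmetrization under the reflection of the unit
interval and the AM-GM inequality, which compare the integrand with the arcsine
density, the case a = 1/2. *)
Lemma pi_le_euler_beta (a : R) : (pi%:E <= euler_beta a)%E.
Proof.
pose k (x : R) := (x `^ (- a) * (1 - x) `^ (a - 1)).
have mk D : measurable_fun D k.
  apply: measurable_funM; apply: measurable_powR_comp => //.
  exact: measurable_funB.
have mk1 : measurable_fun (`]0, 1[%classic : set R) (fun x : R => (k (1 - x))%:E).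
  apply/measurable_EFinP; apply: measurableT_comp; first exact: mk.
  exact: measurable_funB.
have sym : (euler_beta a = \int[mu]_(x in `]0%R, 1%R[) (k (1 - x))%:E)%E.
  rewrite /euler_beta (@ge0_integral_affine _ 1 (-1))//; last 2 first.
  - by apply/measurable_EFinP; exact: mk.
  - by move=> x _; rewrite lee_fin mulr_ge0// powR_ge0.
  have -> : (fun x : R => 1 + -1 * x) @^-1` `]0, 1[ = `]0, 1[%classic.
    by apply/seteqP; split => x; rewrite /= !in_itv/= => ?; chain_lra.
  rewrite normrN1 mul1e.
  by apply: eq_integral => x _; rewrite /k mulN1r.
pose g (x : R) : R := (Num.sqrt (x * (1 - x)))^-1.
have kg (x : R) : 0 < x < 1 -> 2 * g x <= k x + k (1 - x).
  move=> /andP[x0 x1].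
  have x1' : 0 < 1 - x by rewrite subr_gt0.
  have k0 y : 0 <= k y by apply: mulr_ge0; exact: powR_ge0.
  have kk : k x * k (1 - x) = g x ^+ 2.
    clear k0; rewrite /k subKr /g exprVn sqr_sqrtr; last by rewrite mulr_ge0 ?ltW.
    rewrite invfM -(powR_kernel_inv a x0) -(powR_kernel_inv a x1').
    by ring.
  have g_ge0 : 0 <= g x by rewrite invr_ge0 sqrtr_ge0.
  exact: sqrt_am_gm (k0 x) (k0 _) g_ge0 kk.
have mg D : measurable_fun D g.
  have -> : g = fun x => (Num.sqrt (x * (1 - x))) `^ (-1).
    by apply/funext => x; rewrite powR_inv1 ?sqrtr_ge0.
  apply: measurable_powR_comp; apply: measurableT_comp.
    exact: continuous_measurable_fun (@sqrt_continuous R).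
  by apply: measurable_funM; [exact: measurable_id|exact: measurable_funB].
have bound (z : R) : 0 < z < pi / 2 -> ((2 * z)%:E <= euler_beta a)%E.
  move=> z02; have [s0 s1] := sin_pihalf_lt1 z02.
  rewrite -(integral_arcsine z02).
  have k0 x : 0 <= k x by apply: mulr_ge0; exact: powR_ge0.
  have g0 x : 0 <= g x by rewrite /g invr_ge0; exact: sqrtr_ge0.
  refine (le_integral_symmetrization _ _ mg mk g0 k0 sym kg).
    exact: measurable_itv.
  by move=> x; rewrite /= !in_itv/=; move: (sin z) s0 s1 => ? ? ? ?; chain_lra.
exact: pi_le_ereal (euler_beta_ge0 a) bound.
Qed.
End beta_kernel.

(** * Tonelli's theorem for Volterra kernels *)
Section tonelli.
Context {R : realType}.
Local Notation mu := (@lebesgue_measure R).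

(** The integral of a nonnegative function is a supremum over simple functions
below it, so that it is monotone even where the larger function is not
measurable. *)
Lemma ge0_le_lower_integral (d : measure_display) (T : measurableType d)
    (m : {measure set T -> \bar R}) (D1 D2 : set T) (f1 f2 : T -> \bar R) :
  D1 `<=` D2 -> (forall x, D1 x -> 0 <= f1 x)%E -> (forall x, D2 x -> 0 <= f2 x)%E ->
  (forall x, D1 x -> f1 x <= f2 x)%E ->
  (\int[m]_(x in D1) f1 x <= \int[m]_(x in D2) f2 x)%E.
Proof.
move=> D12 f10 f20 f12; rewrite !ge0_integralE//.
apply: le_ereal_sup => _ [h hf <-]; exists h => //= x.
apply: (le_trans (hf x)); rewrite !patchE.
case: ifPn => [/set_mem D1x|_].
  by rewrite mem_set ?f12//; exact: D12.
by case: ifPn => // /set_mem /f20.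
Qed.

Lemma bounded_integrable (D : set R) (h : R -> R) (L : R) :
  measurable D -> (mu D < +oo)%E -> measurable_fun D h ->
  (forall s, D s -> `|h s| <= L) -> mu.-integrable D (EFin \o h).
Proof.
move=> mD muD mh hL; apply: measurable_bounded_integrable => //.
exists L; split; first exact: num_real.
by move=> M LM s Ds /=; rewrite (le_trans (hL s Ds))// ltW.
Qed.

Section kernel.
Variables (K : R -> R -> R) (t B : R).
Hypothesis mK : measurable_fun [set: R * R] (fun z => K z.1 z.2).
Hypothesis B0 : 0 <= B.
Hypothesis K0 : forall s r, 0 <= K s r.
Hypothesis intK : forall s, 0 < s < t ->
  (\int[mu]_(r in `]s, t[) (K s r)%:E = B%:E)%E.

Let F (h : R -> R) (z : R * R) : \bar R :=
  (if [&& 0 < z.1, z.1 < z.2 & z.2 < t] then K z.1 z.2 * h z.1 else 0)%:E.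

Let mF (h : R -> R) : measurable_fun setT h -> measurable_fun setT (F h).
Proof.
move=> mh; apply/measurable_EFinP; apply: measurable_fun_ifT => //.
- apply: measurable_and; first exact: measurable_fun_ltr.
  apply: measurable_and; first exact: measurable_fun_ltr.
  exact: measurable_fun_ltr.
- by apply: measurable_funM => //; exact: measurableT_comp.
Qed.

Let F0 (h : R -> R) : (forall s, 0 <= h s) -> forall z, (0 <= F h z)%E.
Proof. by move=> h0 z; rewrite /F lee_fin; case: ifP => // _; rewrite mulr_ge0. Qed.

Let FE1 h r : (\int[mu]_s F h (s, r) =
  if (0 < r < t)%R then \int[mu]_(s in `]0%R, r[) (K s r * h s)%:E else 0)%E.
Proof.
case: ifPn => r0t.
  rewrite [RHS]integral_mkcond; apply: eq_integral => s _.
  rewrite patchE /F /=; case/andP: r0t => r0 rt; rewrite rt andbT.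
  by rewrite mem_setE in_itv/=; case: ifP.
apply: integral0_eq => s _; rewrite /F /=; case: ifPn => // /and3P[s0 sr rt].
by case/negP: r0t; rewrite rt (lt_trans s0).
Qed.

Let FE2 (h : R -> R) (s : R) : (forall s, 0 <= h s) -> (\int[mu]_r F h (s, r) =
  if (0 < s < t)%R then B%:E * (h s)%:E else 0)%E.
Proof.
move=> h0; case: ifPn => s0t.
  rewrite -(intK s0t) -ge0_integralZr//; last 3 first.
  - apply/measurable_EFinP; apply: (measurable_funS measurableT) => //.
    exact: (measurableT_comp mK (measurable_pair1 s)).
  - by move=> r _; rewrite lee_fin.
  - by rewrite lee_fin.
  rewrite [RHS]integral_mkcond; apply: eq_integral => r _.
  rewrite patchE /F /=; case/andP: s0t => s0 st; rewrite s0 /=.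
  by rewrite mem_setE in_itv/=; case: ifP.
apply: integral0_eq => r _; rewrite /F /=; case: ifPn => // /and3P[s0 sr rt].
by case/negP: s0t; rewrite s0 (lt_trans sr).
Qed.

(** Tonelli's theorem on the triangle 0 < s < r < t, for a kernel whose integral in
its second variable does not depend on the first. *)
Lemma integral_volterra (h : R -> R) : measurable_fun setT h ->
  (forall s, 0 <= h s) ->
  measurable_fun `]0%R, t[
    (fun r => \int[mu]_(s in `]0%R, r[) (K s r * h s)%:E)%E /\
  (\int[mu]_(r in `]0%R, t[) \int[mu]_(s in `]0%R, r[) (K s r * h s)%:E =
   B%:E * \int[mu]_(s in `]0%R, t[) (h s)%:E)%E.
Proof.
move=> mh h0; split.
  have := measurable_fun_fubini_tonelli_G (m1 := mu) _ (mF mh) (F0 h0).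
  move=> /(measurable_funS measurableT (@subsetT _ `]0%R, t[)).
  apply: eq_measurable_fun => r; rewrite inE/= in_itv/= => r0t.
  by rewrite /fubini_G FE1 r0t.
transitivity (\int[mu]_r \int[mu]_s F h (s, r))%E.
  rewrite integral_mkcond; apply: eq_integral => r _.
  by rewrite FE1 patchE mem_setE in_itv.
rewrite -(fubini_tonelli (m1 := mu) (m2 := mu) _ (mF mh) (F0 h0)).
rewrite -ge0_integralZl//.
- rewrite [RHS]integral_mkcond; apply: eq_integral => s _.
  by rewrite FE2// patchE mem_setE in_itv.
- by apply/measurable_EFinP; exact: measurable_funS mh.
- by move=> s _; rewrite lee_fin.
Qed.

(** Tonelli's theorem for a bounded density of arbitrary sign, which becomes
nonnegative after adding a constant. Only the positive part of the inner
integral is retained, so that it can be compared with a nonnegative function. *)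
Lemma le_integral_volterra (g : R -> R) (L : R) : measurable_fun setT g ->
  (forall s, `|g s| <= L) ->
  (forall r, (0 < r < t)%R -> \int[mu]_(s in `]0%R, r[) (K s r)%:E < +oo)%E ->
  let D r := \int[mu]_(s in `]0, r[) (K s r * g s) in
  measurable_fun `]0, t[ D /\
  ((B * \int[mu]_(s in `]0, t[) g s)%:E <=
   \int[mu]_(r in `]0%R, t[) (Num.max 0 (D r))%:E)%E.
Proof.
move=> mg gL finK D.
have L0 : 0 <= L by rewrite (le_trans _ (gL 0)).
have mKr r D' : measurable D' -> measurable_fun D' (fun s => K s r).
  move=> mD'; apply: (measurable_funS measurableT) => //.
  exact: (measurableT_comp mK (measurable_pair2 r)).
have iK r : 0 < r < t -> mu.-integrable `]0, r[ (fun s => (K s r)%:E).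
  move=> r0t; apply/integrableP; split; first by apply/measurable_EFinP; exact: mKr.
  rewrite (_ : (\int[mu]_(x in _) _)%E = (\int[mu]_(s in `]0%R, r[) (K s r)%:E)%E).
    exact: finK.
  by apply: eq_integral => s _; rewrite abse_EFin ger0_norm.
have iKh (h : R -> R) (c : R) r : 0 < r < t -> measurable_fun setT h -> (forall s, `|h s| <= c) ->
    mu.-integrable `]0, r[ (fun s => (K s r * h s)%:E).
  move=> r0t mh hc.
  have : mu.-integrable `]0, r[ (fun s => c%:E * (K s r)%:E)%E.
    by apply: integrableZl => //; exact: iK.
  apply: le_integrable => //.
    apply/measurable_EFinP; apply: measurable_funM; first exact: mKr.
    exact: measurable_funS mh.
  move=> s _; rewrite -EFinM !abse_EFin lee_fin.
  rewrite (le_trans _ (ler_norm _))// normrM (ger0_norm (K0 s r)) mulrC.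
  by apply: ler_wpM2r; [exact: K0|exact: hc].
pose g1 s := g s + L.
have mg1 : measurable_fun setT g1 by exact: measurable_funD.
have mL : measurable_fun setT (fun _ : R => L) by exact: measurable_cst.
have g10 s : 0 <= g1 s.
  by move: (gL s); rewrite ler_norml /g1 => /andP[h _]; lra.
have g12 s : `|g1 s| <= 2 * L.
  by rewrite ger0_norm//; move: (gL s); rewrite ler_norml /g1 => /andP[_ h]; lra.
have [m1 e1] := integral_volterra mg1 g10.
have [m2 e2] := integral_volterra mL (fun _ => L0).
have DE r : 0 < r < t ->
    (\int[mu]_(s in `]0%R, r[) (K s r * g1 s)%:E =
     (D r)%:E + \int[mu]_(s in `]0%R, r[) (K s r * L)%:E)%E.
  move=> r0t; rewrite /D /Rintegral fineK; last first.
    by apply: integrable_fin_num => //; exact: (iKh g L).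
  rewrite -integralD//; last 2 first.
  - exact: (iKh g L).
  - by apply: (iKh (fun=> L) L) => // s; rewrite ger0_norm.
  by apply: eq_integral => s _; rewrite -EFinD mulrDr.
have finL r : 0 < r < t ->
    (\int[mu]_(s in `]0%R, r[) (K s r * L)%:E)%E \is a fin_num.
  move=> r0t; apply: integrable_fin_num => //.
  by apply: (iKh (fun=> L) L) => // s; rewrite ger0_norm.
have mD : measurable_fun `]0, t[ D.
  apply/measurable_EFinP.
  have := emeasurable_funB m1 m2.
  apply: eq_measurable_fun => r; rewrite inE/= in_itv/= => r0t.
  by rewrite DE//= addeK// finL.
split => //.
have mDp : measurable_fun `]0, t[ (fun r => (Num.max 0 (D r))%:E).
  by apply/measurable_EFinP; apply: measurable_maxr.
have mu0t : (mu `]0%R, t[ < +oo)%E.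
  by rewrite lebesgue_measure_itv/=; case: ifP => _; rewrite -?EFinB ltry.
have ic : mu.-integrable `]0, t[ (EFin \o cst L).
  by apply: (@bounded_integrable _ _ L) => // s _; rewrite ger0_norm.
have ig : mu.-integrable `]0, t[ (EFin \o g).
  by apply: (@bounded_integrable _ _ L) => //; exact: measurable_funS mg.
have kL0 r : (0 <= \int[mu]_(s in `]0%R, r[) (K s r * L)%:E)%E.
  by apply: integral_ge0 => s _; rewrite lee_fin mulr_ge0.
have key : (B%:E * \int[mu]_(s in `]0%R, t[) (g1 s)%:E <=
  \int[mu]_(r in `]0%R, t[) (Num.max 0 (D r))%:E +
  B%:E * \int[mu]_(s in `]0%R, t[) L%:E)%E.
  rewrite -e1 -e2 -ge0_integralD//; last first.
    by move=> r _; rewrite lee_fin le_max lexx.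
  apply: ge0_le_integral => //.
  - by move=> r _; apply: integral_ge0 => s _; rewrite lee_fin mulr_ge0.
  - exact: emeasurable_funD.
  - move=> r; rewrite /= in_itv/= => r0t; rewrite DE// leeD2r// lee_fin.
    by rewrite le_max lexx orbT.
have g1E : (\int[mu]_(s in `]0%R, t[) (g1 s)%:E =
    (\int[mu]_(s in `]0, t[) g s)%:E + \int[mu]_(s in `]0%R, t[) L%:E)%E.
  rewrite /Rintegral fineK; last exact: integrable_fin_num.
  by rewrite -integralD.
have /fineK cE : (\int[mu]_(s in `]0%R, t[) L%:E)%E \is a fin_num.
  exact: integrable_fin_num.
move: key; rewrite g1E -cE; set c := fine _; set G := Rintegral _ _ _.
case: (integral _ _ _) => [x| |]; rewrite -?EFinD -?EFinM ?lee_fin.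
- by rewrite mulrDr lerD2r.
- by move=> _; exact: leey.
- by rewrite addNye leNgt ltNyr.
Qed.
End kernel.
End tonelli.

(** * Sobolev spaces on a bounded open domain *)
Section polytope_facts.
Context {R : realType} {d : nat} (Omega : set 'rV[R]_d).
Hypothesis HOmega : polytope Omega.

Lemma polytope_open : open Omega.
Proof. by case: HOmega => _ [m [P ->]]; exact: open_interior. Qed.

(** A convex combination of the vertices is bounded by the sum of their entries. *)
Lemma polytope_bounded : exists c : R, Omega `<=` [set v | forall i, - c <= v ord0 i <= c].
Proof.
case: HOmega => _ [m [P ->]]; exists (\sum_i \sum_j `|P i j|).
move=> x /(@interior_subset _ _) [l [l0 l1 ->]] j.
rewrite -ler_norml mxE (le_trans (ler_norm_sum _ _ _))//.
apply: ler_sum => i _; rewrite normrM ger0_norm//.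
have li : l ord0 i <= 1 by rewrite -l1 (bigD1 i)//= lerDl sumr_ge0.
rewrite (bigD1 j)//= -[leLHS]addr0 lerD//.
  by rewrite ler_piMl.
by rewrite sumr_ge0.
Qed.

End polytope_facts.

Lemma twice_quarters_lt (R : realType) (a b e : R) :
  a < e / 2 ^+ 2 -> b < e / 2 ^+ 2 -> 2 * a + 2 * b < e.
Proof. by lra. Qed.

Section domain.
Context {R : realType} {d : nat} (Omega : set 'rV[R]_d) (c : R).
Hypothesis oOmega : open Omega.
Hypothesis bOmega : Omega `<=` [set v | forall i, - c <= v ord0 i <= c].
Local Notation leb := (@lebesgue_rV R d).
Local Notation Rd := 'rV[R]_d.

Lemma open_domain_measurable : measurable Omega.
Proof. exact: open_rV_measurable. Qed.
Local Notation mOmega := open_domain_measurable.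

Lemma bounded_domain_lty : (leb Omega < +oo)%E.
Proof.
have mbox : measurable [set v : Rd | forall i, - c <= v ord0 i <= c].
  rewrite (_ : [set v : Rd | _] = \bigcap_(i in [set: 'I_d])
      ((fun v : Rd => v ord0 i) @^-1` `[- c, c])); last first.
    apply/seteqP; split => v /= h i; last by have := h i I; rewrite /= in_itv.
    by move=> _ /=; rewrite in_itv; exact: h.
  apply: fin_bigcap_measurable; first exact: finite_finset.
  move=> i _; rewrite -[X in measurable X]setTI.
  by apply: measurable_coord => //; exact: measurable_itv.
apply: le_lt_trans (lebesgue_rV_box_lty c); apply: le_measure => //.
- by rewrite inE; exact: mOmega.
- by rewrite inE.
Qed.

Lemma continuous_bounded_domain (f : Rd -> R) : continuous f ->
  exists K : R, forall x, Omega x -> `|f x| <= K.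
Proof.
move=> cf.
pose B := [set v : Rd | forall i, `[- c, c]%classic (v ord0 i)].
have cB : compact B.
  apply: (@rV_compact R d (fun=> `[- c, c]%classic)) => i; exact: segment_compact.
have cfB : {within B, continuous f} by apply: continuous_subspaceT.
have [M [_ hM]] := compact_bounded (continuous_compact cfB cB).
exists (M + 1) => x /bOmega bx; apply: (hM (M + 1)); first by rewrite ltrDl.
by exists x => // i; rewrite /= in_itv/=; exact: bx.
Qed.

Lemma L2_bounded (f : scalar_field R d) (K : R) :
  measurable_fun Omega (f : Rd -> R) -> (forall x, Omega x -> `|f x| <= K) ->
  L2 Omega f.
Proof.
move=> mf fK; split => //.
apply: (@measurable_bounded_integrable _ _ _ _ (fun x => f x ^+ 2)).
- exact: mOmega.
- exact: bounded_domain_lty.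
- exact: measurable_funX.
- exists (K ^+ 2); split; first exact: num_real.
  move=> M KM x Ox /=; rewrite (le_trans _ (ltW KM))// normrX.
  by rewrite ler_pXn2r ?nnegrE ?fK// (le_trans _ (fK _ Ox)).
Qed.

Lemma L2_continuous (f : Rd -> R) : continuous f -> L2 Omega f.
Proof.
move=> cf; have [K fK] := continuous_bounded_domain cf.
apply: (@L2_bounded _ K) => //.
by apply: continuous_rV_measurable_fun => //; exact: mOmega.
Qed.

(** * Test functions *)

Lemma smooth_partialD (phi psi : Rd -> R) (s : seq 'I_d) :
  smooth phi -> smooth psi ->
  foldr partial (phi + psi) s = foldr partial phi s + foldr partial psi s.
Proof.
move=> sphi spsi; elim: s => [//|i s /= ->]; apply/funext => x.
rewrite /partial.
by rewrite deriveD//; [apply: (sphi s).2|apply: (spsi s).2].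
Qed.

Lemma smooth_partialZ (k : R) (phi : Rd -> R) (s : seq 'I_d) :
  smooth phi ->
  foldr partial (fun x => k * phi x) s = (fun x => k * foldr partial phi s x).
Proof.
move=> sphi; elim: s => [//|i s /= ->]; apply/funext => x.
rewrite /partial.
by rewrite (@deriveZ _ _ _ _ k)//; apply: (sphi s).2.
Qed.

Lemma test_functionD phi psi : test_function Omega phi -> test_function Omega psi ->
  test_function Omega (phi + psi).
Proof.
move=> [s1 k1 o1] [s2 k2 o2].
have sub : closure ((phi + psi) @^-1` [set~ 0]) `<=`
    closure (phi @^-1` [set~ 0]) `|` closure (psi @^-1` [set~ 0]).
  rewrite -closureU; apply: closure_subset => x /= /eqP pp.
  have [p0|pN0] := eqVneq (phi x) 0; last by left; exact/eqP.
  by right => /= q0; case/eqP: pp; rewrite /GRing.add/= p0 q0 addr0.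
split.
- move=> s; rewrite smooth_partialD//; split.
    by move=> x; have [/(_ x) c1 _] := s1 s; have [/(_ x) c2 _] := s2 s;
       exact: cvgD c1 c2.
  by move=> i x; apply: derivableD; [exact: (s1 s).2|exact: (s2 s).2].
- apply: (subclosed_compact _ (compactU k1 k2)) => //.
  exact: closed_closure.
- by move=> x /sub [/o1|/o2].
Qed.

Lemma test_functionZ (k : R) phi : test_function Omega phi ->
  test_function Omega (fun x => k * phi x).
Proof.
move=> [s1 k1 o1].
have sub : closure ((fun x => k * phi x) @^-1` [set~ 0]) `<=`
    closure (phi @^-1` [set~ 0]).
  apply: closure_subset => x /= kp p0; apply: kp.
  by rewrite p0 mulr0.
split.
- move=> s; rewrite smooth_partialZ//; split.
    by move=> x; have [/(_ x) c1 _] := s1 s; exact: cvgM (cvg_cst k) c1.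
  by move=> i x; apply: (@derivableZ _ _ _ _ k); exact: (s1 s).2.
- apply: (subclosed_compact _ k1) => //; exact: closed_closure.
- by move=> x /sub /o1.
Qed.

(** * The H1 norm as a sum of squares of L2 norms *)

Definition component (g : Rd -> Rd) (i : 'I_d) : scalar_field R d :=
  fun x => g x ord0 i.

(** The integrability part of H10. It is closed under linear combinations without
any approximation by test functions. *)
Definition H1 (v : sobolev R d) : Prop :=
  L2 Omega v.1 /\ forall i, L2 Omega (component v.2 i).

Lemma integral_dot (g h : Rd -> Rd) :
  (forall i, L2 Omega (component g i)) -> (forall i, L2 Omega (component h i)) ->
  \int[leb]_(x in Omega) dot (g x) (h x) = \sum_i ip Omega (component g i) (component h i).
Proof.
move=> Lg Lh.
have igh i : leb.-integrable Omega (fun x => (component g i x * component h i x)%:E).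
  exact: (L2_integrableM mOmega).
transitivity (fine (\sum_i \int[leb]_(x in Omega) (component g i x * component h i x)%:E)).
  rewrite -integral_sum; [|exact: mOmega|by move=> i; exact: igh].
  rewrite /Rintegral; congr fine; apply: eq_integral => x _.
  rewrite sumEFin; congr EFin; rewrite /dot mxE.
  by apply: eq_bigr => i _; rewrite mxE.
rewrite sum_fine// => i _; apply: integrable_fin_num => //.
exact: mOmega.
Qed.

Lemma sqr_h1norm v : H1 v ->
  h1norm Omega v ^+ 2 = ip Omega v.1 v.1 + \sum_i ip Omega (component v.2 i) (component v.2 i).
Proof.
move=> [Lv1 Lv2]; rewrite /h1norm integral_dot// sqr_sqrtr ?sqr_l2norm//.
by rewrite addr_ge0 ?ip_ge0// sumr_ge0// => i _; exact: ip_ge0.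
Qed.

Lemma h1norm_ge0 v : 0 <= h1norm Omega v.
Proof. exact: sqrtr_ge0. Qed.

Lemma l2norm_le_h1norm v : l2norm Omega v.1 <= h1norm Omega v.
Proof.
rewrite /h1norm -[leLHS](ger0_norm (l2norm_ge0 _ _)) -sqrtr_sqr ler_wsqrtr//.
rewrite lerDl; apply: Rintegral_ge0 => x _; rewrite /dot mxE sumr_ge0// => i _.
by rewrite mxE -expr2 sqr_ge0.
Qed.

Lemma H1D v w : H1 v -> H1 w -> H1 (v + w).
Proof.
move=> [v1 v2] [w1 w2]; split; first exact: (L2D mOmega).
move=> i; rewrite (_ : component _ i = component v.2 i + component w.2 i).
  exact: (L2D mOmega).
by apply/funext => x; rewrite /component mxE.
Qed.

Lemma H1Z k v : H1 v -> H1 (k *: v).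
Proof.
move=> [v1 v2]; split; first exact: (L2Z mOmega).
move=> i; rewrite (_ : component _ i = k *: component v.2 i).
  exact: (L2Z mOmega).
by apply/funext => x; rewrite /component mxE.
Qed.

Lemma H1B v w : H1 v -> H1 w -> H1 (v - w).
Proof. by move=> v1 w1; rewrite -scaleN1r; exact: H1D v1 (H1Z (-1) w1). Qed.

Lemma ip_sum_sqr_le (f g : scalar_field R d) : L2 Omega f -> L2 Omega g ->
  ip Omega (f + g) (f + g) <= 2 * ip Omega f f + 2 * ip Omega g g.
Proof.
move=> Lf Lg; have := ip_ge0 Omega (f - g).
have LB := L2B mOmega Lf Lg; have LD := L2D mOmega Lf Lg.
rewrite (ipDl mOmega Lf Lg LD) (ipDr mOmega Lf Lg Lf) (ipDr mOmega Lf Lg Lg).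
rewrite (ipBl mOmega Lf Lg LB) (ipBr mOmega Lf Lg Lf) (ipBr mOmega Lf Lg Lg).
by rewrite (ipC Omega g f); lra.
Qed.

(** A weak triangle inequality, immediate from the squared norm being a sum of
squares; it serves to approximate sums by test functions. *)
Lemma h1norm_sum_sqr_le v w : H1 v -> H1 w ->
  h1norm Omega (v + w) ^+ 2 <= 2 * h1norm Omega v ^+ 2 + 2 * h1norm Omega w ^+ 2.
Proof.
move=> Hv Hw; rewrite !sqr_h1norm//; last exact: H1D.
have [[v1 v2] [w1 w2]] := (Hv, Hw).
have := ip_sum_sqr_le v1 w1.
have : \sum_i ip Omega (component (v + w).2 i) (component (v + w).2 i) <=
    2 * (\sum_i ip Omega (component v.2 i) (component v.2 i)) +
    2 * (\sum_i ip Omega (component w.2 i) (component w.2 i)).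
  rewrite !mulr_sumr -big_split/=; apply: ler_sum => i _.
  rewrite (_ : component _ i = component v.2 i + component w.2 i); first exact: ip_sum_sqr_le.
  by apply/funext => x; rewrite /component mxE.
by rewrite /=; lra.
Qed.

Lemma h1normZ k v : H1 v -> h1norm Omega (k *: v) = `|k| * h1norm Omega v.
Proof.
move=> Hv; apply/eqP; rewrite -(@eqrXn2 _ 2)// ?mulr_ge0 ?h1norm_ge0//.
rewrite exprMn !sqr_h1norm//; last exact: H1Z.
have [v1 v2] := Hv; rewrite real_normK ?num_real// mulrDr mulr_sumr.
rewrite (ipZl mOmega)//; last exact: (L2Z mOmega).
rewrite (ipZr mOmega)// mulrA -expr2; apply/eqP; congr (_ + _).
apply: eq_bigr => i _.
rewrite (_ : component (k *: v).2 i = k *: component v.2 i); last first.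
  by apply/funext => x; rewrite /component mxE.
rewrite (ipZl mOmega)//; last exact: (L2Z mOmega).
by rewrite (ipZr mOmega)// mulrA -expr2.
Qed.

Lemma H1_lift phi : test_function Omega phi -> H1 (lift_test phi).
Proof.
move=> [sphi _ _]; split; first exact: L2_continuous (sphi [::]).1.
move=> i; rewrite (_ : component _ i = partial i phi).
  exact: L2_continuous (sphi [:: i]).1.
by apply/funext => x; rewrite /component mxE.
Qed.

Lemma H10_H1 v : H10 Omega v -> H1 v.
Proof. by case. Qed.

Lemma lift_testD phi psi : test_function Omega phi -> test_function Omega psi ->
  lift_test (phi + psi) = lift_test phi + lift_test psi.
Proof.
move=> [s1 _ _] [s2 _ _]; congr pair; apply/funext => x; apply/rowP => i.
rewrite !mxE /partial deriveD//; [exact: (s1 [::]).2|exact: (s2 [::]).2].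
Qed.

Lemma lift_testZ k phi : test_function Omega phi ->
  lift_test (fun x => k * phi x) = k *: lift_test phi.
Proof.
move=> [s1 _ _]; congr pair; apply/funext => x; apply/rowP => i.
by rewrite !mxE /partial (@deriveZ _ _ _ _ k)//; exact: (s1 [::]).2.
Qed.

Lemma H10_lift phi : test_function Omega phi -> H10 Omega (lift_test phi).
Proof.
move=> tphi; have [h1 h2] := H1_lift tphi; split => // e e0; exists phi => //.
rewrite subrr (_ : h1norm Omega 0 = 0)//.
by rewrite -(scale0r (lift_test phi)) h1normZ ?normr0 ?mul0r//; exact: H1_lift.
Qed.

Lemma H10D v w : H10 Omega v -> H10 Omega w -> H10 Omega (v + w).
Proof.
move=> Hv Hw; have [D1 D2] := H1D (H10_H1 Hv) (H10_H1 Hw).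
split => // e e0; have e2 : 0 < e / 2 by rewrite divr_gt0.
have [_ _ /(_ _ e2) [phi tphi hphi]] := Hv.
have [_ _ /(_ _ e2) [psi tpsi hpsi]] := Hw.
exists (phi + psi); first exact: test_functionD.
rewrite lift_testD// opprD addrACA.
have Hp := H1B (H10_H1 Hv) (H1_lift tphi).
have Hq := H1B (H10_H1 Hw) (H1_lift tpsi).
rewrite -(@ltr_pXn2r _ 2)// ?nnegrE ?h1norm_ge0 ?(ltW e0)//.
apply: le_lt_trans (h1norm_sum_sqr_le Hp Hq) _.
have sq (x : R) : 0 <= x -> x < e / 2 -> x ^+ 2 < e ^+ 2 / 2 ^+ 2.
  by move=> x0 xe; rewrite -expr_div_n ltr_pXn2r// nnegrE ltW.
exact: twice_quarters_lt (sq _ (h1norm_ge0 _) hphi) (sq _ (h1norm_ge0 _) hpsi).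
Qed.

Lemma H10Z k v : H10 Omega v -> H10 Omega (k *: v).
Proof.
move=> Hv; have [D1 D2] := H1Z k (H10_H1 Hv).
split => // e e0.
have k0 : 0 < `|k| + 1 by rewrite ltr_wpDl.
have ek : 0 < e / (`|k| + 1) by rewrite divr_gt0.
have [_ _ /(_ _ ek) [phi tphi hphi]] := Hv.
exists (fun x => k * phi x); first exact: test_functionZ.
rewrite lift_testZ// -scalerBr h1normZ; last first.
  exact: H1B (H10_H1 Hv) (H1_lift tphi).
move: hphi; rewrite ltr_pdivlMr// => hphi.
apply: le_lt_trans hphi; rewrite mulrC ler_wpM2l ?h1norm_ge0//.
by rewrite lerDl.
Qed.

Lemma H10B v w : H10 Omega v -> H10 Omega w -> H10 Omega (v - w).
Proof. by move=> v1 w1; rewrite -scaleN1r; exact: H10D v1 (H10Z (-1) w1). Qed.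

Lemma H10_dense v e : H10 Omega v -> 0 < e ->
  exists2 phi, test_function Omega phi & l2norm Omega (v.1 - phi) < e.
Proof.
move=> [_ _ h] /h[phi tphi hphi]; exists phi => //.
exact: le_lt_trans (l2norm_le_h1norm (v - lift_test phi)) hphi.
Qed.

(** * The bilinear form *)
Section form.
Variable A : Rd -> 'M[R]_d.
Hypothesis cA : forall i j, continuous (fun x => A x i j).

Lemma L2_continuousM (a : Rd -> R) (g : scalar_field R d) : continuous a ->
  L2 Omega g -> L2 Omega (fun x => a x * g x).
Proof.
move=> ca [mg g2]; have [K aK] := continuous_bounded_domain ca.
have ma : measurable_fun Omega a.
  by apply: continuous_rV_measurable_fun => //; exact: mOmega.
split; first exact: measurable_funM.
have := integrableZl mOmega (K ^+ 2) g2.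
apply: le_integrable; first exact: mOmega.
  by apply/measurable_EFinP; apply: measurable_funX; exact: measurable_funM.
move=> x Ox; rewrite -EFinM !abse_EFin lee_fin.
rewrite (ger0_norm (sqr_ge0 _)) (le_trans _ (ler_norm _))// exprMn.
apply: ler_wpM2r; first exact: sqr_ge0.
have aKx := aK x Ox; have K0 := le_trans (normr_ge0 _) aKx.
by rewrite -(real_normK (num_real (a x))) ler_pXn2r// nnegrE.
Qed.

Lemma component_flux g j : component (flux A g) j = \sum_i (fun x => A x j i * component g i x).
Proof.
apply/funext => x; rewrite fct_sumE /component /flux mxE.
by apply: eq_bigr => i _; rewrite mxE mulrC.
Qed.

Lemma L2_flux g j : (forall i, L2 Omega (component g i)) -> L2 Omega (component (flux A g) j).
Proof.
move=> Lg; rewrite component_flux; apply: (L2_sum mOmega) => i _ _.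
by apply: L2_continuousM.
Qed.

Lemma aformE v w : H1 v -> H1 w ->
  aform Omega A v w = \sum_i ip Omega (component (flux A v.2) i) (component w.2 i).
Proof.
move=> [v1 v2] [w1 w2]; rewrite /aform integral_dot// => i; exact: L2_flux.
Qed.

Lemma fluxD g h : flux A (g + h) = flux A g + flux A h.
Proof. by apply/funext => x; rewrite /flux mulmxDl. Qed.

Lemma fluxZ k g : flux A (k *: g) = k *: flux A g.
Proof. by apply/funext => x; rewrite /flux -scalemxAl. Qed.

Lemma aformD v v' w : H1 v -> H1 v' -> H1 w ->
  aform Omega A (v + v') w = aform Omega A v w + aform Omega A v' w.
Proof.
move=> Hv Hv' Hw; rewrite !aformE//; last exact: H1D.
rewrite -big_split/=; apply: eq_bigr => i _; rewrite fluxD.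
rewrite (_ : component _ i = component (flux A v.2) i + component (flux A v'.2) i); last first.
  by apply/funext => x; rewrite /component mxE.
by rewrite (ipDl mOmega)//; [apply: L2_flux; case: Hv|apply: L2_flux; case: Hv'|case: Hw].
Qed.

Lemma aformZ k v w : H1 v -> H1 w -> aform Omega A (k *: v) w = k * aform Omega A v w.
Proof.
move=> Hv Hw; rewrite !aformE//; last exact: H1Z.
rewrite mulr_sumr; apply: eq_bigr => i _; rewrite fluxZ.
rewrite (_ : component _ i = k *: component (flux A v.2) i); last first.
  by apply/funext => x; rewrite /component mxE.
by rewrite (ipZl mOmega)//; [apply: L2_flux; case: Hv|case: Hw].
Qed.

End form.

End domain.

(** * Functions that are continuously differentiable on each time step *)
Section piecewise.
Context {R : realType} (tt : nat -> R) (N : nat).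
Hypothesis tt0 : tt 0%N = 0.
Hypothesis tt_incr : forall n, (n < N)%N -> tt n < tt n.+1.
Local Notation mu := (@lebesgue_measure R).

Lemma le_nodes n m : (n <= m <= N)%N -> tt n <= tt m.
Proof.
move=> /andP[]; elim: m => [|m ih]; first by rewrite leqn0 => /eqP ->.
rewrite leq_eqVlt => /predU1P[->//|nm mN].
by rewrite (le_trans (ih nm (ltnW mN)))// ltW// tt_incr.
Qed.

Lemma time_indexE n s : (1 <= n <= N)%N -> tt n.-1 < s <= tt n ->
  time_index tt N s = n.
Proof.
move=> /andP[n1 nN] /andP[ns sn]; rewrite /time_index.
transitivity (\sum_(j < N) (j < n)%N)%N.
  apply: eq_bigr => j _; congr nat_of_bool.
  have [jn|nj] := ltnP j n.
    apply: le_lt_trans ns; apply: le_nodes.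
    by rewrite -ltnS prednK// jn (leq_trans (leq_pred _)).
  by apply/negbTE; rewrite -leNgt (le_trans sn)// le_nodes// nj ltnW.
transitivity (\sum_(j < N | (j < n)%N) 1)%N.
  by rewrite [RHS]big_mkcond/=; apply: eq_bigr => j _; case: ifP.
by rewrite -(big_ord_widen N (fun=> 1%N) nN) sum1_card card_ord.
Qed.

Lemma time_index0 : time_index tt N 0 = 0%N.
Proof.
rewrite /time_index big1// => j _; rewrite -tt0.
by rewrite ltNge le_nodes//= ltnW.
Qed.

Lemma time_indexP s : 0 < s <= tt N -> exists n, [/\ (1 <= n <= N)%N,
  tt n.-1 < s & s <= tt n].
Proof.
move=> /andP[s0 sN].
have ex : exists n, s <= tt n by exists N.
exists (ex_minn ex); case: ex_minnP => n sn nmin.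
have n1 : (0 < n)%N by case: n sn {nmin} => //; rewrite tt0 leNgt s0.
split => //; first by rewrite n1/= nmin.
by rewrite ltNge; apply/negP => /nmin; rewrite -ltnS prednK// ltnn.
Qed.

(** The derivative of a piecewise smooth function is given by one function per
time step, each defined for all times; at_piece selects the one in force. *)
Definition at_piece {V : Type} (f : nat -> R -> V) (s : R) : V :=
  f (time_index tt N s) s.

Definition C1_pieces (x : R) (F : R -> R) (f : nat -> R -> R) : Prop :=
  {within `[0, x], continuous F} /\
  forall n, (1 <= n <= N)%N -> {within `[0, x], continuous (f n)} /\
    forall s, tt n.-1 < s < tt n -> s < x -> is_derive s 1 F (f n s).

Lemma measurable_at_piece (x : R) (f : nat -> R -> R) : x <= tt N ->
  (forall n, (1 <= n <= N)%N -> {within `[0, x], continuous (f n)}) ->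
  measurable_fun (`]0, x[%classic : set R) (at_piece f).
Proof.
move=> xN cf.
pose E n : set R := if (n < N)%N then `]tt n, tt n.+1] `&` `]0, x[ else set0.
have mE n : measurable (E n).
  by rewrite /E; case: ifP => // _; apply: measurableI; exact: measurable_itv.
have UE : `]0, x[%classic = \bigcup_n E n.
  apply/seteqP; split=> s /=.
    rewrite in_itv/= => /andP[s0 sx].
    have [|n [/andP[n1 nN] ns sn]] := @time_indexP s.
      by rewrite s0 (le_trans (ltW sx)).
    exists n.-1 => //; rewrite /E prednK// nN; split; rewrite /= in_itv/=.
      by rewrite ns.
    by rewrite s0.
  by move=> [n _]; rewrite /E; case: ifP => // _ [].
rewrite UE; apply/measurable_fun_bigcup => // n.
rewrite /E; case: ifPn => [nN|_]; last exact: measurable_fun_set0.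
apply: (@eq_measurable_fun _ _ _ _ _ (f n.+1)).
  by move=> s; rewrite inE => -[/=]; rewrite in_itv/= => sn _;
     rewrite /at_piece (@time_indexE n.+1).
have : measurable_fun (`[0, x]%classic : set R) (f n.+1).
  by apply: subspace_continuous_measurable_fun => //; exact: cf.
apply: measurable_funS => // s [_] /=; exact: subset_itv_oo_cc.
Qed.

Lemma bounded_at_piece (x : R) (f : nat -> R -> R) : 0 <= x <= tt N ->
  (forall n, (1 <= n <= N)%N -> {within `[0, x], continuous (f n)}) ->
  exists L, forall s, 0 < s < x -> `|at_piece f s| <= L.
Proof.
move=> /andP[x0 xN] cf.
have bnd n : exists L : R, (1 <= n <= N)%N -> forall s, 0 <= s <= x -> `|f n s| <= L.
  have [nN|_] := boolP (1 <= n <= N)%N; last by exists 0.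
  have [c _ hc] := EVT_max x0 (cf n nN); have [c' _ hc'] := EVT_min x0 (cf n nN).
  exists (`|f n c| + `|f n c'|) => _ s sx.
  have := hc s; have := hc' s; rewrite in_itv/= => /(_ sx) h1 /(_ sx) h2.
  rewrite ler_norml; apply/andP; split.
    have := ler_norm (- f n c'); rewrite normrN; have := normr_ge0 (f n c); lra.
  have := ler_norm (f n c); have := normr_ge0 (f n c'); lra.
have [L hL] := choice bnd.
exists (\sum_(n < N.+1) `|L n|) => s /andP[s0 sx].
have [|n [/andP[n1 nN] ns sn]] := @time_indexP s.
  by rewrite s0 (le_trans (ltW sx)).
rewrite /at_piece (@time_indexE n) ?n1 ?ns//.
rewrite (le_trans (hL n _ s _)) ?n1 ?(ltW s0) ?(ltW sx)//.
have nN1 : (n < N.+1)%N by rewrite ltnS.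
rewrite (bigD1 (Ordinal nN1))//= (le_trans (ler_norm _))// lerDl.
by apply: sumr_ge0 => i _; exact: normr_ge0.
Qed.

Lemma integrable_at_piece (x : R) (f : nat -> R -> R) : 0 <= x <= tt N ->
  (forall n, (1 <= n <= N)%N -> {within `[0, x], continuous (f n)}) ->
  mu.-integrable `]0, x[ (EFin \o at_piece f).
Proof.
move=> /[dup] x0N /andP[x0 xN] cf.
have [L hL] := bounded_at_piece x0N cf.
apply: (@bounded_integrable _ _ _ L) => //.
- by rewrite lebesgue_measure_itv/=; case: ifP => _; rewrite -?EFinB ltry.
- exact: measurable_at_piece.
Qed.

Let FTC_piece (n : nat) (x : R) F f : (n < N)%N -> tt n < x <= tt n.+1 ->
  C1_pieces x F f ->
  \int[mu]_(s in `]tt n, x[) at_piece f s = F x - F (tt n).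
Proof.
move=> nN /andP[nx xn] [cF /(_ n.+1 nN) [cf dF]].
have tn0 : 0 <= tt n by rewrite -tt0 le_nodes//= ltnW.
have sub : `[tt n, x] `<=` `[0, x].
  by apply: subset_itvr; rewrite bnd_simp.
have cf' := continuous_subspaceW sub cf.
have [cFo cFl cFr] := (continuous_within_itvP _ nx).1 (continuous_subspaceW sub cF).
transitivity (\int[mu]_(s in `]tt n, x[) f n.+1 s).
  apply: eq_Rintegral => s; rewrite inE/= in_itv/= => /andP[ns sx].
  by rewrite /at_piece (@time_indexE n.+1)//= ns (le_trans (ltW sx)).
have mf : measurable_fun (`]tt n, x[%classic : set R) (EFin \o f n.+1).
  apply/measurable_EFinP.
  have : measurable_fun (`[tt n, x]%classic : set R) (f n.+1).
    exact: subspace_continuous_measurable_fun.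
  by apply: measurable_funS => //; exact: subset_itv_oo_cc.
rewrite /Rintegral -(integral_itv_bndoo true false mf).
rewrite (@continuous_FTC2 _ _ F)//.
- split => // s; rewrite in_itv/= => /andP[ns sx].
  by case: (dF s) => //; rewrite ns (lt_le_trans sx).
- move=> s; rewrite in_itv/= => /andP[ns sx].
  rewrite derive1E; apply: (@derive_val _ _ _ _ _ _ _ (dF s _ _)) => //.
  by rewrite ns (lt_le_trans sx).
Qed.

Lemma C1_piecesW (x x' : R) F f : x' <= x -> C1_pieces x F f -> C1_pieces x' F f.
Proof.
move=> xx' [cF cf].
have sub : `[0, x'] `<=` `[0, x] by apply: subset_itvl; rewrite bnd_simp.
split; first exact: continuous_subspaceW cF.
move=> n nN; have [cfn dF] := cf n nN; split; first exact: continuous_subspaceW cfn.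
by move=> s sn sx'; apply: dF => //; exact: lt_le_trans xx'.
Qed.

Lemma FTC_C1_pieces (x : R) F f : 0 <= x <= tt N -> C1_pieces x F f ->
  \int[mu]_(s in `]0, x[) at_piece f s = F x - F 0.
Proof.
move=> /andP[x0 xN].
suff H n : (n <= N)%N -> forall x, 0 <= x -> x <= tt n -> C1_pieces x F f ->
    \int[mu]_(s in `]0, x[) at_piece f s = F x - F 0 by exact: (H N).
elim: n => [|n ih] nN {x x0 xN} x x0 xn C1.
  have -> : x = 0 by apply/le_anti; rewrite x0 -tt0 xn.
  by rewrite set_itv_ge ?bnd_simp ?ltxx// Rintegral_set0 subrr.
have [xtn|tnx] := leP x (tt n); first exact: ih (ltnW nN) _ _ _ _.
have tn0 : 0 <= tt n by rewrite -tt0 le_nodes//= ltnW.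
have xN : 0 <= x <= tt N by rewrite x0 (le_trans xn)// le_nodes//= nN leqnn.
have ix : mu.-integrable `]0, x[ (EFin \o at_piece f).
  by apply: integrable_at_piece => // m /(C1.2 m)[].
have := Rintegral_itvB ix; move=> /(_ (tt n)).
rewrite !bnd_simp => /(_ tn0 tnx).
have tnx1 : tt n < x <= tt n.+1 by rewrite tnx.
rewrite (FTC_piece nN tnx1 C1) => /eqP; rewrite subr_eq => /eqP ->.
rewrite -Rintegral_itv_bndo_bndc; last first.
  apply: (integrableS _ _ _ ix) => //.
  by apply: subset_itvl; rewrite bnd_simp ltW.
rewrite (ih (ltnW nN))//; first by rewrite addrA subrK.
by apply: C1_piecesW C1; exact: ltW.
Qed.

End piecewise.

(** * Convolutions with the singular kernel *)
Section kernel_sign.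
Context {R : realType} (tt : nat -> R) (N : nat).
Hypothesis tt0 : tt 0%N = 0.
Hypothesis tt_incr : forall n, (n < N)%N -> tt n < tt n.+1.
Local Notation mu := (@lebesgue_measure R).

Lemma is_derive_powR_left (p c s : R) : s < c ->
  is_derive s 1 (fun s => (c - s) `^ p) (- (p * (c - s) `^ (p - 1))).
Proof.
move=> sc; have cs : 0 < c - s by rewrite subr_gt0.
have d1 : is_derive s 1 (fun s => c - s) (-1).
  by apply: is_derive_eq; rewrite add0r mul1r.
have := @is_derive1_comp _ (fun y : R => y `^ p) _ s _ _ (is_derive1_powR p cs) d1.
by rewrite mulrN1.
Qed.

Lemma powR_left_le (p c c' s : R) : 0 <= p -> s < c -> c <= c' ->
  (c' - s) `^ (- p) <= (c - s) `^ (- p).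
Proof.
move=> p0 sc cc'; have cs : 0 < c - s by rewrite subr_gt0.
have cs' : 0 < c' - s by rewrite subr_gt0 (lt_le_trans sc).
rewrite !powRN lef_pV2 ?posrE ?powR_gt0//.
by apply: ge0_ler_powR; rewrite ?nnegrE ?lerD2r// ltW.
Qed.

Lemma integrable_powR_left (p t : R) : p < 1 -> 0 < t ->
  mu.-integrable `]0, t[ (fun s => ((t - s) `^ (- p))%:E).
Proof.
move=> p1 t0; apply/integrableP; split.
  by apply/measurable_EFinP; apply: measurable_powR_comp; exact: measurable_funB.
rewrite (_ : (\int[mu]_(x in _) _)%E =
    (\int[mu]_(s in `]0%R, t[) ((t - s) `^ ((1 - p) - 1))%:E)%E).
  by rewrite integral_powR_left ?ltry// subr_gt0.
apply: eq_integral => s _; rewrite abse_EFin ger0_norm; last exact: powR_ge0.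
by congr (_ `^ _)%:E; ring.
Qed.

Section shifted.
Variables (tau : R) (m : R -> R) (f : nat -> R -> R).
Hypothesis tauN : 0 <= tau <= tt N.
Hypothesis m_le0 : forall s : R, 0 <= s <= tau -> m s <= 0.
Hypothesis m_tau : m tau = 0.
Hypothesis C1 : C1_pieces tt N tau m f.

(** By parts, the integral of k m' is - k(0) m(0) minus the integral of k' m, and m
is nonpositive. *)
Lemma increasing_kernel_sign (k k' : R -> R) :
  (forall s, s <= tau -> is_derive s 1 k (k' s)) ->
  (forall s, s <= tau -> {for s, continuous k'}) ->
  (forall s, s <= tau -> 0 <= k s) -> (forall s, s <= tau -> 0 <= k' s) ->
  0 <= \int[mu]_(s in `]0, tau[) (k s * at_piece tt N f s).
Proof.
move=> dk ck' k0 k'0; case/andP: (tauN) => tau0 _; case: (C1) => cm cf.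
have ck : {within `[0, tau], continuous k}.
  apply: derivable_within_continuous => s; rewrite in_itv/= => /andP[_ st].
  by case: (dk s st).
have ck'w : {within `[0, tau], continuous k'}.
  by apply: continuous_in_subspaceT => s; rewrite inE/= in_itv/= => /andP[_ /ck'].
have prod (g h : R -> R) : {within `[0, tau], continuous g} ->
    {within `[0, tau], continuous h} -> {within `[0, tau], continuous (g \* h)}.
  move=> /subspace_continuousP cg /subspace_continuousP ch.
  by apply/subspace_continuousP => s st; apply: cvgM; [exact: cg|exact: ch].
have C1km : C1_pieces tt N tau (k \* m) (fun n s => k s * f n s + k' s * m s).
  split; first exact: prod.
  move=> n nN; have [cfn dm] := cf n nN; split.
    have /subspace_continuousP ckf := prod _ _ ck cfn.
    have /subspace_continuousP ckm := prod _ _ ck'w cm.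
    by apply/subspace_continuousP => s st; apply: cvgD; [exact: ckf|exact: ckm].
  move=> s sn st; have dks := dk s (ltW st); have dms := dm s sn st.
  by apply: is_derive_eq; rewrite [k' s * _]mulrC.
have ikf : mu.-integrable `]0, tau[
    (EFin \o at_piece tt N (fun n s => k s * f n s)).
  apply: integrable_at_piece => // n nN; have [cfn _] := cf n nN.
  exact: prod.
have ikm : mu.-integrable `]0, tau[
    (EFin \o at_piece tt N (fun n s => k s * f n s + k' s * m s)).
  by apply: integrable_at_piece => // n /(C1km.2 n)[].
apply: (@le_trans _ _ (\int[mu]_(s in `]0, tau[)
    at_piece tt N (fun n s => k s * f n s + k' s * m s) s)).
  rewrite (FTC_C1_pieces tt0 tt_incr tauN C1km) /= m_tau mulr0 sub0r oppr_ge0.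
  by apply: mulr_ge0_le0; [exact: k0|apply: m_le0; rewrite lexx].
apply: le_Rintegral => //= s; rewrite in_itv/= => /andP[s0 st].
rewrite /at_piece gerDl; apply: mulr_ge0_le0; first exact: k'0 (ltW st).
by apply: m_le0; rewrite !ltW.
Qed.

Lemma Rintegral_cvg (D : set R) (g : nat -> R -> R) (h b : R -> R) :
  measurable D -> (forall k, measurable_fun D (g k)) -> measurable_fun D h ->
  (forall s, D s -> g k s @[k --> \oo] --> h s) ->
  mu.-integrable D (EFin \o b) -> (forall k s, D s -> `|g k s| <= b s) ->
  \int[mu]_(s in D) g k s @[k --> \oo] --> \int[mu]_(s in D) h s.
Proof.
move=> mD mg mh gh ib gb.
have [] := @dominated_convergence _ _ _ mu D mD (fun k s => (g k s)%:E)
  (fun s => (h s)%:E) (EFin \o b).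
- by move=> k; apply/measurable_EFinP; exact: mg.
- exact/measurable_EFinP.
- by apply: aeW => s Ds; apply: cvg_EFin; [exact: nearW|exact: gh].
- exact: ib.
- by apply: aeW => s k Ds; rewrite abse_EFin lee_fin; exact: gb.
move=> ih _ cv; apply: fine_cvg.
by rewrite fineK//; exact: integrable_fin_num.
Qed.

(** The kernel is singular at tau. Replacing tau by tau + 1/(k+1) in it makes it
smooth up to the final time, and the shift is removed by dominated
convergence. *)
Lemma power_kernel_sign (a : R) : 0 < a < 1 -> 0 < tau ->
  0 <= \int[mu]_(s in `]0, tau[) ((tau - s) `^ (- a) * at_piece tt N f s).
Proof.
move=> /andP[a0 a1] tau0.
have cf n : (1 <= n <= N)%N -> {within `[0, tau], continuous (f n)}.
  by move=> nN; have [] := C1.2 n nN.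
have tN : tau <= tt N by case/andP: tauN.
have mf : measurable_fun (`]0, tau[%classic : set R) (at_piece tt N f).
  exact: measurable_at_piece.
have [L hL] := bounded_at_piece tt0 tt_incr tauN cf.
pose g (k : nat) (s : R) := (tau + k.+1%:R^-1 - s) `^ (- a) * at_piece tt N f s.
have tauk (k : nat) : tau < tau + k.+1%:R^-1 by rewrite ltrDl invr_gt0.
have g0 k : 0 <= \int[mu]_(s in `]0, tau[) g k s.
  apply: (@increasing_kernel_sign _
     (fun s => a * (tau + k.+1%:R^-1 - s) `^ (- a - 1))) => s st.
  - have := is_derive_powR_left (- a) (le_lt_trans st (tauk k)).
    by rewrite mulNr opprK.
  - apply: cvgM; first exact: cvg_cst.
    have [+ _] := is_derive_powR_left (- a - 1) (le_lt_trans st (tauk k)).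
    by move/derivable1_diffP/differentiable_continuous.
  - exact: powR_ge0.
  - by apply: mulr_ge0; [exact: ltW|exact: powR_ge0].
have : \int[mu]_(s in `]0, tau[) g k s @[k --> \oo] -->
    \int[mu]_(s in `]0, tau[) ((tau - s) `^ (- a) * at_piece tt N f s).
  apply: (@Rintegral_cvg _ _ _ (fun s => L * (tau - s) `^ (- a))) => //.
  - move=> k; apply: measurable_funM => //.
    by apply: measurable_powR_comp; exact: measurable_funB.
  - apply: measurable_funM => //.
    by apply: measurable_powR_comp; exact: measurable_funB.
  - move=> s; rewrite /= in_itv/= => /andP[s0 st].
    apply: cvgM; last exact: cvg_cst.
    have ts : 0 < tau - s by rewrite subr_gt0.
    have [/derivable1_diffP/differentiable_continuous cp _] :=
      is_derive1_powR (- a) ts.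
    apply: (continuous_cvg _ cp).
    rewrite -[X in _ --> (X - _)]addr0; apply: cvgB; last exact: cvg_cst.
    by apply: cvgD; [exact: cvg_cst|exact: cvg_harmonic].
  - have := integrable_powR_left a1 tau0; exact: integrableZl.
  - move=> k s; rewrite /= in_itv/= => /andP[s0 st].
    rewrite normrM (ger0_norm (powR_ge0 _ _)) mulrC.
    apply: ler_pM => //; first exact: powR_ge0.
      by apply: hL; rewrite s0.
    by apply: powR_left_le => //; exact: ltW.
by apply: (closed_cvg _ (@closed_ge R 0)); exact: nearW.
Qed.

End shifted.

Lemma integrable_power_kernel (a tau : R) (f : nat -> R -> R) :
  a < 1 -> 0 < tau -> tau <= tt N ->
  (forall n, (1 <= n <= N)%N -> {within `[0, tau], continuous (f n)}) ->
  mu.-integrable `]0, tau[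
    (fun s => ((tau - s) `^ (- a) * at_piece tt N f s)%:E).
Proof.
move=> a1 tau0 tauN cf.
have tau_in : 0 <= tau <= tt N by rewrite ltW.
have [L hL] := bounded_at_piece tt0 tt_incr tau_in cf.
have : mu.-integrable `]0, tau[ (fun s => `|L|%:E * ((tau - s) `^ (- a))%:E)%E.
  by apply: integrableZl => //; exact: integrable_powR_left.
apply: le_integrable => //.
  apply/measurable_EFinP; apply: measurable_funM.
    by apply: measurable_powR_comp; exact: measurable_funB.
  exact: measurable_at_piece.
move=> s; rewrite /= in_itv/= => s_in.
rewrite lee_fin normrM [leRHS]normrM normr_id mulrC.
apply: ler_wpM2r; first exact: normr_ge0.
by rewrite (le_trans (hL s _)) ?ler_norm.
Qed.

End kernel_sign.

(** * A fractional integral inequality *)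
Section fractional_comparison.
Context {R : realType} (tt : nat -> R) (N : nat).
Hypothesis tt0 : tt 0%N = 0.
Hypothesis tt_incr : forall n, (n < N)%N -> tt n < tt n.+1.
Local Notation mu := (@lebesgue_measure R).

(** The bound on the convolution of y' with the kernel is integrated against the
complementary power. By Abel's identity the result recovers the increment of y,
multiplied by a value of the beta function that is at least pi. *)
Lemma fractional_comparison (a t c : R) (y G : R -> R) (f : nat -> R -> R) :
  0 < a < 1 -> 0 < t <= tt N -> 0 < c ->
  C1_pieces tt N t y f ->
  (forall r, 0 <= r <= t -> 0 <= G r) ->
  (forall r, 0 < r < t ->
     \int[mu]_(s in `]0, r[) ((r - s) `^ (- a) * at_piece tt N f s) <= c * G r) ->
  ((pi / c * (y t - y 0))%:E <=
   \int[mu]_(r in `[0%R, t]) ((t - r) `^ (a - 1) * G r)%:E)%E.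
Proof.
move=> a01 /andP[t0 tN] c0 C1 G0 DG.
have t0N : 0 <= t <= tt N by rewrite ltW.
have kG0 r : `[0, t]%classic r -> (0 <= ((t - r) `^ (a - 1) * G r)%:E)%E.
  move=> /=; rewrite in_itv/= => /G0 Gr0; rewrite lee_fin.
  by apply: mulr_ge0; first exact: powR_ge0.
(* Only a positive increment may be multiplied by pi in place of the larger B. *)
have [y_le|y_gt] := leP (y t - y 0) 0.
  apply: (@le_trans _ _ 0%E); last exact: integral_ge0.
  rewrite lee_fin mulr_ge0_le0// divr_ge0//; last exact: ltW.
  exact: ltW (pi_gt0 R).
have cf n : (1 <= n <= N)%N -> {within `[0, t], continuous (f n)}.
  by move=> nN; have [] := C1.2 n nN.
have [L hL] := bounded_at_piece tt0 tt_incr t0N cf.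
have mf := measurable_at_piece tt0 tt_incr tN cf.
pose g : R -> R := (at_piece tt N f) \_ `]0, t[.
have gE s : 0 < s < t -> g s = at_piece tt N f s.
  by move=> s0t; rewrite /g patchE mem_set//= in_itv.
have mg : measurable_fun setT g by exact/(measurable_restrictT _ _).1.
have gL s : `|g s| <= `|L|.
  have [s0t|s0t] := boolP (0 < s < t).
    by rewrite gE// (le_trans (hL s s0t))// ler_norm.
  rewrite /g patchE memNset ?normr0//=.
  by rewrite in_itv/=; exact/negP.
pose K (s r : R) := (t - r) `^ (a - 1) * (r - s) `^ (- a).
have mK : measurable_fun [set: R * R] (fun z => K z.1 z.2).
  apply: measurable_funM; apply: measurable_powR_comp.
    exact: measurable_funB.
  exact: measurable_funB.
have K0 s r : 0 <= K s r by apply: mulr_ge0; exact: powR_ge0.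
have Bfin : euler_beta a \is a fin_num.
  by rewrite ge0_fin_numE ?euler_beta_ge0// euler_beta_lty.
pose B := fine (euler_beta a).
have B_ge_pi : pi <= B by rewrite -lee_fin /B fineK// pi_le_euler_beta.
have B0 : 0 <= B by rewrite (le_trans _ B_ge_pi)// ltW// pi_gt0.
have intK s : 0 < s < t -> (\int[mu]_(r in `]s, t[) (K s r)%:E = B%:E)%E.
  move=> /andP[s0 st]; rewrite /B (fineK Bfin).
  exact: integral_abel_kernel.
have ikernel r : 0 < r < t ->
    mu.-integrable `]0, r[ (fun s => ((r - s) `^ (- a))%:E).
  by move=> /andP[r0 _]; apply: integrable_powR_left => //; case/andP: a01.
have finK r : 0 < r < t -> (\int[mu]_(s in `]0%R, r[) (K s r)%:E < +oo)%E.
  move=> r0t.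
  have : mu.-integrable `]0, r[
      (fun s => ((t - r) `^ (a - 1))%:E * ((r - s) `^ (- a))%:E)%E.
    by apply: integrableZl => //; exact: ikernel.
  move/integrableP => [_]; apply: le_lt_trans.
  apply: ge0_le_lower_integral => //.
  - by move=> s _; rewrite lee_fin; exact: K0.
  - by move=> s _; rewrite -EFinM abse_EFin lee_fin; exact: ler_norm.
have ikf r : 0 < r < t ->
    mu.-integrable `]0, r[ (fun s => ((r - s) `^ (- a) * at_piece tt N f s)%:E).
  move=> /andP[r0 rt]; have /andP[_ a1] := a01.
  apply: integrable_power_kernel => //; first by rewrite (le_trans (ltW rt)).
  move=> n nN; apply: continuous_subspaceW (cf n nN).
  by apply: subset_itvl; rewrite bnd_simp; exact: ltW.
pose D (r : R) : R := \int[mu]_(s in `]0, r[) (K s r * g s).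
have [mD le1] : measurable_fun `]0, t[ D /\
    ((B * \int[mu]_(s in `]0, t[) g s)%:E <=
     \int[mu]_(r in `]0%R, t[) (Num.max 0 (D r))%:E)%E.
  have := le_integral_volterra mK B0 K0 intK mg gL finK; exact.
have gy : \int[mu]_(s in `]0, t[) g s = y t - y 0.
  rewrite -(FTC_C1_pieces tt0 tt_incr t0N C1); apply: eq_Rintegral => s.
  by rewrite inE/= in_itv/= => /gE.
rewrite gy in le1.
have mD0 : measurable_fun (`]0, t[%classic : set R) (fun r : R => Num.max 0 (D r)).
  exact: measurable_maxr.
have DE r : 0 < r < t -> D r = (t - r) `^ (a - 1) *
    \int[mu]_(s in `]0, r[) ((r - s) `^ (- a) * at_piece tt N f s).
  move=> r0t; have /andP[r0 rt] := r0t.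
  rewrite -RintegralZl//; last exact: ikf.
  apply: eq_Rintegral => s; rewrite inE/= in_itv/= => /andP[s0 sr].
  by rewrite gE ?mulrA// s0 (lt_trans sr).
have cV0 : 0 <= c^-1 by rewrite invr_ge0 ltW.
have le2 : (\int[mu]_(r in `]0%R, t[) (c^-1%:E * (Num.max 0 (D r))%:E) <=
    \int[mu]_(r in `[0%R, t]) ((t - r) `^ (a - 1) * G r)%:E)%E.
  apply: ge0_le_lower_integral => //.
  - exact: subset_itv_oo_cc.
  - move=> r _; rewrite -EFinM lee_fin; apply: mulr_ge0 => //.
    by rewrite le_max lexx.
  - move=> r; rewrite /= in_itv/= => r0t; have /andP[r0 rt] := r0t.
    have kG : 0 <= (t - r) `^ (a - 1) * G r.
      by apply: mulr_ge0; [exact: powR_ge0|apply: G0; rewrite !ltW].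
    rewrite -EFinM lee_fin ler_pdivrMl// ge_max; apply/andP; split.
      by apply: mulr_ge0 => //; exact: ltW.
    rewrite DE// mulrCA; apply: ler_wpM2l; first exact: powR_ge0.
    exact: DG.
apply: le_trans le2; rewrite ge0_integralZl_EFin//; last 2 first.
- by move=> r _; rewrite lee_fin le_max lexx.
- exact/measurable_EFinP.
apply: (@le_trans _ _ (c^-1%:E * (B * (y t - y 0))%:E)%E).
  rewrite -EFinM lee_fin (mulrC pi) -mulrA; apply: ler_wpM2l => //.
  by apply: ler_wpM2r => //; exact: ltW.
by apply: lee_wpmul2l => //; rewrite lee_fin.
Qed.

End fractional_comparison.

(** * Calculus for L2-valued functions of time *)
Section L2_calculus.
Context {R : realType} {d : nat} (Omega : set 'rV[R]_d).
Hypothesis mOmega : measurable Omega.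
Local Notation L2 := (L2 Omega).
Local Notation ip := (ip Omega).
Local Notation nrm := (l2norm Omega).
Implicit Types (D : set R) (v w : R -> scalar_field R d) (a b : scalar_field R d).

Lemma dominated_cvg_dist (T : Type) (F : set_system T) (FF : Filter F)
    (f g : T -> R) (l : R) :
  (\forall x \near F, `|f x - l| <= g x) -> g x @[x --> F] --> (0 : R) ->
  f x @[x --> F] --> l.
Proof.
move=> fg g0; apply/cvgrPdist_lt => e e0.
move/cvgrPdist_lt : g0 => /(_ e e0) ge.
near=> x; rewrite distrC; apply: (@le_lt_trans _ _ (g x)).
  by near: x.
have : `|0 - g x| < e by near: x.
by rewrite sub0r normrN; apply: le_lt_trans; exact: ler_norm.
Unshelve. all: by end_near. Qed.

Lemma is_derive_quotient (f : R -> R) (s l : R) :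
  (z - s)^-1 * (f z - f s) @[z --> s^'] --> l -> is_derive s 1 f l.
Proof.
move=> fl.
have H : h^-1 *: ((f \o shift s) (h *: (1 : R)) - f s) @[h --> 0^'] --> l.
  apply/cvgrPdist_lt => e e0; move/cvgrPdist_lt : fl => /(_ e e0).
  move=> -[/= r r0 hr].
  exists r => //= h; rewrite /ball/= sub0r normrN => hr' h0.
  have := hr (h + s); rewrite /ball /= opprD addrCA subrr addr0 normrN addrK.
  move=> /(_ hr'); rewrite /GRing.scale/= mulr1; apply.
  by apply: contra_neq h0 => /eqP; rewrite -subr_eq0 addrK => /eqP.
by split; [apply: cvgP H|apply: cvg_lim].
Qed.

Lemma has_derivative_dnbhs D v (s : R) a : nbhs s D -> has_derivative nrm D v s a ->
  nrm ((z - s)^-1 *: (v z - v s) - a) @[z --> s^'] --> (0 : R).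
Proof.
move=> Ds h; apply: cvg_trans h; move=> P /=; rewrite /dnbhs /within /=.
move=> h; apply: filterS2 Ds h => z Dz h zs; apply: h; split => //.
exact/eqP.
Qed.

Lemma continuous_on_nbhs D v (s : R) : nbhs s D -> continuous_on nrm D v ->
  nrm (v z - v s) @[z --> s] --> (0 : R).
Proof.
move=> Ds /(_ s (nbhs_singleton Ds)) h; apply: cvg_trans h => P /=.
rewrite /within /= => h; apply: filterS2 Ds h => z Dz; exact.
Qed.

(** Derivatives are only determined up to a field of norm zero, that is, almost
everywhere. *)
Lemma has_derivative_uniq D D' v (s : R) a b : nbhs s D -> nbhs s D' ->
  (forall z, D z -> L2 (v z)) -> L2 a -> L2 b ->
  has_derivative nrm D v s a -> has_derivative nrm D' v s b -> nrm (a - b) = 0.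
Proof.
move=> Ds D's Lv La Lb /(has_derivative_dnbhs Ds) ha /(has_derivative_dnbhs D's) hb.
have Lvs := Lv _ (nbhs_singleton Ds).
have h0 : nrm ((z - s)^-1 *: (v z - v s) - a) +
    nrm ((z - s)^-1 *: (v z - v s) - b) @[z --> s^'] --> (0 : R).
  by rewrite -[X in _ --> X]addr0; exact: cvgD.
have hc : nrm (a - b) @[z --> s^'] --> (0 : R).
  apply: dominated_cvg_dist h0.
  have Ds' : \forall z \near s^', D z by apply: nbhs_dnbhs.
  near=> z; rewrite subr0 (ger0_norm (l2norm_ge0 _ _)).
  have Lq : L2 ((z - s)^-1 *: (v z - v s)).
    apply/(L2Z mOmega)/(L2B mOmega) => //; apply: Lv; near: z; exact: Ds'.
  have Lqa := L2B mOmega Lq La; have Lqb := L2B mOmega Lq Lb.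
  rewrite (_ : a - b = (((z - s)^-1 *: (v z - v s)) - b) -
    (((z - s)^-1 *: (v z - v s)) - a)); last by rewrite opprB [RHS]addrC addrA subrK.
  by rewrite [leRHS]addrC; exact: (l2normB mOmega Lqb Lqa).
by apply: (cvg_unique _ _ hc) => //; exact: cvg_cst.
Unshelve. all: by end_near. Qed.

Lemma ip_continuous_within D v w : (forall z, D z -> L2 (v z)) ->
  (forall z, D z -> L2 (w z)) ->
  continuous_on nrm D v -> continuous_on nrm D w ->
  {within D, continuous (fun s => ip (v s) (w s))}.
Proof.
move=> Lv Lw cv cw; apply/subspace_continuousP => s Ds.
change (ip (v z) (w z) @[z --> within D (nbhs s)] --> ip (v s) (w s)).
have /= g0 : nrm (v z - v s) * (nrm (w z - w s) + nrm (w s)) +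
    nrm (v s) * nrm (w z - w s) @[z --> within D (nbhs s)] --> (0 : R).
  rewrite -[X in _ --> X]addr0 -[X in _ --> X + _](mul0r (0 + nrm (w s))).
  rewrite -[X in _ --> _ + X](mulr0 (nrm (v s))).
  apply: cvgD; apply: cvgM; [exact: cv| |exact: cvg_cst|exact: cw].
  by apply: cvgD; [exact: cw|exact: cvg_cst].
apply: dominated_cvg_dist g0; near=> z.
have Dz : D z by near: z; exact: withinT.
have [[[Lvz Lvs] Lwz] Lws] := (Lv _ Dz, Lv _ Ds, Lw _ Dz, Lw _ Ds).
have LB := L2B mOmega.
rewrite (_ : ip (v z) (w z) - ip (v s) (w s) =
    ip (v z - v s) ((w z - w s) + w s) + ip (v s) (w z - w s)); last first.
  by rewrite subrK (ipBl mOmega)// (ipBr mOmega)// addrA subrK.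
apply: le_trans (ler_normD _ _) _; apply: lerD.
  apply: le_trans (cauchy_schwarz mOmega _ _) _; first exact: LB.
    by rewrite subrK.
  by apply: ler_wpM2l; [exact: l2norm_ge0|apply: l2normD => //; exact: LB].
by apply: cauchy_schwarz => //; exact: LB.
Unshelve. all: by end_near. Qed.

Lemma is_derive_ip D v (s : R) a (b : scalar_field R d) : nbhs s D ->
  (forall z, D z -> L2 (v z)) -> L2 a -> L2 b ->
  has_derivative nrm D v s a -> is_derive s 1 (fun z => ip (v z) b) (ip a b).
Proof.
move=> Ds Lv La Lb /(has_derivative_dnbhs Ds) ha; apply: is_derive_quotient.
have Lvs := Lv _ (nbhs_singleton Ds).
have g0 : nrm ((z - s)^-1 *: (v z - v s) - a) * nrm b @[z --> s^'] --> (0 : R).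
  by rewrite -[X in _ --> X](mul0r (nrm b)); apply: cvgM => //; exact: cvg_cst.
apply: dominated_cvg_dist g0.
have Ds' : \forall z \near s^', D z by apply: nbhs_dnbhs.
near=> z.
have Lvz : L2 (v z) by apply: Lv; near: z; exact: Ds'.
have Lq : L2 ((z - s)^-1 *: (v z - v s)) by apply/(L2Z mOmega)/(L2B mOmega).
rewrite -(ipBl mOmega)// -(ipZl mOmega)//; last exact: L2B.
rewrite -(ipBl mOmega)//; apply: cauchy_schwarz => //; exact: L2B.
Unshelve. all: by end_near. Qed.

Lemma is_derive_sqr_l2norm D v (s : R) a : nbhs s D ->
  (forall z, D z -> L2 (v z)) -> L2 a -> continuous_on nrm D v ->
  has_derivative nrm D v s a ->
  is_derive s 1 (fun z => ip (v z) (v z)) (2 * ip (v s) a).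
Proof.
move=> Ds Lv La cv /(has_derivative_dnbhs Ds) ha; apply: is_derive_quotient.
have Lvs := Lv _ (nbhs_singleton Ds).
have cv0 : nrm (v z - v s) @[z --> s^'] --> (0 : R).
  by apply: cvg_within_filter; exact: continuous_on_nbhs cv.
have g0 : nrm ((z - s)^-1 *: (v z - v s) - a) * (nrm (v z - v s) + 2 * nrm (v s)) +
    nrm a * nrm (v z - v s) @[z --> s^'] --> (0 : R).
  rewrite -[X in _ --> X]addr0 -[X in _ --> X + _](mul0r (0 + 2 * nrm (v s))).
  rewrite -[X in _ --> _ + X](mulr0 (nrm a)).
  apply: cvgD; apply: cvgM; [exact: ha| |exact: cvg_cst|exact: cv0].
  by apply: cvgD; [exact: cv0|exact: cvg_cst].
apply: dominated_cvg_dist g0.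
have Ds' : \forall z \near s^', D z by apply: nbhs_dnbhs.
near=> z.
have Lvz : L2 (v z) by apply: Lv; near: z; exact: Ds'.
have Ldv := L2B mOmega Lvz Lvs.
have Lq : L2 ((z - s)^-1 *: (v z - v s)) by exact: L2Z.
have Lqa := L2B mOmega Lq La.
set q := (z - s)^-1 *: (v z - v s) in Lq Lqa *.
have L2vs := L2Z mOmega 2 Lvs.
have Lsum := L2D mOmega Ldv L2vs.
have e1 : (z - s)^-1 * (ip (v z) (v z) - ip (v s) (v s)) =
    ip q ((v z - v s) + 2 *: v s).
  rewrite /q (ipZl mOmega _ Ldv Lsum); congr (_ * _).
  rewrite (ipDr mOmega Ldv L2vs Ldv) (ipZr mOmega _ Lvs Ldv).
  rewrite (ipBl mOmega Lvz Lvs Ldv) (ipBl mOmega Lvz Lvs Lvs).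
  rewrite (ipBr mOmega Lvz Lvs Lvz) (ipBr mOmega Lvz Lvs Lvs).
  by rewrite (ipC Omega (v s) (v z)); ring.
have e2 : (z - s)^-1 * (ip (v z) (v z) - ip (v s) (v s)) - 2 * ip (v s) a =
    ip (q - a) ((v z - v s) + 2 *: v s) + ip a (v z - v s).
  rewrite e1 (ipBl mOmega Lq La Lsum) (ipDr mOmega Ldv L2vs La).
  by rewrite (ipZr mOmega _ Lvs La) (ipC Omega (v s) a); ring.
rewrite e2; apply: le_trans (ler_normD _ _) _; apply: lerD.
  apply: le_trans (cauchy_schwarz mOmega Lqa Lsum) _.
  apply: ler_wpM2l; first exact: l2norm_ge0.
  apply: le_trans (l2normD mOmega Ldv L2vs) _.
  by rewrite (l2normZ mOmega _ Lvs) ger0_norm.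
exact: cauchy_schwarz.
Unshelve. all: by end_near. Qed.

End L2_calculus.

(** * The energy estimate *)

Lemma cauchy_schwarz_pair (R : realType) (p q e y z : R) :
  0 <= p -> 0 <= q -> 0 <= y -> 0 <= z ->
  y ^+ 2 = p ^+ 2 + e ^+ 2 -> z ^+ 2 = q ^+ 2 + e ^+ 2 ->
  p * q + e ^+ 2 <= z * y.
Proof.
move=> p0 q0 y0 z0 yE zE.
have pqe : 0 <= p * q + e ^+ 2 by rewrite addr_ge0 ?sqr_ge0// mulr_ge0.
have zy : 0 <= z * y by rewrite mulr_ge0.
rewrite -(@ler_pXn2r _ 2)// [leRHS]exprMn yE zE.
rewrite -subr_ge0 (_ : _ - _ = e ^+ 2 * (p - q) ^+ 2); last by ring.
by rewrite mulr_ge0 ?sqr_ge0.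
Qed.

Section trajectory.
Context {R : realType} {d : nat} (Omega : set 'rV[R]_d).
Hypothesis mOmega : measurable Omega.
Local Notation L2 := (L2 Omega).
Local Notation ip := (ip Omega).
Local Notation nrm := (l2norm Omega).
Local Notation mu := (@lebesgue_measure R).
Variables (tt : nat -> R) (N : nat).
Hypothesis tt0 : tt 0%N = 0.
Hypothesis tt_incr : forall n, (n < N)%N -> tt n < tt n.+1.
Local Notation T := (tt N).
Variables (rho : R -> scalar_field R d) (V : nat -> R -> scalar_field R d).
Hypothesis Lrho : forall s : R, `[0, T]%classic s -> L2 (rho s).
Hypothesis LV : forall n (s : R), (n <= N)%N -> `[0, T]%classic s -> L2 (V n s).
Hypothesis crho : continuous_on nrm `[0, T] rho.
Hypothesis cV : forall n, (n <= N)%N -> continuous_on nrm `[0, T] (V n).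
Hypothesis drho : forall n s, (1 <= n <= N)%N -> tt n.-1 < s < tt n ->
  has_derivative nrm `[0, T] rho s (V n s).

Lemma piece_nbhs n (s : R) : (1 <= n <= N)%N -> tt n.-1 < s < tt n ->
  nbhs s `[0, T]%classic.
Proof.
move=> /andP[n1 nN] /andP[ns sn].
have s0 : 0 < s.
  apply: le_lt_trans ns; rewrite -tt0; apply: (le_nodes tt_incr).
  by rewrite /= (leq_trans (leq_pred _)).
have sT : s < T.
  by apply: lt_le_trans sn _; apply: (le_nodes tt_incr); rewrite nN leqnn.
apply: (@filterS _ _ _ `]0, T[%classic); first exact: subset_itv_oo_cc.
by apply: near_in_itvoo; rewrite in_itv/= s0.
Qed.

Section regularized.
Variable e : R.
Hypothesis e0 : 0 < e.

(** The norm is not differentiable at the zeros of the trajectory; adding e ^+ 2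
under the root removes the singularity. *)
Definition regnorm (s : R) : R := Num.sqrt (ip (rho s) (rho s) + e ^+ 2).

Definition regnorm' (n : nat) (s : R) : R := ip (rho s) (V n s) / regnorm s.

Lemma regnorm_arg_gt0 s : 0 < ip (rho s) (rho s) + e ^+ 2.
Proof. by rewrite ltr_wpDl ?ip_ge0// exprn_gt0. Qed.

Lemma regnorm_gt0 s : 0 < regnorm s.
Proof. by rewrite sqrtr_gt0 regnorm_arg_gt0. Qed.

Lemma sqr_regnorm s : regnorm s ^+ 2 = ip (rho s) (rho s) + e ^+ 2.
Proof. by rewrite sqr_sqrtr// ltW// regnorm_arg_gt0. Qed.

Lemma l2norm_le_regnorm s : nrm (rho s) <= regnorm s.
Proof. by rewrite ler_wsqrtr// lerDl sqr_ge0. Qed.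

Lemma regnorm_le s : regnorm s <= nrm (rho s) + e.
Proof.
rewrite -(@ler_pXn2r _ 2)// ?nnegrE ?addr_ge0 ?l2norm_ge0 ?(ltW (regnorm_gt0 _)) ?(ltW e0)//.
rewrite sqr_regnorm sqrrD sqr_l2norm -addrA lerD2l lerDr.
by rewrite mulrn_wge0// mulr_ge0 ?l2norm_ge0// ltW.
Qed.

Let sub_time (x : R) : x <= T -> (`[0, x]%classic : set R) `<=` `[0, T]%classic.
Proof. by move=> xT; apply: subset_itvl; rewrite bnd_simp. Qed.

Let continuous_regnorm : {within `[0, T], continuous regnorm}.
Proof.
have /subspace_continuousP c1 := ip_continuous_within mOmega Lrho Lrho crho crho.
apply/subspace_continuousP => s Ts; rewrite /regnorm.
apply: (@continuous_cvg _ _ _ _ _ (fun z => ip (rho z) (rho z) + e ^+ 2) Num.sqrt).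
  exact: sqrt_continuous.
by apply: cvgD; [exact: c1|exact: cvg_cst].
Qed.

Let continuous_regnorm' n : (n <= N)%N -> {within `[0, T], continuous (regnorm' n)}.
Proof.
move=> nN; have /subspace_continuousP c1 :=
  ip_continuous_within mOmega Lrho (fun s => LV nN) crho (cV nN).
have /subspace_continuousP c2 := continuous_regnorm.
apply/subspace_continuousP => s Ts; apply: cvgM; first exact: c1.
apply: cvgV; last exact: c2.
by rewrite gt_eqF// regnorm_gt0.
Qed.

Let is_derive_regnorm n s : (1 <= n <= N)%N -> tt n.-1 < s < tt n ->
  is_derive s 1 regnorm (regnorm' n s).
Proof.
move=> nN sn; have Ts := piece_nbhs nN sn; have /andP[_ n_le] := nN.
have d1 := is_derive_sqr_l2norm mOmega Ts Lrho (LV n_le (nbhs_singleton Ts)) crho (drho nN sn).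
have d2 : is_derive s 1 (fun z => ip (rho z) (rho z) + e ^+ 2) (2 * ip (rho s) (V n s)).
  by apply: is_derive_eq; rewrite addr0.
have d3 := is_derive1_sqrt (regnorm_arg_gt0 s).
have := @is_derive1_comp _ _ _ s _ _ d3 d2.
rewrite (_ : _ * (2 * _) = regnorm' n s)//.
rewrite /regnorm' -/(regnorm s).
have r0 : regnorm s != 0 by rewrite gt_eqF// regnorm_gt0.
by move: (regnorm s) (ip _ _) r0 => y q y0; field.
Qed.

Lemma C1_regnorm x : x <= T -> C1_pieces tt N x regnorm regnorm'.
Proof.
move=> xT; split; first exact: continuous_subspaceW (sub_time xT) continuous_regnorm.
move=> n nN; have /andP[_ n_le] := nN; split.
  exact: continuous_subspaceW (sub_time xT) (continuous_regnorm' n_le).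
by move=> s sn _; exact: is_derive_regnorm.
Qed.

(** By the Cauchy-Schwarz inequality for the pairs (rho s, e) and (rho tau, e), the
function m below is nonpositive; it vanishes at tau. *)
Lemma regnorm_kernel_le (a tau : R) : 0 < a < 1 -> 0 < tau -> tau <= T ->
  regnorm tau * (\int[mu]_(s in `]0, tau[) ((tau - s) `^ (- a) * at_piece tt N regnorm' s)) <=
  \int[mu]_(s in `]0, tau[) ((tau - s) `^ (- a) *
    at_piece tt N (fun n s => ip (V n s) (rho tau)) s).
Proof.
move=> a01 tau0 tauT.
have tau_in : 0 <= tau <= T by rewrite ltW.
have Ttau : `[0, T]%classic tau by rewrite /= in_itv.
have Lt := Lrho Ttau.
pose p s := ip (rho s) (rho tau).
pose p' n s := ip (V n s) (rho tau).
pose y := regnorm tau.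
have cst_cont D : continuous_on nrm D (fun=> rho tau).
  by move=> s _; rewrite subrr l2norm0; exact: cvg_cst.
have C1p : C1_pieces tt N tau p p'.
  split.
    apply: (continuous_subspaceW (sub_time tauT)).
    exact: (ip_continuous_within mOmega Lrho (fun _ _ => Lt) crho (cst_cont _)).
  move=> n nN; have /andP[_ n_le] := nN; split.
    apply: (continuous_subspaceW (sub_time tauT)).
    exact: (ip_continuous_within mOmega (fun s => LV n_le) (fun _ _ => Lt)
      (cV n_le) (cst_cont _)).
  move=> s sn _; have Ts := piece_nbhs nN sn.
  exact: (is_derive_ip mOmega Ts Lrho (LV n_le (nbhs_singleton Ts)) Lt (drho nN sn)).
have C1y := C1_regnorm tauT.
pose m s := p s + e ^+ 2 - y * regnorm s.
pose m' n s := p' n s - y * regnorm' n s.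
have C1m : C1_pieces tt N tau m m'.
  have [/subspace_continuousP cp dp] := C1p.
  have [/subspace_continuousP cy dy] := C1y.
  split.
    apply/subspace_continuousP => s st; apply: cvgB.
      by apply: cvgD; [exact: cp|exact: cvg_cst].
    by apply: cvgM; [exact: cvg_cst|exact: cy].
  move=> n nN; have [/subspace_continuousP cp' dp'] := dp n nN.
  have [/subspace_continuousP cy' dy'] := dy n nN; split.
    apply/subspace_continuousP => s st; apply: cvgB; first exact: cp'.
    by apply: cvgM; [exact: cvg_cst|exact: cy'].
  move=> s sn st; have d1 := dp' s sn st; have d2 := dy' s sn st.
  by apply: is_derive_eq; rewrite addr0.
have m_le0 s : 0 <= s <= tau -> m s <= 0.
  move=> /andP[s0 st].
  have Ls : L2 (rho s) by apply: Lrho; rewrite /= in_itv/= s0 (le_trans st).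
  rewrite /m subr_le0; apply: le_trans (_ : nrm (rho s) * nrm (rho tau) + e ^+ 2 <= _).
    by rewrite lerD2r; exact: ip_le_l2norm.
  apply: cauchy_schwarz_pair; rewrite ?l2norm_ge0 ?(ltW (regnorm_gt0 _))//.
    by rewrite sqr_regnorm sqr_l2norm.
  by rewrite sqr_regnorm sqr_l2norm.
have m_tau : m tau = 0.
  by rewrite /m /p -sqr_regnorm -expr2 subrr.
have k_ge0 := power_kernel_sign tt0 tt_incr tau_in m_le0 m_tau C1m a01 tau0.
have /andP[_ a1] := a01.
have ip' : mu.-integrable `]0, tau[
    (fun s => ((tau - s) `^ (- a) * at_piece tt N p' s)%:E).
  by apply: integrable_power_kernel => // n /(C1p.2 n)[].
have iy' : mu.-integrable `]0, tau[
    (fun s => ((tau - s) `^ (- a) * at_piece tt N regnorm' s)%:E).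
  by apply: integrable_power_kernel => // n /(C1y.2 n)[].
rewrite -RintegralZl// -subr_ge0 -RintegralB//; last exact: (integrableZl _ y iy').
rewrite (_ : Rintegral _ _ _ =
  \int[mu]_(s in `]0, tau[) ((tau - s) `^ (- a) * at_piece tt N m' s))//.
apply: eq_Rintegral => s _; rewrite /at_piece /m' mulrBr; congr (_ - _).
by rewrite mulrCA.
Qed.

End regularized.

(** The hypothesis bounds the Caputo derivative of the trajectory tested with the
trajectory. The comparison lemma applies to the regularized norm, and then e
tends to 0. *)
Lemma energy_estimate (a t c : R) (G : R -> R) :
  0 < a < 1 -> 0 < t <= T -> 0 < c ->
  (forall r, 0 <= r <= t -> 0 <= G r) ->
  (forall r, 0 < r < t ->
     \int[mu]_(s in `]0, r[) ((r - s) `^ (- a) *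
       at_piece tt N (fun n s => ip (V n s) (rho r)) s) <= c * (nrm (rho r) * G r)) ->
  ((pi / c * (nrm (rho t) - nrm (rho 0)))%:E <=
   \int[mu]_(r in `[0%R, t]) ((t - r) `^ (a - 1) * G r)%:E)%E.
Proof.
move=> a01 /[dup] t0T /andP[t0 tT] c0 G0 HG.
have step e : 0 < e -> ((pi / c * (regnorm e t - regnorm e 0))%:E <=
    \int[mu]_(r in `[0%R, t]) ((t - r) `^ (a - 1) * G r)%:E)%E.
  move=> e0.
  apply: (fractional_comparison tt0 tt_incr a01 t0T c0 (C1_regnorm e0 tT) G0).
  move=> r /[dup] r0t /andP[r0 rt].
  have rT : r <= T by rewrite (le_trans (ltW rt)).
  rewrite -(ler_pM2l (regnorm_gt0 e0 r)).
  apply: le_trans (regnorm_kernel_le e0 a01 r0 rT) _.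
  apply: le_trans (HG r r0t) _; rewrite mulrCA; apply: ler_wpM2r.
    by rewrite mulr_ge0 ?(ltW c0) ?G0 ?ltW.
  exact: l2norm_le_regnorm.
have pic : 0 < pi / c by rewrite divr_gt0// pi_gt0.
have I0 : (0 <= \int[mu]_(r in `[0%R, t]) ((t - r) `^ (a - 1) * G r)%:E)%E.
  apply: integral_ge0 => r; rewrite /= in_itv/= => /G0 Gr; rewrite lee_fin.
  by apply: mulr_ge0 => //; exact: powR_ge0.
move: I0 step; case: (integral _ _ _) => [I| |]// I0 step; last by rewrite leey.
rewrite lee_fin; apply/ler_addgt0Pr => e e0.
(* The regularization costs at most pi / c * e', which is e for this choice. *)
have e'0 : 0 < e / (pi / c) by rewrite divr_gt0.
have := step _ e'0; rewrite lee_fin => stepe.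
have := l2norm_le_regnorm (e / (pi / c)) t; have := regnorm_le e'0 0.
set e' := e / (pi / c) in stepe e'0 *.
have -> : e = pi / c * e' by rewrite /e' mulrC divfK// gt_eqF.
move=> h1 h2; apply: le_trans (_ : pi / c * (regnorm e' t - regnorm e' 0) + pi / c * e' <= _).
  by rewrite -mulrDr ler_wpM2l ?(ltW pic)//; lra.
by rewrite lerD2r.
Qed.

End trajectory.

(** * Bochner integrals *)
Section bochner.
Context {R : realType} {d : nat} (Omega : set 'rV[R]_d).
Hypothesis mOmega : measurable Omega.
Local Notation L2 := (L2 Omega).
Local Notation ip := (ip Omega).
Local Notation nrm := (l2norm Omega).
Local Notation mu := (@lebesgue_measure R).
Variable D : set (measurableTypeR R).
Hypothesis mD : measurable D.
Hypothesis muD : (mu D < +oo)%E.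

Lemma Rintegral_simple (I : eqType) (l : seq I) (B : I -> set (measurableTypeR R))
    (r : I -> R) : (forall i, i \in l -> measurable (B i)) ->
  let h s := \sum_(i <- l) r i * (\1_(B i) s : R) in
  mu.-integrable D (EFin \o h) /\
  \int[mu]_(s in D) h s = \sum_(i <- l) r i * fine (mu (B i `&` D)).
Proof.
elim: l => [|i l ih] mB h.
  have -> : h = cst 0 by apply/funext => s; rewrite /h big_nil.
  by rewrite big_nil /Rintegral integral0; split => //; exact: integrable0.
have [|ihi ihE] := ih; first by move=> j jl; apply: mB; rewrite inE jl orbT.
have mBi : measurable (B i) by apply: mB; rewrite mem_head.
have i1 : mu.-integrable D (EFin \o (\1_(B i) : _ -> R)).
  apply: (@bounded_integrable _ _ _ 1) => //.
  by move=> s _; rewrite indicE; case: (_ \in _); rewrite ?normr1 ?normr0.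
have ri1 : mu.-integrable D (EFin \o (fun s => r i * (\1_(B i) s : R))).
  exact: (integrableZl mD (r i) i1).
have -> : h = (fun s => r i * (\1_(B i) s : R) +
    \sum_(j <- l) r j * (\1_(B j) s : R)).
  by apply/funext => s; rewrite /h big_cons.
split; first exact: (integrableD mD ri1 ihi).
rewrite RintegralD// RintegralZl// ihE big_cons; congr (_ * _ + _).
by rewrite /Rintegral integral_indic.
Qed.

(** Testing a Bochner integral against a fixed element reduces it to a Lebesgue
integral: the simple approximants converge in L1, hence so do their inner
products. *)
Lemma ip_bochner (F : R -> scalar_field R d) (w psi : scalar_field R d) (G : R -> R) :
  is_bochner_integral Omega D F w -> L2 psi -> mu.-integrable D (EFin \o G) ->
  {ae mu, forall s, D s -> ip (F s) psi = G s} ->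
  ip w psi = \int[mu]_(s in D) G s.
Proof.
move=> [Lw LF [S [LS mS cS wS]]] Lpsi iG FG.
pose H k s := \sum_(p <- S k) ip p.2 psi * (\1_(p.1) s : R).
have Lsimple k s : L2 (simple_fun (S k) s).
  by apply: (L2_sum mOmega) => p pS _; apply/(L2Z mOmega)/(LS k p pS).2.
have LsimpleI k : L2 (simple_integral D (S k)).
  by apply: (L2_sum mOmega) => p pS _; apply/(L2Z mOmega)/(LS k p pS).2.
have HE k s : H k s = ip (simple_fun (S k) s) psi.
  rewrite /H /simple_fun (ip_suml mOmega)//; last first.
    by move=> p pS _; apply/(L2Z mOmega)/(LS k p pS).2.
  rewrite big_seq [RHS]big_seq; apply: eq_bigr => p pS.
  by rewrite (ipZl mOmega _ (LS k p pS).2 Lpsi) mulrC.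
have [iH intH] : (forall k, mu.-integrable D (EFin \o H k)) /\
    (forall k, \int[mu]_(s in D) H k s = ip (simple_integral D (S k)) psi).
  split=> k; have [] := @Rintegral_simple _ (S k) fst (fun p => ip p.2 psi).
  - by move=> p pS; exact: (LS k p pS).1.
  - by [].
  - by move=> p pS; exact: (LS k p pS).1.
  move=> _ ->; rewrite /simple_integral (ip_suml mOmega)//; last first.
    by move=> p pS _; apply/(L2Z mOmega)/(LS k p pS).2.
  rewrite big_seq [RHS]big_seq; apply: eq_bigr => p pS.
  by rewrite (ipZl mOmega _ (LS k p pS).2 Lpsi) mulrC.
have cvg1 : \int[mu]_(s in D) H k s @[k --> \oo] --> ip w psi.
  under eq_fun do rewrite intH.
  have g0 : nrm (simple_integral D (S k) - w) * nrm psi @[k --> \oo] --> (0 : R).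
    by rewrite -[X in _ --> X](mul0r (nrm psi)); apply: cvgM => //; exact: cvg_cst.
  apply: dominated_cvg_dist g0; apply: nearW => k.
  rewrite -(ipBl mOmega)//; apply: cauchy_schwarz => //; exact: L2B.
have cvg2 : \int[mu]_(s in D) H k s @[k --> \oo] --> \int[mu]_(s in D) G s.
  have cS' : ((nrm psi)%:E * \int[mu]_(s in D) (nrm (F s - simple_fun (S k) s))%:E)%E
      @[k --> \oo] --> 0%E.
    by rewrite -(mule0 (nrm psi)%:E); apply: cvgeZl.
  have cS'' : fine ((nrm psi)%:E * \int[mu]_(s in D) (nrm (F s - simple_fun (S k) s))%:E)%E
      @[k --> \oo] --> (0 : R) by exact: fine_cvg cS'.
  apply: dominated_cvg_dist cS''.
  move/fine_cvgP : (cS') => [fin_cS _]; apply: filterS fin_cS => k fin_k.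
  rewrite -RintegralB//.
  have iHG : mu.-integrable D (EFin \o (fun s => H k s - G s)).
    exact: (integrableB mD (iH k) iG).
  rewrite -lee_fin fineK// EFin_normr_Rintegral//.
  apply: le_trans (le_abse_integral mu mD _) _; first by case/integrableP: iHG.
  rewrite -ge0_integralZl_EFin//; last 3 first.
  - by move=> s _; rewrite lee_fin l2norm_ge0.
  - by apply/measurable_EFinP; exact: mS.
  - exact: l2norm_ge0.
  apply: ae_ge0_le_integral => //.
  - by apply: measurableT_comp => //; case/integrableP: iHG.
  - by move=> s _; rewrite mule_ge0// lee_fin l2norm_ge0.
  - by apply: measurable_funeM; apply/measurable_EFinP; exact: mS.
  - apply: filterS FG => s FGs Ds; rewrite -EFinM abse_EFin lee_fin.
    rewrite -(FGs Ds) HE distrC mulrC -(ipBl mOmega)//; last exact: LF.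
    by apply: cauchy_schwarz => //; apply: L2B => //; exact: LF.
exact: cvg_unique cvg1 cvg2.
Qed.

Import HBSimple.

Let sfun_seq (g : {sfun (measurableTypeR R) >-> R}) :
  exists l : seq (set (measurableTypeR R) * R),
    (forall p, p \in l -> measurable p.1) /\
    forall s, g s = \sum_(p <- l) p.2 * (\1_(p.1) s : R).
Proof.
exists [seq (g @^-1` [set y], y) | y <- enum_fset (fset_set (range g))]; split.
  by move=> p /mapP[y _ ->] /=; exact: measurable_funPTI.
move=> s; rewrite big_map/= fimfunE fsbig_finite//=.
Qed.

Lemma ip_finite_rank (I : finType) (a b : I -> R) (x : I -> scalar_field R d) :
  (forall i, L2 (x i)) ->
  ip (\sum_i a i *: x i) (\sum_i b i *: x i) =
  \sum_i a i * \sum_j b j * ip (x j) (x i).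
Proof.
move=> Lx; have Lax (e : I -> R) i : L2 (e i *: x i) by exact: L2Z.
have Ls e : L2 (\sum_i e i *: x i) by apply: (L2_sum mOmega) => i _ _.
rewrite (ip_suml mOmega)//; apply: eq_bigr => i _.
rewrite (ipZl mOmega)// ipC (ip_suml mOmega)//; congr (_ * _).
by apply: eq_bigr => j _; rewrite (ipZl mOmega).
Qed.

(** The coefficients are approximated in L1 by simple functions, and the error of
the field is at most the sum of these errors weighted by the norms of the x i. *)
Lemma bochner_integral_finite_rank (n : nat) (c : 'I_n -> R -> R)
    (x : 'I_n -> scalar_field R d) :
  (forall i, mu.-integrable D (EFin \o c i)) -> (forall i, L2 (x i)) ->
  is_bochner_integral Omega D (fun s => \sum_i c i s *: x i)
    (\sum_i (\int[mu]_(s in D) c i s) *: x i).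
Proof.
move=> ic Lx.
have Lcx (e : 'I_n -> R) : L2 (\sum_i e i *: x i).
  by apply: (L2_sum mOmega) => i _ _; exact: L2Z.
have approx i : exists g : nat -> {sfun (measurableTypeR R) >-> R},
    (forall k, mu.-integrable D (EFin \o g k)) /\
    (\int[mu]_(s in D) `|(c i s)%:E - (g k s)%:E|)%E @[k --> \oo] --> 0%E.
  by have [g [ig _ cg]] := approximation_sfun_integrable mD (ic i); exists g.
have [g hg] := choice approx.
have [l hl] := choice (fun ik : 'I_n * nat => sfun_seq (g ik.1 ik.2)).
pose S k := [seq (p.1, p.2 *: x i) | i <- enum 'I_n, p <- l (i, k)].
have SE k s : simple_fun (S k) s = \sum_i g i k s *: x i.
  rewrite /simple_fun /S big_allpairs_dep/= big_enum/=; apply: eq_bigr => i _.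
  rewrite (hl (i, k)).2 scaler_suml; apply: eq_bigr => p _.
  by rewrite scalerA mulrC.
have SI k : simple_integral D (S k) = \sum_i (\int[mu]_(s in D) g i k s) *: x i.
  rewrite /simple_integral /S big_allpairs_dep/= big_enum/=; apply: eq_bigr => i _.
  have [_] := @Rintegral_simple _ (l (i, k)) fst snd (hl (i, k)).1.
  rewrite (_ : (fun s => _) = g i k); last by apply/funext => s; rewrite (hl (i, k)).2.
  move=> ->; rewrite scaler_suml; apply: eq_bigr => p _.
  by rewrite scalerA mulrC.
have FSE k s : \sum_i c i s *: x i - simple_fun (S k) s =
    \sum_i (c i s - g i k s) *: x i.
  by rewrite SE -sumrB; apply: eq_bigr => i _; rewrite scalerBl.
have icg i k : mu.-integrable D (EFin \o (fun s => c i s - g i k s)).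
  exact: (integrableB mD (ic i) ((hg i).1 k)).
have mcg i k : measurable_fun D (fun s => c i s - g i k s).
  by apply/measurable_EFinP; case/integrableP: (icg i k).
have mnrm k : measurable_fun D (fun s => nrm (\sum_i c i s *: x i - simple_fun (S k) s)).
  under eq_fun do rewrite FSE /l2norm ip_finite_rank//.
  apply: measurableT_comp.
    exact: continuous_measurable_fun (@sqrt_continuous R).
  apply: measurable_sum => i; apply: measurable_funM; first exact: mcg.
  by apply: measurable_sum => j; apply: measurable_funM; first exact: mcg.
have nrm_le (e : 'I_n -> R) : nrm (\sum_i e i *: x i) <= \sum_i `|e i| * nrm (x i).
  apply: le_trans (l2norm_sum mOmega _) _; first by move=> i _; exact: L2Z.
  by apply: ler_sum => i _; rewrite (l2normZ mOmega).
pose err k i := \int[mu]_(s in D) `|c i s - g i k s|.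
have errE k i : (\int[mu]_(s in D) `|c i s - g i k s|%:E = (err k i)%:E)%E.
  rewrite /err /Rintegral fineK//; apply: integrable_fin_num => //.
  exact: integrable_norm (icg i k).
have err0 i : err k i @[k --> \oo] --> (0 : R).
  exact: (fine_cvg (hg i).2).
have g0 : \sum_i err k i * nrm (x i) @[k --> \oo] --> (0 : R).
  rewrite [X in _ --> X](_ : _ = \sum_(i < n) 0 * nrm (x i)); last first.
    by rewrite big1// => i _; rewrite mul0r.
  apply: cvg_big => [|i _]; first exact: add_continuous.
  by apply: cvgM; [exact: err0|exact: cvg_cst].
have err_le k : (\int[mu]_(s in D) (nrm (\sum_i c i s *: x i - simple_fun (S k) s))%:E <=
    (\sum_i err k i * nrm (x i))%:E)%E.
  apply: (@le_trans _ _
      (\int[mu]_(s in D) \sum_i (`|c i s - g i k s|%:E * (nrm (x i))%:E))%E).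
    apply: ge0_le_integral => //.
    - by move=> s _; rewrite lee_fin l2norm_ge0.
    - by apply/measurable_EFinP; exact: mnrm.
    - apply: emeasurable_sum => i; apply: emeasurable_funM => //.
      by apply/measurable_EFinP; apply: measurableT_comp => //; exact: mcg.
    - move=> s _; rewrite FSE.
      apply: (@le_trans _ _ (\sum_i `|c i s - g i k s| * nrm (x i))%:E).
        by rewrite lee_fin; exact: nrm_le.
      by rewrite -sumEFin; apply: lee_sum => i _; rewrite EFinM.
  rewrite ge0_integral_sum//; last 2 first.
  - move=> i; apply: emeasurable_funM => //.
    by apply/measurable_EFinP; apply: measurableT_comp => //; exact: mcg.
  - by move=> i s _; rewrite mule_ge0// lee_fin ?normr_ge0 ?l2norm_ge0.
  rewrite -sumEFin; apply: lee_sum => i _.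
  rewrite EFinM -errE ge0_integralZr//.
  - by apply/measurable_EFinP; apply: measurableT_comp => //; exact: mcg.
  - by rewrite lee_fin l2norm_ge0.
split => //.
exists S; split => //.
- move=> k p /allpairsPdep[i [q [_ ql ->]]] /=; split.
    exact: (hl (i, k)).1.
  exact: L2Z.
- apply: (@squeeze_cvge _ _ _ _ (fun=> 0%E) _
    (fun k => (\sum_i err k i * nrm (x i))%:E)).
  + apply: nearW => k; rewrite err_le andbT.
    by apply: integral_ge0 => s _; rewrite lee_fin l2norm_ge0.
  + exact: cvg_cst.
  + by apply: cvg_EFin; [exact: nearW|exact: g0].
- apply: dominated_cvg_dist g0; apply: nearW => k.
  rewrite subr0 ger0_norm ?l2norm_ge0// SI -sumrB.
  under eq_bigr do rewrite -scalerBl.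
  apply: le_trans (nrm_le _) _; apply: ler_sum => i _.
  apply: ler_wpM2r; first exact: l2norm_ge0.
  rewrite distrC -RintegralB//; last exact: (hg i).1.
  by apply: le_normr_Rintegral.
Qed.

End bochner.

(** * Positivity of the Gamma function *)
Section gamma.
Context {R : realType}.
Local Notation mu := (@lebesgue_measure R).

Lemma integral_expRN_lty : (\int[mu]_(t in `[1%R, +oo[) (expR (- t))%:E < +oo)%E.
Proof.
have dF (x : R) : is_derive x 1 (fun t : R => - expR (- t)) (expR (- x)).
  by apply: is_derive_eq; rewrite mulrN1 opprK.
have cE : continuous (fun t : R => expR (- t)).
  move=> x; apply: continuous_comp; first exact: continuousN.
  exact: continuous_expR.
rewrite (@ge0_continuous_FTC2y _ _ (fun t : R => - expR (- t)) 1 0).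
- by rewrite -EFinB ltry.
- by move=> x _; exact: expR_ge0.
- by apply: continuous_subspaceT.
- by rewrite -[X in _ --> X]oppr0; apply: cvgN; exact: cvgr_expR.
- by move=> x _; case: (dF x).
- apply: cvg_at_right_filter.
  by have [/derivable1_diffP/differentiable_continuous] := dF 1.
- by move=> x _; rewrite derive1E; exact: (@derive_val _ _ _ _ _ _ _ (dF x)).
Qed.

(** The integral is real-valued, so that positivity requires its finiteness: by
comparison with t ^ (x - 1) on (0, 1) and with exp (- t) beyond. *)
Lemma Gamma_gt0 (x : R) : 0 < x < 1 -> 0 < Gamma x.
Proof.
move=> /andP[x0 x1].
pose g (t : R) : R := t `^ (x - 1) * expR (- t).
have g0 t : (0 <= (g t)%:E)%E.
  by rewrite lee_fin; apply: mulr_ge0; [exact: powR_ge0|exact: expR_ge0].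
have mg D : measurable_fun D (fun t => (g t)%:E).
  apply/measurable_EFinP; apply: measurable_funM; first exact: measurable_powR_comp.
  by apply: measurableT_comp => //; exact: measurable_funN.
have mg1 D : measurable_fun D (fun t : R => (t `^ (x - 1))%:E).
  by apply/measurable_EFinP; exact: measurable_powR_comp.
have mg2 D : measurable_fun D (fun t : R => (expR (- t))%:E).
  by apply/measurable_EFinP; apply: measurableT_comp => //; exact: measurable_funN.
rewrite /Gamma /Rintegral; apply: fine_gt0; apply/andP; split.
- apply: (@lt_le_trans _ _ (\int[mu]_(t in `]0%R, 1%R[) (expR (- 1))%:E)%E).
    by rewrite integral_cst//= lebesgue_measure_itv/= lte_fin ltr01 oppr0 adde0 mule1
      lte_fin expR_gt0.
  apply: ge0_le_lower_integral.
  - by apply: subset_itvl.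
  - by move=> t _; rewrite lee_fin; exact: expR_ge0.
  - by move=> t _; exact: g0.
  - move=> t; rewrite /= in_itv/= => /andP[t0 t1]; rewrite lee_fin /g.
    rewrite -[leLHS]mul1r; apply: ler_pM; [exact: ler01|exact: expR_ge0| |].
      rewrite -[leLHS](powRr0 t).
      by apply: ger_powR; rewrite ?t0 ?(ltW t1)//; lra.
    by rewrite ler_expR lerN2 ltW.
- rewrite (@itv_bndbnd_setU _ _ _ (BLeft 1)); [|by rewrite bnd_simp|by rewrite bnd_simp].
  rewrite ge0_integral_setU; [|exact: measurable_itv|exact: measurable_itv|exact: mg
    |by move=> t _; exact: g0|]; last first.
    apply/disj_setPS => t [] /=; rewrite !in_itv/= andbT => /andP[_ t1] t1'.
    by move: (lt_le_trans t1 t1'); rewrite ltxx.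
  apply: lte_add_pinfty.
    apply: (@le_lt_trans _ _ (\int[mu]_(t in `]0%R, 1%R[) (t `^ (x - 1))%:E)%E).
      apply: ge0_le_integral => //; [by move=> t _; exact: g0|exact: mg|exact: mg1|].
      move=> t; rewrite /= in_itv/= => /andP[t0 _]; rewrite lee_fin.
      rewrite -[leRHS]mulr1; apply: ler_wpM2l; first exact: powR_ge0.
      by rewrite -expR0 ler_expR oppr_le0 ltW.
    by rewrite (integral_powR x0 ltr01) ltry.
  apply: le_lt_trans integral_expRN_lty.
  apply: ge0_le_integral => //; [by move=> t _; exact: g0|exact: mg|exact: mg2|].
  move=> t; rewrite /= in_itv/= andbT => t1; rewrite lee_fin.
  rewrite -[leRHS]mul1r; apply: ler_wpM2r; first exact: expR_ge0.
  rewrite -[leRHS](powRr0 t).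
  by apply: ler_powR => //; rewrite subr_le0 ltW.
Qed.

End gamma.

(** * Piecewise linear interpolants in time *)
Section interpolant.
Context {R : realType} (tt : nat -> R) (N : nat).
Hypothesis tt0 : tt 0%N = 0.
Hypothesis tt_incr : forall n, (n < N)%N -> tt n < tt n.+1.

Definition slope (E : lmodType R) (W : nat -> E) (n : nat) : E :=
  (time_step tt n)^-1 *: (W n - W n.-1).

Lemma time_step_gt0 n : (1 <= n <= N)%N -> 0 < time_step tt n.
Proof.
by case: n => // n /andP[_ nN]; rewrite /time_step subr_gt0 /= tt_incr.
Qed.

Lemma interpolant_affine (E : lmodType R) (W : nat -> E) n s : (1 <= n <= N)%N ->
  tt n.-1 <= s <= tt n ->
  interpolant tt N W s = W n.-1 + (s - tt n.-1) *: slope W n.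
Proof.
move=> nN; have kn := time_step_gt0 nN; have [n1 nN'] := andP nN.
have kN0 : time_step tt n != 0 by rewrite gt_eqF.
move=> /andP[]; rewrite le_eqVlt => /predU1P[<- _|ns sn].
  rewrite subrr scale0r addr0 /interpolant.
  have [n0|n0] := eqVneq n.-1 0%N; first by rewrite n0 tt0 (time_index0 tt0 tt_incr).
  have n1N : (1 <= n.-1 <= N)%N by rewrite lt0n n0 (leq_trans (leq_pred _)).
  have tn : tt n.-1.-1 < tt n.-1 <= tt n.-1.
    by rewrite lexx andbT -subr_gt0; exact: time_step_gt0 n1N.
  rewrite (time_indexE tt_incr n1N tn) (negbTE n0) subrr mul0r scale0r add0r.
  by rewrite divff ?scale1r// gt_eqF// time_step_gt0.
rewrite /interpolant (time_indexE tt_incr nN) ?ns// gtn_eqF//.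
have -> : (tt n - s) / time_step tt n = 1 - (s - tt n.-1) / time_step tt n.
  by rewrite /time_step in kN0 *; field.
rewrite scalerBl scale1r -addrA; congr (_ + _).
by rewrite /slope scalerA scalerBr addrC.
Qed.

Lemma interpolant_piece (E : lmodType R) (W : nat -> E) n s z : (1 <= n <= N)%N ->
  tt n.-1 <= s <= tt n -> tt n.-1 <= z <= tt n ->
  interpolant tt N W s - interpolant tt N W z = (s - z) *: slope W n.
Proof.
move=> nN sn zn; rewrite !(interpolant_affine W nN)// opprD addrACA subrr add0r.
by rewrite -scalerBl opprB addrA subrK.
Qed.

Lemma interpolant_fst (E F : lmodType R) (W : nat -> E * F) s :
  (interpolant tt N W s).1 = interpolant tt N (fun n => (W n).1) s.
Proof. by rewrite /interpolant; case: ifP. Qed.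

Section L2_interpolant.
Context {d : nat} (Omega : set 'rV[R]_d).
Hypothesis mOmega : measurable Omega.
Local Notation L2 := (L2 Omega).
Local Notation ip := (ip Omega).
Local Notation nrm := (l2norm Omega).
Local Notation mu := (@lebesgue_measure R).
Local Notation T := (tt N).
Variable W : nat -> scalar_field R d.
Hypothesis LW : forall n, (n <= N)%N -> L2 (W n).
Local Notation I := (interpolant tt N W).

Lemma L2_slope n : (n <= N)%N -> L2 (slope W n).
Proof.
move=> nN; apply/(L2Z mOmega)/(L2B mOmega); apply: LW => //.
exact: leq_trans (leq_pred _) nN.
Qed.

Lemma L2_interpolant s : 0 <= s <= T -> L2 (I s).
Proof.
move=> /andP[]; rewrite le_eqVlt => /predU1P[<- _|s0 sT].
  by rewrite /interpolant (time_index0 tt0 tt_incr) eqxx; exact: LW.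
have [|n [nN ns sn]] := @time_indexP _ tt N tt0 s; first by rewrite s0.
rewrite (interpolant_affine W nN) ?(ltW ns)//; have /andP[_ nN'] := nN.
apply/(L2D mOmega)/(L2Z mOmega); last exact: L2_slope.
by apply: LW; exact: leq_trans (leq_pred _) nN'.
Qed.

(** The constant is the sum of the norms of all slopes; on each step the increment
is a multiple of one of them, and increments add up over the steps. *)
Lemma interpolant_lipschitz : exists2 L, 0 <= L & forall z s, 0 <= z -> z <= s -> s <= T ->
  nrm (I s - I z) <= L * (s - z).
Proof.
exists (\sum_(n < N.+1) nrm (slope W n)); first by rewrite sumr_ge0// => n _; exact: l2norm_ge0.
set L := \sum_(n < N.+1) _.
have slopeL n : (n <= N)%N -> nrm (slope W n) <= L.
  move=> nN; have nN1 : (n < N.+1)%N by [].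
  by rewrite /L (bigD1 (Ordinal nN1))//= lerDl sumr_ge0// => i _; exact: l2norm_ge0.
have L0 : 0 <= L by rewrite (le_trans _ (slopeL 0%N _)) ?l2norm_ge0.
suff H n : (n <= N)%N -> forall z s, 0 <= z -> z <= s -> s <= tt n ->
    nrm (I s - I z) <= L * (s - z) by exact: H.
elim: n => [_ z s z0 zs|n ih nN z s z0 zs sn].
  rewrite tt0 => s0; have -> : s = z by apply/le_anti; rewrite zs (le_trans s0).
  by rewrite subrr l2norm0 subrr mulr0.
have [stn|tns] := leP s (tt n); first exact: ih (ltnW nN) _ _ _ _ _.
have piece z' s' : tt n <= z' -> z' <= s' -> s' <= tt n.+1 ->
    nrm (I s' - I z') <= L * (s' - z').
  move=> nz zs' s'n; have n1N : (1 <= n.+1 <= N)%N by [].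
  have s'_in : tt n.+1.-1 <= s' <= tt n.+1 by rewrite s'n (le_trans nz).
  have z'_in : tt n.+1.-1 <= z' <= tt n.+1 by rewrite nz (le_trans zs').
  rewrite (interpolant_piece W n1N s'_in z'_in) (l2normZ mOmega _ (L2_slope nN)).
  rewrite ger0_norm ?subr_ge0// mulrC ler_wpM2r ?subr_ge0//.
  exact: slopeL.
have [tnz|ztn] := leP (tt n) z; first exact: piece.
have tn0 : 0 <= tt n by rewrite (le_trans z0)// ltW.
have tnT : tt n <= T by rewrite (le_nodes tt_incr)// (ltnW nN) leqnn.
have sT : s <= T by rewrite (le_trans sn)// (le_nodes tt_incr)// nN leqnn.
have Is : L2 (I s) by apply: L2_interpolant; rewrite sT (le_trans z0).
have Iz : L2 (I z) by apply: L2_interpolant; rewrite z0 (le_trans zs).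
have In : L2 (I (tt n)) by apply: L2_interpolant; rewrite tn0.
rewrite (_ : I s - I z = (I s - I (tt n)) + (I (tt n) - I z)); last by rewrite addrA subrK.
apply: le_trans (l2normD mOmega (L2B mOmega Is In) (L2B mOmega In Iz)) _.
have := piece _ _ (lexx _) (ltW tns) sn; have := ih (ltnW nN) z _ z0 (ltW ztn) (lexx _).
by move: (nrm _) (nrm _) => x y; lra.
Qed.

Lemma interpolant_continuous : continuous_on nrm `[0, T] I.
Proof.
have [L L0 hL] := interpolant_lipschitz.
move=> t; rewrite /= in_itv/= => /andP[t0 tT].
have g0 : L * `|s - t| @[s --> within `[0, T] (nbhs t)] --> (0 : R).
  have n0 : `|s - t| @[s --> t] --> `|t - t|.
    by apply: cvg_norm; apply: cvgB; [exact: cvg_id|exact: cvg_cst].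
  have h : L * `|s - t| @[s --> t] --> L * `|t - t| by exact: cvgMr.
  rewrite subrr normr0 mulr0 in h.
  exact: cvg_within_filter h.
apply: dominated_cvg_dist g0; near=> s.
have : `[0, T]%classic s by near: s; exact: withinT.
rewrite /= in_itv/= => /andP[s0 sT].
rewrite subr0 ger0_norm ?l2norm_ge0//.
have [ts|st] := leP t s; first by rewrite ger0_norm ?subr_ge0// hL.
have Is : L2 (I s) by apply: L2_interpolant; rewrite s0.
have It : L2 (I t) by apply: L2_interpolant; rewrite t0.
rewrite (l2norm_distC mOmega Is It).
by rewrite ler0_norm ?subr_le0 ?(ltW st)// opprB hL// ltW.
Unshelve. all: by end_near. Qed.

Lemma interpolant_derivative (D : set R) n s : (1 <= n <= N)%N ->
  tt n.-1 < s < tt n -> has_derivative nrm D I s (slope W n).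
Proof.
move=> nN /andP[ns sn]; apply/cvgrPdist_lt => e e0.
have : \forall z \near s, z \in `]tt n.-1, tt n[.
  by apply: near_in_itvoo; rewrite in_itv/= ns.
move=> near_s; apply: filterS near_s => z; rewrite in_itv/= => /andP[nz zn] [_ zs].
rewrite (interpolant_piece W nN) ?(ltW nz) ?(ltW zn) ?(ltW ns) ?(ltW sn)//.
rewrite scalerA mulVf ?scale1r ?subrr ?l2norm0 ?subrr ?normr0//.
by rewrite subr_eq0; exact/eqP.
Qed.

End L2_interpolant.
End interpolant.

(** * Caputo derivatives *)
Section caputo.
Context {R : realType} (tt : nat -> R) (N : nat).
Hypothesis tt0 : tt 0%N = 0.
Hypothesis tt_incr : forall n, (n < N)%N -> tt n < tt n.+1.
Context {d : nat} (Omega : set 'rV[R]_d).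
Hypothesis mOmega : measurable Omega.
Local Notation L2 := (L2 Omega).
Local Notation ip := (ip Omega).
Local Notation nrm := (l2norm Omega).
Local Notation mu := (@lebesgue_measure R).
Local Notation T := (tt N).
Variable a : R.
Hypothesis a01 : 0 < a < 1.

Lemma omegaE (x : R) : omega (1 - a) x = (Gamma (1 - a))^-1 * x `^ (- a).
Proof. by rewrite /omega mulrC; congr (_ * _ `^ _); ring. Qed.

Let Gamma1a_gt0 : 0 < Gamma (1 - a) :> R.
Proof. by apply: Gamma_gt0; move: a01 => /andP[? ?]; apply/andP; split; lra. Qed.

(** The interpolant has no derivative at the nodes, which are countably many. *)
Lemma ae_interior_piece : {ae mu, forall s, 0 < s <= T ->
  exists2 n, (1 <= n <= N)%N & tt n.-1 < s < tt n}.
Proof.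
have ct : countable (range tt) by apply: (sub_countable (card_image_le _ _)).
exists (range tt); split.
- by apply: countable_measurable.
- exact: (countable_lebesgue_measure0 ct).
- move=> s /= /not_implyP[/(time_indexP tt0)[n [nN ns sn]] h].
  exists n => //; apply/eqP; rewrite eq_le sn andbT leNgt; apply/negP => sn'.
  by apply: h; exists n => //; rewrite ns.
Qed.

Lemma time_index_le s : (time_index tt N s <= N)%N.
Proof.
rewrite /time_index -[leqRHS]card_ord -sum1_card.
by apply: leq_sum => j _; case: (_ < _).
Qed.

Section weak.
Variables (tau : R) (v : R -> scalar_field R d) (V : nat -> R -> scalar_field R d).
Variables (w psi : scalar_field R d).
Hypothesis tau0 : 0 < tau.
Hypothesis tauT : tau <= T.
Hypothesis Lv : forall s : R, `[0, T]%classic s -> L2 (v s).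
Hypothesis LV : forall n (s : R), (n <= N)%N -> `[0, T]%classic s -> L2 (V n s).
Hypothesis cV : forall n, (n <= N)%N -> continuous_on nrm `[0, T] (V n).
Hypothesis dv : forall n s, (1 <= n <= N)%N -> tt n.-1 < s < tt n ->
  has_derivative nrm `[0, T] v s (V n s).
Hypothesis Lpsi : L2 psi.

(** The derivative that defines the Caputo derivative is given almost everywhere
only; by uniqueness it may be replaced by the piecewise derivative V. *)
Lemma ip_caputo : is_caputo Omega a v tau w ->
  Gamma (1 - a) * ip w psi = \int[mu]_(s in `]0, tau[)
    ((tau - s) `^ (- a) * at_piece tt N (fun n s => ip (V n s) psi) s).
Proof.
move=> [v' [Lv' dv' bw]].
have cst_cont D : continuous_on nrm D (fun=> psi).
  by move=> s _; rewrite subrr l2norm0; exact: cvg_cst.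
have sub : (`[0, tau]%classic : set R) `<=` `[0, T]%classic.
  by apply: subset_itvl; rewrite bnd_simp.
have ik : mu.-integrable `]0, tau[
    (fun s => ((tau - s) `^ (- a) * at_piece tt N (fun n s => ip (V n s) psi) s)%:E).
  apply: integrable_power_kernel => //; first by case/andP: a01.
  move=> n /andP[_ nN]; apply: continuous_subspaceW sub _.
  exact: (ip_continuous_within mOmega (fun s => LV nN) (fun _ _ => Lpsi)
    (cV nN) (cst_cont _)).
rewrite (ip_bochner mOmega _ _ bw Lpsi (G := fun s => (Gamma (1 - a))^-1 *
  ((tau - s) `^ (- a) * at_piece tt N (fun n s => ip (V n s) psi) s)))//.
- by rewrite RintegralZl// mulrA divff ?mul1r// gt_eqF.
- by rewrite lebesgue_measure_itv/=; case: ifP => _; rewrite -?EFinB ltry.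
- exact: (integrableZl _ _ ik).
- move: ae_interior_piece dv'; apply: filterS2; first exact: (ae_filter_ringOfSetsType mu).
  move=> s ex dv's.
  rewrite /= in_itv/= => /[dup] s_in /andP[s0 st].
  have [|n nN ns] := ex; first by rewrite s0 (le_trans (ltW st)).
  have Ts : nbhs s (`[0, T]%classic : set R).
    apply: (@filterS _ _ _ `]0, tau[%classic).
      by move=> z /subset_itv_oo_cc /sub.
    by apply: near_in_itvoo; rewrite in_itv.
  have ts : nbhs s (`]0, tau[%classic : set R).
    by apply: near_in_itvoo; rewrite in_itv.
  have nN' : (n <= N)%N by case/andP: nN.
  have Lvs : L2 (v' s) by apply: Lv'; rewrite in_itv.
  have LVs : L2 (V n s) by apply: LV nN' (nbhs_singleton Ts).
  rewrite (ipZl mOmega)// omegaE -mulrA; congr (_ * (_ * _)).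
  rewrite /at_piece (time_indexE tt_incr nN); last by case/andP: ns => -> /ltW ->.
  apply: (ip_eql mOmega) => //.
  apply: (has_derivative_uniq mOmega ts Ts _ Lvs LVs (dv's _) (dv nN ns)).
    by move=> z /subset_itv_oo_cc /sub; exact: Lv.
  by rewrite in_itv.
Qed.

End weak.

(** The derivative of the interpolant takes the values slope tt W i.+1, so that the
integral is a combination of these fields. *)
Lemma caputo_interpolant_exists (W : nat -> scalar_field R d) (tau : R) :
  (forall n, (n <= N)%N -> L2 (W n)) -> 0 < tau <= T ->
  exists w, is_caputo Omega a (interpolant tt N W) tau w.
Proof.
move=> LW /andP[tau0 tauT].
pose x (i : 'I_N) := slope tt W i.+1.
pose c (i : 'I_N) s := omega (1 - a) (tau - s) *
  at_piece tt N (fun n _ => ((n == i.+1)%:R : R)) s.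
exists (\sum_i (\int[mu]_(s in `]0, tau[) c i s) *: x i).
exists (fun s => slope tt W (time_index tt N s)); split.
- by move=> s _; exact: (L2_slope tt mOmega LW (time_index_le s)).
- move: ae_interior_piece; apply: filterS; first exact: (ae_filter_ringOfSetsType mu).
  move=> s ex; rewrite in_itv/= => /andP[s0 st].
  have [|n nN ns] := ex; first by rewrite s0 (le_trans (ltW st)).
  rewrite (time_indexE tt_incr nN); last by case/andP: ns => -> /ltW ->.
  exact: interpolant_derivative.
have -> : (fun s => omega (1 - a) (tau - s) *: slope tt W (time_index tt N s)) =
    (fun s => \sum_i c i s *: x i).
  apply/funext => s; rewrite /c /at_piece; have := time_index_le s.
  move: (time_index tt N s) => [_|n nN].
    rewrite /slope subrr !scaler0 big1// => i _.
    by rewrite mulr0 scale0r.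
  rewrite (bigD1 (Ordinal nN))//= eqxx mulr1 big1 ?addr0// => i ni.
  rewrite (_ : (n.+1 == i.+1) = false) ?mulr0 ?scale0r//.
  apply/negbTE; apply: contra ni => /eqP[ni]; apply/eqP/val_inj; exact/esym.
apply: (bochner_integral_finite_rank mOmega) => //.
- by rewrite lebesgue_measure_itv/=; case: ifP => _; rewrite -?EFinB ltry.
- move=> i.
  have : mu.-integrable `]0, tau[ (fun s => (Gamma (1 - a))^-1%:E *
    ((tau - s) `^ (- a) * at_piece tt N (fun n _ => ((n == i.+1)%:R : R)) s)%:E)%E.
    apply: integrableZl => //; apply: integrable_power_kernel => //.
      by case/andP: a01.
    by move=> n _; apply: continuous_subspaceT => z; exact: cvg_cst.
  by apply: eq_integrable => // s _; rewrite /= /c omegaE -EFinM mulrA.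
- by move=> i; exact: (L2_slope tt mOmega LW).
Qed.

End caputo.

(** * The energy estimate for differences of Caputo derivatives *)
Section differences.
Context {R : realType} {d : nat} (Omega : set 'rV[R]_d).
Hypothesis mOmega : measurable Omega.
Local Notation L2 := (L2 Omega).
Local Notation nrm := (l2norm Omega).
Variables (D : set R) (v w : R -> scalar_field R d).
Hypothesis Lv : forall s, D s -> L2 (v s).
Hypothesis Lw : forall s, D s -> L2 (w s).

Let l2norm_distD f f' g g' : L2 f -> L2 f' -> L2 g -> L2 g' ->
  nrm ((f - f') - (g - g')) <= nrm (f - g) + nrm (f' - g').
Proof.
move=> Lf Lf' Lg Lg'.
rewrite opprB [g' - g]addrC addrACA [- f' + g']addrC -[g' - f'](opprB f').
exact: (l2normB mOmega (L2B mOmega Lf Lg) (L2B mOmega Lf' Lg')).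
Qed.

Lemma continuous_onB : continuous_on nrm D v -> continuous_on nrm D w ->
  continuous_on nrm D (fun s => v s - w s).
Proof.
move=> cv cw t Dt.
have g0 : nrm (v s - v t) + nrm (w s - w t) @[s --> within D (nbhs t)] --> (0 : R).
  by rewrite -[X in _ --> X](addr0 (0 : R)); apply: cvgD; [exact: cv|exact: cw].
apply: dominated_cvg_dist g0; rewrite near_withinE; apply: nearW => s Ds.
rewrite subr0 ger0_norm ?l2norm_ge0//.
by apply: l2norm_distD; [exact: Lv|exact: Lw|exact: Lv|exact: Lw].
Qed.

Lemma has_derivativeB (s : R) a b : D s -> L2 a -> L2 b ->
  has_derivative nrm D v s a -> has_derivative nrm D w s b ->
  has_derivative nrm D (fun s => v s - w s) s (a - b).
Proof.
move=> Ds La Lb da db.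
have g0 : nrm ((z - s)^-1 *: (v z - v s) - a) + nrm ((z - s)^-1 *: (w z - w s) - b)
    @[z --> within (D `\ s) (nbhs s)] --> (0 : R).
  by rewrite -[X in _ --> X](addr0 (0 : R)); exact: (cvgD da db).
apply: dominated_cvg_dist g0; rewrite near_withinE; apply: nearW => z [Dz _].
rewrite subr0 ger0_norm ?l2norm_ge0//.
have E : v z - w z - (v s - w s) = v z - v s - (w z - w s).
  by rewrite !opprB [w s - v s]addrC addrACA [- w z + w s]addrC.
rewrite E scalerBr.
apply: l2norm_distD => //; apply/(L2Z mOmega)/(L2B mOmega);
  by [exact: Lv|exact: Lw].
Qed.

End differences.

Lemma is_caputo_L2 (R : realType) (d : nat) (Omega : set 'rV[R]_d) (a t : R) v w :
  is_caputo Omega a v t w -> L2 Omega w.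
Proof. by move=> [? [_ _ []]]. Qed.

Section caputo_energy.
Context {R : realType} {d : nat} (Omega : set 'rV[R]_d).
Hypothesis mOmega : measurable Omega.
Local Notation L2 := (L2 Omega).
Local Notation ip := (ip Omega).
Local Notation nrm := (l2norm Omega).
Local Notation mu := (@lebesgue_measure R).
Variables (tt : nat -> R) (N : nat).
Hypothesis tt0 : tt 0%N = 0.
Hypothesis tt_incr : forall n, (n < N)%N -> tt n < tt n.+1.
Local Notation T := (tt N).
Variables (v v' : R -> scalar_field R d) (W : nat -> scalar_field R d).
Hypothesis Lv : forall s : R, `[0, T]%classic s -> L2 (v s).
Hypothesis Lv' : forall s : R, `[0, T]%classic s -> L2 (v' s).
Hypothesis dv : forall s : R, `[0, T]%classic s ->
  has_derivative nrm `[0, T] v s (v' s).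
Hypothesis cv' : continuous_on nrm `[0, T] v'.
Hypothesis LW : forall n, (n <= N)%N -> L2 (W n).
Local Notation I := (interpolant tt N W).

(** A bounded difference quotient forces continuity. *)
Lemma has_derivative_continuous_on : continuous_on nrm `[0, T] v.
Proof.
move=> t Tt; have Lt := Lv Tt; have Lt' := Lv' Tt.
have n0 : `|s - t| @[s --> within `[0, T] (nbhs t)] --> (0 : R).
  have h : `|s - t| @[s --> t] --> `|t - t|.
    by apply: cvg_norm; apply: cvgB; [exact: cvg_id|exact: cvg_cst].
  by rewrite subrr normr0 in h; exact: cvg_within_filter h.
have d0 := dv Tt.
have g0 : `|s - t| * (1 + nrm (v' t)) @[s --> within `[0, T] (nbhs t)] --> (0 : R).
  by rewrite -[X in _ --> X](mul0r (1 + nrm (v' t))); apply: cvgMl.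
apply: dominated_cvg_dist g0.
move/cvgrPdist_lt : d0 => /(_ 1 ltr01); rewrite !near_withinE => d1.
apply: filterS d1 => s; rewrite /= => d1 Ts.
rewrite subr0 ger0_norm ?l2norm_ge0//.
have [->|st] := eqVneq s t; first by rewrite subrr l2norm0 subrr normr0 mul0r.
have Ls := Lv Ts.
have Lst := L2B mOmega Ls Lt.
have st0 : s - t != 0 by rewrite subr_eq0.
have Lq := L2Z mOmega (s - t)^-1 Lst.
have -> : v s - v t = (s - t) *: ((s - t)^-1 *: (v s - v t)).
  by rewrite scalerA divff// scale1r.
rewrite (l2normZ mOmega _ Lq) ler_wpM2l//.
rewrite -[X in nrm X](subrK (v' t)).
apply: le_trans (l2normD mOmega (L2B mOmega Lq Lt') Lt') _.
rewrite lerD2r ltW//.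
have := d1 (conj Ts (elimN eqP st)).
by rewrite sub0r normrN ger0_norm// l2norm_ge0.
Qed.

Local Notation rho := (fun s => v s - I s).
Local Notation V := (fun n s => v' s - slope tt W n).

(** The energy estimate for the difference of a continuously differentiable
trajectory and a piecewise linear one: the hypothesis on the Caputo derivatives
is that on the convolutions, after testing the Bochner integrals. *)
Lemma caputo_energy_estimate (a t : R) (G : R -> R) :
  0 < a < 1 -> 0 < t <= T ->
  (forall r, 0 <= r <= t -> 0 <= G r) ->
  (forall r, 0 < r < t -> exists w w',
     [/\ is_caputo Omega a v r w, is_caputo Omega a I r w' &
         ip (w - w') (rho r) <= nrm (rho r) * G r]) ->
  ((pi / Gamma (1 - a) * (nrm (rho t) - nrm (rho 0)))%:E <=
   \int[mu]_(r in `[0%R, t]) ((t - r) `^ (a - 1) * G r)%:E)%E.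
Proof.
move=> a01 t0T G0 HG.
have Gam0 : 0 < Gamma (1 - a) :> R.
  by apply: Gamma_gt0; move: a01 => /andP[? ?]; apply/andP; split; lra.
have cst_cont D x : continuous_on nrm D (fun=> x).
  by move=> s _; rewrite subrr l2norm0; exact: cvg_cst.
have LI s : `[0, T]%classic s -> L2 (I s).
  by rewrite /= in_itv/=; exact: L2_interpolant.
have Lslope n : (n <= N)%N -> L2 (slope tt W n) by exact: L2_slope.
apply: (energy_estimate (rho := rho) (V := V) mOmega tt0 tt_incr) => //.
- by move=> s Ts; apply: (L2B mOmega); [exact: Lv|exact: LI].
- by move=> n s nN Ts; apply: (L2B mOmega); [exact: Lv'|exact: Lslope].
- exact: continuous_onB Lv LI has_derivative_continuous_on (interpolant_continuous _ _ _ _).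
- move=> n nN; apply: continuous_onB => //; by move=> s _; exact: Lslope.
- move=> n s nN ns.
  have Ts := nbhs_singleton (piece_nbhs tt0 tt_incr nN ns).
  have /andP[_ n_le] := nN.
  exact: (has_derivativeB mOmega Lv LI Ts (Lv' Ts) (Lslope _ n_le) (dv Ts)
    (interpolant_derivative tt0 tt_incr _ _ _ nN ns)).
move=> r r0t; have [w [w' [cw cw' le_ip]]] := HG r r0t.
have /andP[r0 rt] := r0t; have rT : r <= T.
  by case/andP: t0T => _ tT; rewrite (le_trans (ltW rt)).
have Tr : `[0, T]%classic r by rewrite /= in_itv/= ltW.
have Lrho : L2 (rho r) by apply: (L2B mOmega); [exact: Lv|exact: LI].
rewrite mulrC -ler_pdivrMr//; apply: le_trans (le_ip); rewrite ler_pdivrMr// mulrC.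
have Vdv n s : (1 <= n <= N)%N -> tt n.-1 < s < tt n ->
  has_derivative nrm `[0, T] v s (v' s).
  by move=> nN /(piece_nbhs tt0 tt_incr nN)/nbhs_singleton; exact: dv.
rewrite (ipBl mOmega (is_caputo_L2 cw) (is_caputo_L2 cw') Lrho) mulrBr.
rewrite (ip_caputo tt0 tt_incr mOmega a01 r0 rT Lv (fun n s _ => @Lv' s)
  (fun n _ => cv') Vdv Lrho cw).
have dI n s : (1 <= n <= N)%N -> tt n.-1 < s < tt n ->
  has_derivative nrm `[0, T] I s (slope tt W n).
  exact: interpolant_derivative.
rewrite (ip_caputo (V := fun n _ => slope tt W n) tt0 tt_incr mOmega a01 r0 rT LI
  (fun n s nN _ => Lslope n nN) (fun n _ => cst_cont _ _) dI Lrho cw').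
have sub : (`[0, r]%classic : set R) `<=` `[0, T]%classic.
  by apply: subset_itvl; rewrite bnd_simp.
have ik (F : nat -> R -> scalar_field R d) :
  (forall n s, (n <= N)%N -> `[0, T]%classic s -> L2 (F n s)) ->
  (forall n, (n <= N)%N -> continuous_on nrm `[0, T] (F n)) ->
  mu.-integrable `]0, r[ (fun s => ((r - s) `^ (- a) *
    at_piece tt N (fun n s => ip (F n s) (rho r)) s)%:E).
  move=> LF cF; apply: integrable_power_kernel => //; first by case/andP: a01.
  move=> n /andP[_ nN]; apply: continuous_subspaceW sub _.
  exact: (ip_continuous_within mOmega (fun s => LF n s nN) (fun _ _ => Lrho)
    (cF n nN) (cst_cont _ _)).
rewrite -RintegralB//; last 2 first.
- by apply: (ik (fun=> v')) => // n s _; exact: Lv'.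
- by apply: (ik (fun n _ => slope tt W n)) => // n s nN _; exact: Lslope.
rewrite le_eqVlt; apply/orP; left; apply/eqP.
apply: eq_Rintegral => s; rewrite inE/= in_itv/= => /andP[s0 sr].
have Ts : `[0, T]%classic s.
  by rewrite /= in_itv/= (ltW s0) (le_trans (ltW sr) rT).
rewrite -mulrBr /at_piece (ipBl mOmega (Lv' Ts) _ Lrho)//.
exact: Lslope (time_index_le _ _ _).
Qed.

End caputo_energy.

(** * The constant of the estimate *)

(** The angle lies in [0, pi / 2[, so that its cosine is in ]0, 1], and the exponent
alpha - 1 is negative. *)
Lemma fractional_constant_le (R : realType) (alpha theta : R) :
  0 < alpha < 1 -> 0 < theta < pi / 2 ->
  Gamma (1 - alpha) / pi <= (sin theta)^-1 *
    (pi^-1 * cos (Num.max 0 (pi - (pi - theta) / alpha)) `^ (alpha - 1) *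
     Gamma (1 - alpha)).
Proof.
move=> /andP[a0 a1] /andP[th0 th1].
have pi0 : 0 < pi :> R by exact: pi_gt0.
have Gam0 : 0 < Gamma (1 - alpha) :> R.
  by apply: Gamma_gt0; apply/andP; split; lra.
have s0 : 0 < sin theta.
  by apply: sin_gt0_pi; rewrite th0/=; lra.
have s1 : 1 <= (sin theta)^-1 by rewrite invf_ge1// sin_le1.
set phi := Num.max _ _.
have phi0 : 0 <= phi by rewrite le_max lexx.
have phi1 : phi < pi / 2.
  rewrite gt_max divr_gt0//= ltrBlDr -ltrBlDl ltr_pdivlMr//.
  by nra.
have c0 : 0 < cos phi by apply: cos_gt0_pihalf; apply/andP; split; lra.
have c1 : 1 <= cos phi `^ (alpha - 1).
  rewrite -(opprB 1 alpha) powRN invf_ge1 ?powR_gt0//.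
  apply: (@le_trans _ _ (1 `^ (1 - alpha))); last by rewrite powR1.
  by apply: ge0_ler_powR; rewrite ?nnegrE ?cos_le1 ?subr_ge0// ltW.
rewrite [leLHS]mulrC (_ : _ * (_ * _ * _) =
  ((sin theta)^-1 * cos phi `^ (alpha - 1)) * (pi^-1 * Gamma (1 - alpha))); last by ring.
by rewrite ler_peMl ?mulr_ege1// mulr_ge0 ?invr_ge0// ltW.
Qed.

(** * Elliptic operators on interpolants *)
Section convex_combination.
Context {R : realType} (tt : nat -> R) (N : nat).
Hypothesis tt_incr : forall n, (n < N)%N -> tt n < tt n.+1.

Definition time_weight (n : nat) (s : R) : R := (s - tt n.-1) / time_step tt n.

Lemma time_weight_in01 n s : (1 <= n <= N)%N -> tt n.-1 < s <= tt n ->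
  0 <= time_weight n s <= 1.
Proof.
move=> nN /andP[ns sn]; have k0 := time_step_gt0 tt_incr nN.
apply/andP; split.
  by rewrite divr_ge0 ?(ltW k0)// subr_ge0 ltW.
by rewrite ler_pdivrMr// mul1r lerD2r.
Qed.

Lemma interpolant_convex (E : lmodType R) (W : nat -> E) n s : (1 <= n <= N)%N ->
  tt n.-1 < s <= tt n -> interpolant tt N W s =
  (1 - time_weight n s) *: W n.-1 + time_weight n s *: W n.
Proof.
move=> nN ns; have k0 := time_step_gt0 tt_incr nN; have /andP[n0 _] := nN.
rewrite /interpolant (time_indexE tt_incr nN ns) gtn_eqF//; congr (_ *: _ + _).
have kN0 : time_step tt n != 0 by rewrite gt_eqF.
by rewrite /time_weight /time_step in kN0 *; field.
Qed.

End convex_combination.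

Section elliptic.
Context {R : realType} {d : nat} (Omega : set 'rV[R]_d) (c : R).
Hypothesis oOmega : open Omega.
Hypothesis bOmega : Omega `<=` [set v | forall i, - c <= v ord0 i <= c].
Variable A : 'rV[R]_d -> 'M[R]_d.
Hypothesis cA : forall i j, continuous (fun x => A x i j).
Local Notation L2 := (L2 Omega).
Local Notation ip := (ip Omega).
Local Notation nrm := (l2norm Omega).
Local Notation H10 := (H10 Omega).
Let mOmega : measurable Omega := open_domain_measurable oOmega.

(** Test functions are dense, so that testing with them determines a field in L2. *)
Lemma is_ellop_weak v g g' psi : is_ellop Omega A v g -> is_ellop Omega A v g' ->
  H10 psi -> ip g psi.1 = ip g' psi.1.
Proof.
move=> [Lg hg] [Lg' hg'] Hpsi; have [Lpsi _ _] := Hpsi.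
have Lgg := L2B mOmega Lg Lg'.
apply/eqP; rewrite -subr_eq0 -(ipBl mOmega)// -normr_le0.
apply/ler_addgt0Pr => e e0; rewrite add0r.
have e'0 : 0 < e / (nrm (g - g') + 1).
  by rewrite divr_gt0// ltr_wpDl// l2norm_ge0.
have [phi tphi psi_phi] := H10_dense Hpsi e'0.
have Lphi : L2 phi by have [] := H1_lift oOmega bOmega tphi.
have := hg _ tphi; rewrite (hg' _ tphi) => gphi.
have -> : ip (g - g') psi.1 = ip (g - g') (psi.1 - phi).
  rewrite (ipBr mOmega Lpsi Lphi Lgg) (ipBl mOmega Lg Lg' Lphi) gphi.
  by rewrite subrr subr0.
apply: le_trans (cauchy_schwarz mOmega Lgg (L2B mOmega Lpsi Lphi)) _.
apply: (@le_trans _ _ ((nrm (g - g') + 1) * (e / (nrm (g - g') + 1)))).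
  by apply: ler_pM; rewrite ?l2norm_ge0 ?lerDl ?ler01// ltW.
by rewrite mulrC divfK// gt_eqF// ltr_wpDl// l2norm_ge0.
Qed.

(** The operator is defined by choice among the fields that represent the form on
test functions; any representation g shows that there is one, and density
extends it to H10. *)
Lemma ellop_weak v g : L2 g ->
  (forall psi, H10 psi -> aform Omega A v psi = ip g psi.1) ->
  L2 (ellop Omega A v) /\
  forall psi, H10 psi -> aform Omega A v psi = ip (ellop Omega A v) psi.1.
Proof.
move=> Lg vg.
have ell_g : is_ellop Omega A v g.
  split=> // phi tphi; rewrite vg//; exact: (H10_lift oOmega bOmega tphi).
have ell_v : is_ellop Omega A v (ellop Omega A v) by exact: (xgetPex 0 (ex_intro _ g ell_g)).
split=> [|psi Hpsi]; first by case: ell_v.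
rewrite (vg _ Hpsi); exact: (is_ellop_weak ell_g ell_v Hpsi).
Qed.

Variables (tt : nat -> R) (N : nat).
Hypothesis tt_incr : forall n, (n < N)%N -> tt n < tt n.+1.
Variables (W : nat -> sobolev R d) (g : nat -> scalar_field R d).
Hypothesis HW : forall n, (n <= N)%N -> H10 (W n).

Lemma H10_interpolant n s : (1 <= n <= N)%N -> tt n.-1 < s <= tt n ->
  H10 (interpolant tt N W s).
Proof.
move=> nN ns; rewrite (interpolant_convex tt_incr W nN ns).
have /andP[_ nN'] := nN; have n1N := leq_trans (leq_pred n) nN'.
by apply: (H10D oOmega bOmega); apply: (H10Z oOmega bOmega); exact: HW.
Qed.

Hypothesis Lg : forall n, (n <= N)%N -> L2 (g n).
Hypothesis Wg : forall n, (n <= N)%N -> forall psi, H10 psi ->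
  aform Omega A (W n) psi = ip (g n) psi.1.

(** The interpolant is a convex combination of two nodal values, and the
corresponding combination of the fields g represents the form. *)
Lemma ellop_interpolant n s : (1 <= n <= N)%N -> tt n.-1 < s <= tt n ->
  L2 (ellop Omega A (interpolant tt N W s)) /\
  forall psi, H10 psi -> aform Omega A (interpolant tt N W s) psi =
    ip (ellop Omega A (interpolant tt N W s)) psi.1.
Proof.
move=> nN ns; have /andP[_ nN'] := nN; have n1N := leq_trans (leq_pred n) nN'.
rewrite (interpolant_convex tt_incr W nN ns); set c1 := 1 - _; set c2 := time_weight _ _ _.
have Lg1 := Lg n1N; have Lg2 := Lg nN'.
have HW1 := H10_H1 (HW n1N); have HW2 := H10_H1 (HW nN').
apply: (@ellop_weak _ (c1 *: g n.-1 + c2 *: g n)).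
  by apply: (L2D mOmega); exact: L2Z.
move=> psi Hpsi; have Hp := H10_H1 Hpsi; have [Lpsi _] := Hp.
rewrite (aformD oOmega bOmega cA (H1Z oOmega c1 HW1) (H1Z oOmega c2 HW2) Hp).
rewrite !(aformZ oOmega bOmega cA)// !Wg//.
by rewrite (ipDl mOmega (L2Z mOmega c1 Lg1) (L2Z mOmega c2 Lg2) Lpsi) !(ipZl mOmega).
Qed.

End elliptic.

(** * The residual and the reconstruction error *)
Section weak_norms.
Context {R : realType} {d : nat} (Omega : set 'rV[R]_d).
Variables (D : set R) (u : R -> sobolev R d).

Lemma continuous_on_l2norm : continuous_on (h1norm Omega) D u ->
  continuous_on (l2norm Omega) D (fun s => (u s).1).
Proof.
move=> cu s Ds; apply: dominated_cvg_dist (cu s Ds); apply: nearW => z.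
by rewrite subr0 ger0_norm ?l2norm_ge0//; exact: (l2norm_le_h1norm Omega (u z - u s)).
Qed.

Lemma has_derivative_l2norm (s : R) v : has_derivative (h1norm Omega) D u s v ->
  has_derivative (l2norm Omega) D (fun s => (u s).1) s v.1.
Proof.
move=> du; apply: dominated_cvg_dist du; apply: nearW => z.
rewrite subr0 ger0_norm ?l2norm_ge0//.
exact: (l2norm_le_h1norm Omega ((z - s)^-1 *: (u z - u s) - v)).
Qed.
End weak_norms.

(** Here g represents the elliptic operator at the reconstruction, e is the
remaining nonnegative part of the bilinear form, and h = l + b is the scheme. *)
Lemma ip_residual_le (R : realType) (d : nat) (Omega : set 'rV[R]_d)
    (w w' g l b h f psi : scalar_field R d) (e x : R) :
  measurable Omega -> L2 Omega w -> L2 Omega w' -> L2 Omega g -> L2 Omega l ->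
  L2 Omega b -> L2 Omega h -> L2 Omega f -> L2 Omega psi ->
  0 <= e -> 0 <= x ->
  ip Omega w psi + (ip Omega g psi + e) = ip Omega f psi ->
  ip Omega h psi = ip Omega l psi + ip Omega b psi ->
  ip Omega (w - w') psi <= l2norm Omega psi * (l2norm Omega (w' - l) +
    l2norm Omega (g - b) + l2norm Omega (h - f) + x).
Proof.
move=> mO Lw Lw' Lg Ll Lb Lh Lf Lp e0 x0 wE hE.
have cs p q : L2 Omega p -> L2 Omega q ->
    ip Omega q psi - ip Omega p psi <= l2norm Omega psi * l2norm Omega (p - q).
  move=> Lp' Lq; rewrite -opprB -(ipBl mO Lp' Lq Lp) [leRHS]mulrC lerNl.
  exact: lerNnormlW (cauchy_schwarz mO (L2B mO Lp' Lq) Lp).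
have h1 := cs _ _ Lw' Ll; have h2 := cs _ _ Lg Lb; have h3 := cs _ _ Lh Lf.
have px : 0 <= l2norm Omega psi * x by rewrite mulr_ge0 ?l2norm_ge0.
rewrite (ipBl mO Lw Lw' Lp) !mulrDr.
apply: le_trans (lerD (lerD (lerD h1 h2) h3) px).
move: e0 wE hE; clear.
move: (ip _ _ _) (ip _ _ _) (ip _ _ _) (ip _ _ _) (ip _ _ _) (ip _ _ _) (ip _ _ _).
by move=> i1 i2 i3 i4 i5 i6 i7; lra.
Qed.

Lemma l2norm_convex_le (R : realType) (d : nat) (Omega : set 'rV[R]_d)
    (f f' g g' : scalar_field R d) (c x y : R) :
  measurable Omega -> L2 Omega (f - f') -> L2 Omega (g - g') -> 0 <= c <= 1 ->
  l2norm Omega (f - f') <= x -> l2norm Omega (g - g') <= y ->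
  l2norm Omega ((1 - c) *: f + c *: g - ((1 - c) *: f' + c *: g')) <= Num.max y x.
Proof.
move=> mO Lf Lg /andP[c0 c1] fx gy.
rewrite opprD addrACA -!scalerBr.
apply: le_trans (l2normD mO (L2Z mO _ Lf) (L2Z mO _ Lg)) _.
rewrite !(l2normZ mO)// !ger0_norm ?subr_ge0//.
have fm : l2norm Omega (f - f') <= Num.max y x by rewrite le_max fx orbT.
have gm : l2norm Omega (g - g') <= Num.max y x by rewrite le_max gy.
have -> : Num.max y x = (1 - c) * Num.max y x + c * Num.max y x by ring.
by apply: lerD; apply: ler_wpM2l => //; rewrite subr_ge0.
Qed.

Section fe_space_linear.
Context {R : realType} {d : nat} (Omega : set 'rV[R]_d.+1) (c : R).
Hypothesis oOmega : open Omega.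
Hypothesis bOmega : Omega `<=` [set v | forall i, - c <= v ord0 i <= c].
Variables (r : nat) (M : mesh R d).

Lemma polynomial_onD S (f g : 'rV[R]_d.+1 -> R) : polynomial_on r S f -> polynomial_on r S g ->
  polynomial_on r S (f + g).
Proof.
move=> [a fE] [b gE]; exists (fun m => a m + b m) => x Sx.
rewrite fctE fE// gE// -big_split/=.
by apply: eq_bigr => m _; rewrite mulrDl.
Qed.

Lemma polynomial_onZ S k (f : 'rV[R]_d.+1 -> R) : polynomial_on r S f ->
  polynomial_on r S (fun x => k * f x).
Proof.
move=> [a fE]; exists (fun m => k * a m) => x Sx.
by rewrite fE// mulr_sumr; apply: eq_bigr => m _; rewrite mulrA.
Qed.

Lemma fe_spaceD v w : fe_space Omega r M v -> fe_space Omega r M w ->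
  fe_space Omega r M (v + w).
Proof.
move=> [v1 v2 v3 v4] [w1 w2 w3 w4]; split.
- exact: (H10D oOmega bOmega v1 w1).
- by move=> x; apply: continuousD; [exact: v2|exact: w2].
- by move=> x bx; rewrite /= fctE v3// w3// addr0.
- by move=> i; exact: polynomial_onD.
Qed.

Lemma fe_spaceZ k v : fe_space Omega r M v -> fe_space Omega r M (k *: v).
Proof.
move=> [v1 v2 v3 v4]; split.
- exact: (H10Z oOmega bOmega k v1).
- by move=> x; apply: continuousM; [exact: cvg_cst|exact: v2].
- by move=> x bx; rewrite /= fctE v3// scaler0.
- by move=> i; exact: polynomial_onZ.
Qed.

Lemma fe_spaceB v w : fe_space Omega r M v -> fe_space Omega r M w ->
  fe_space Omega r M (v - w).
Proof.
by move=> v1 w1; rewrite -scaleN1r; exact: fe_spaceD v1 (fe_spaceZ (-1) w1).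
Qed.

End fe_space_linear.

(** The integral may be infinite, in which case the bound is trivial since k is
positive. *)
Lemma le_of_scaled_bound (R : realType) (x m y y0 q k : R) (I : \bar R) :
  x <= m + y -> 0 < q -> q^-1 <= k -> (0 <= I)%E -> ((q * (y - y0))%:E <= I)%E ->
  (x%:E <= m%:E + y0%:E + k%:E * I)%E.
Proof.
move=> xy q0 qk I0 yI; have k0 : 0 < k by apply: lt_le_trans qk; rewrite invr_gt0.
case: I I0 yI => [i| |]//; last first.
  by move=> _ _; rewrite gt0_muley ?lte_fin// addey// leey.
rewrite -EFinM -!EFinD !lee_fin => i0 yi.
apply: (le_trans xy); rewrite -addrA lerD2l -lerBlDl.
apply: (@le_trans _ _ (q^-1 * i)); last exact: ler_wpM2r.
by rewrite ler_pdivlMl.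
Qed.

Theorem theorem5p2 (R : realType) (d : nat)
  (* domain, operator and data *)
  (Omega : set 'rV[R]_d.+1) (A : 'rV[R]_d.+1 -> 'M[R]_d.+1) (eta beta : R)
  (alpha T : R) (f : R -> scalar_field R d.+1)
  (u0 : sobolev R d.+1) (u : R -> sobolev R d.+1)
  (HOmega : polytope Omega)
  (Asmooth : forall i j, smooth (fun x => A x i j))
  (Asym : forall x, closure Omega x -> (A x)^T = A x)
  (Apos : forall x, closure Omega x ->
     forall xi : 'rV[R]_d.+1, xi != 0 -> 0 < dot (xi *m A x) xi)
  (eta_gt0 : 0 < eta) (beta_gt0 : 0 < beta)
  (coercive : forall v, H10 Omega v ->
     eta * h1norm Omega v ^+ 2 <= aform Omega A v v)
  (acont : forall v w, H10 Omega v -> H10 Omega w ->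
     `|aform Omega A v w| <= beta * h1norm Omega v * h1norm Omega w)
  (alpha01 : 0 < alpha < 1) (T_gt0 : 0 < T)
  (* exact solution *)
  (fL2 : forall t, 0 <= t <= T -> L2 Omega (f t))
  (fC : continuous_on (l2norm Omega) `[0, T] f)
  (Hu0 : H10 Omega u0)
  (uC1 : continuously_differentiable (h1norm Omega) (H10 Omega) `[0, T] u)
  (u_eq : forall t, 0 < t <= T -> exists2 w,
     is_caputo Omega alpha (fun s => (u s).1) t w &
     forall phi, H10 Omega phi ->
       ip Omega w phi.1 + aform Omega A (u t) phi = ip Omega (f t) phi.1)
  (u_init : ae_eq (@lebesgue_rV R d.+1) Omega (u 0).1 u0.1)
  (* time levels, meshes, finite element spaces *)
  (N : nat) (tt : nat -> R) (M : nat -> mesh R d) (kappa : R) (r : nat)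
  (tt0 : tt 0%N = 0) (ttN : tt N = T)
  (tt_incr : forall n, (n < N)%N -> tt n < tt n.+1)
  (Mconf : forall n, (n <= N)%N -> conforming_triangulation Omega (M n))
  (Mreg : forall n, (n <= N)%N -> shape_regular kappa (M n))
  (r_ge1 : (1 <= r)%N)
  (V := fun n => fe_space Omega r (M n))
  (* discrete operators *)
  (P0 : nat -> scalar_field R d.+1 -> sobolev R d.+1)
  (Pi : nat -> nat -> sobolev R d.+1 -> sobolev R d.+1)
  (Ah : nat -> sobolev R d.+1 -> sobolev R d.+1)
  (HP0 : forall n, (n <= N)%N -> forall g, L2 Omega g -> V n (P0 n g) /\
     forall phi, V n phi -> ip Omega (P0 n g).1 phi.1 = ip Omega g phi.1)
  (HPi : forall j i, (j <= N)%N -> (i <= N)%N ->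
     forall v, V j v -> V i (Pi j i v))
  (HAh : forall n, (n <= N)%N -> forall v, H10 Omega v -> V n (Ah n v) /\
     forall phi, V n phi -> ip Omega (Ah n v).1 phi.1 = aform Omega A v phi)
  (* L1 scheme *)
  (U : nat -> sobolev R d.+1)
  (fh := fun n => P0 n (f (tt n)))
  (HU : forall n, (n <= N)%N -> V n (U n))
  (scheme : forall n, (1 <= n <= N)%N ->
     ae_eq (@lebesgue_rV R d.+1) Omega
       (l1_caputo alpha tt Pi U n + Ah n (U n)).1 (fh n).1)
  (* reconstructions *)
  (Rec : nat -> sobolev R d.+1 -> sobolev R d.+1)
  (HRec : forall n, (n <= N)%N -> forall v, V n v -> H10 Omega (Rec n v) /\
     forall phi, H10 Omega phi ->
       aform Omega A (Rec n v) phi = ip Omega (Ah n v).1 phi.1)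
  (Uh := interpolant tt N U)
  (UR := interpolant tt N (fun n => Rec n (U n)))
  (* elliptic estimator *)
  (Ce0 : R) (Ce0_gt0 : 0 < Ce0)
  (E := fun n v => estimator Ce0 A Omega (M n) v (Ah n v))
  (HCe0 : forall n, (n <= N)%N -> forall v, V n v ->
     l2norm Omega ((Rec n v).1 - v.1) <= E n v)
  (rho := fun t => u t - UR t)
  (rho0 : ellop_dom Omega A (rho 0))
  (theta : R) (theta_in : 0 < theta < pi / 2)
  (phi := Num.max 0 (pi - (pi - theta) / alpha))
  (C := pi^-1 * cos phi `^ (alpha - 1) * Gamma (1 - alpha)) :
  forall n t, (1 <= n <= N)%N -> tt n.-1 < t <= tt n ->
  ((l2norm Omega ((u t).1 - (Uh t).1))%:E <=
   (Num.max (E n (U n)) (E n.-1 (U n.-1)))%:E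
   + (l2norm Omega (rho 0).1)%:E
   + ((sin theta)^-1 * C)%:E *
     \int[@lebesgue_measure R]_(tau in `[0%R, t])
       (let m := time_index tt N tau in
        (t - tau) `^ (alpha - 1) *
        (l2norm Omega (caputo Omega alpha (fun s => (UR s).1) tau
                         - (l1_caputo alpha tt Pi U m).1)
         + l2norm Omega (ellop Omega A (UR tau) - (Ah m (U m)).1)
         + l2norm Omega ((fh m).1 - f tau)
         + l2norm Omega (ellop Omega A (rho 0))))%R%:E)%E.
Proof.
move=> n t nN tn.
have oO := polytope_open HOmega; have [c bO] := polytope_bounded HOmega.
have mO := open_domain_measurable oO.
have cA i j : continuous (fun x => A x i j) by exact: (Asmooth i j [::]).1.
have /andP[n0 n_le] := nN; have n1_le := leq_trans (leq_pred n) n_le.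
have [uH [u' [u'H du cu']]] := uC1.
have VH m v : V m v -> H10 Omega v by case.
have HL v : H10 Omega v -> L2 Omega v.1 by case.
have t0T : 0 < t <= tt N.
  have /andP[t1 t2] := tn; apply/andP; split.
    by apply: le_lt_trans t1; rewrite -tt0; apply: (le_nodes tt_incr).
  by apply: le_trans t2 _; apply: (le_nodes tt_incr); rewrite n_le leqnn.
pose W m := Rec m (U m).
have HW m : (m <= N)%N -> H10 Omega (W m) by move=> mN; have [] := HRec _ mN _ (HU _ mN).
have WL m : (m <= N)%N -> L2 Omega (W m).1 by move=> /HW/HL.
have LAh m : (m <= N)%N -> L2 Omega (Ah m (U m)).1.
  by move=> mN; have [/VH/HL] := HAh _ mN _ (VH _ _ (HU _ mN)).
have Wg m : (m <= N)%N -> forall psi, H10 Omega psi ->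
    aform Omega A (W m) psi = ip Omega (Ah m (U m)).1 psi.1.
  by move=> mN; have [] := HRec _ mN _ (HU _ mN).
(* The abbreviations are used below only through these equations. *)
have rhoD s : rho s = u s - UR s := erefl.
clearbody rho E.
have URD s : UR s = interpolant tt N W s := erefl.
have UhD s : Uh s = interpolant tt N U s := erefl.
have fhD m : fh m = P0 m (f (tt m)) := erefl.
have errW m : (m <= N)%N -> l2norm Omega ((W m).1 - (U m).1) <= E m (U m).
  by move=> mN; exact: HCe0 mN _ (HU _ mN).
clearbody UR Uh fh W.
have URE : (fun s => (UR s).1) = interpolant tt N (fun m => (W m).1).
  by apply/funext => s; rewrite URD; exact: interpolant_fst.
pose G tau : R := let m := time_index tt N tau in
  (l2norm Omega (caputo Omega alpha (fun s => (UR s).1) tau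
                   - (l1_caputo alpha tt Pi U m).1)
   + l2norm Omega (ellop Omega A (UR tau) - (Ah m (U m)).1)
   + l2norm Omega ((fh m).1 - f tau)
   + l2norm Omega (ellop Omega A (rho 0))).
have G0 tau : 0 <= G tau.
  by rewrite /G; do 3 ?apply: addr_ge0; exact: l2norm_ge0.
have Gamma0 : 0 < Gamma (1 - alpha) :> R.
  by apply: Gamma_gt0; rewrite subr_gt0 gtrBl andbC.
have rhoE s : (rho s).1 = (u s).1 - interpolant tt N (fun m => (W m).1) s.
  by rewrite rhoD -URE.
set J := (\int[_]_(_ in _) _)%E.
apply: (@le_of_scaled_bound _ _ _ (l2norm Omega (rho t).1) _ (pi / Gamma (1 - alpha))).
(* The error is rho plus the difference of the interpolants of W and U. *)
- have rho1 : (rho t).1 = (u t).1 - (UR t).1 by rewrite rhoD.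
  rewrite -(subrKA (UR t).1) -rho1 addrC.
  have Lrho : L2 Omega (rho t).1.
    apply/HL; rewrite rhoD; apply: (H10B oO bO).
      by apply: uH; rewrite /= in_itv/= -ttN; have /andP[/ltW -> ->] := t0T.
    by rewrite URD; exact: (H10_interpolant oO bO tt_incr HW nN tn).
  pose c2 := time_weight tt n t.
  have cvx (Z : nat -> sobolev R d.+1) :
      (interpolant tt N Z t).1 = (1 - c2) *: (Z n.-1).1 + c2 *: (Z n).1.
    by rewrite (interpolant_convex tt_incr Z nN tn).
  have LU m : (m <= N)%N -> L2 Omega (U m).1 by move=> /HU/VH/HL.
  have Lerr m : (m <= N)%N -> L2 Omega ((W m).1 - (U m).1).
    by move=> mN; exact: (L2B mO (WL _ mN) (LU _ mN)).
  have cUR := cvx W; rewrite -URD in cUR.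
  have cUh := cvx U; rewrite -UhD in cUh.
  have LUR : L2 Omega (UR t).1.
    by rewrite cUR; apply: (L2D mO); apply: (L2Z mO); exact: WL.
  have LUh : L2 Omega (Uh t).1.
    by rewrite cUh; apply: (L2D mO); apply: (L2Z mO); exact: LU.
  apply: le_trans (l2normD mO (L2B mO LUR LUh) Lrho) _; rewrite lerD2r cUR cUh.
  apply: (l2norm_convex_le mO (Lerr _ n1_le) (Lerr _ n_le) (time_weight_in01 tt_incr nN tn)).
    exact: errW n1_le.
  exact: errW n_le.
- by rewrite divr_gt0// pi_gt0.
- rewrite invf_div; exact: fractional_constant_le.
- apply: integral_ge0 => s _; rewrite lee_fin; apply: mulr_ge0; first exact: powR_ge0.
  exact: G0.
rewrite (rhoE t) (rhoE 0) {}/J.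
apply: (caputo_energy_estimate (v := fun s => (u s).1) (v' := fun s => (u' s).1) (G := G)
  mO tt0 tt_incr _ _ _ _ WL alpha01 t0T).
- by rewrite ttN => s /uH/HL.
- by rewrite ttN => s /u'H/HL.
- by rewrite ttN => s /du; exact: has_derivative_l2norm.
- by rewrite ttN; exact: continuous_on_l2norm.
- by move=> s _; exact: G0.
move=> tau /andP[tau0 taut].
have tauT : tau <= tt N by case/andP: t0T => _; exact: le_trans (ltW taut).
have tau_in : 0 < tau <= tt N by rewrite tau0.
have [m [mN mtau taum]] := time_indexP tt0 tau_in.
have tau_m : tt m.-1 < tau <= tt m by rewrite mtau.
have /andP[_ m_le] := mN.
have Htau : H10 Omega (u tau) by apply: uH; rewrite /= in_itv/= ltW//= -ttN.
have HURtau : H10 Omega (UR tau).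
  by rewrite URD; exact: (H10_interpolant oO bO tt_incr HW mN tau_m).
have Hrho : H10 Omega (rho tau) by rewrite rhoD; exact: (H10B oO bO Htau HURtau).
rewrite ttN in tau_in tauT.
(* The equation of u at tau, and the Caputo derivative of the reconstruction. *)
have [w cw w_eq] := u_eq _ tau_in.
exists w, (caputo Omega alpha (fun s => (UR s).1) tau).
have cw' : is_caputo Omega alpha (fun s => (UR s).1) tau
    (caputo Omega alpha (fun s => (UR s).1) tau).
  apply: (xgetPex 0); rewrite URE.
  by apply: (caputo_interpolant_exists tt0 tt_incr mO alpha01 WL); rewrite ttN.
split; first exact: cw.
  by rewrite -URE; exact: cw'.
rewrite -rhoE /G (time_indexE tt_incr mN tau_m).
have [Lell ell_eq] := ellop_interpolant oO bO cA tt_incr HW LAh Wg mN tau_m.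
rewrite -URD in Lell ell_eq.
(* The discrete derivative lies in H10, as a combination of elements of the finite
   element spaces. *)
have Ll1 : H10 Omega (l1_caputo alpha tt Pi U m).
  rewrite /l1_caputo big_nat; apply: (big_ind (H10 Omega)).
  - rewrite -(scale0r (W m)); exact: (H10Z oO bO 0 (HW _ m_le)).
  - by move=> v1 v2 h1 h2; exact: (H10D oO bO h1 h2).
  move=> j /andP[j1 jm]; apply: (H10Z oO bO); apply/VH.
  have jN : (j <= N)%N by rewrite (leq_trans _ m_le).
  have j1N := leq_trans (leq_pred j) jN.
  apply: (HPi _ _ jN m_le); apply: (fe_spaceZ oO bO).
  by apply: (fe_spaceB oO bO (HU _ jN)); exact: HPi (HU _ j1N).
have tm_in : 0 <= tt m <= T.
  by rewrite -tt0 -ttN; apply/andP; split; apply: (le_nodes tt_incr); rewrite ?m_le ?leqnn.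
have [Vfh fh_eq] := HP0 _ m_le _ (fL2 _ tm_in).
rewrite -fhD in Vfh fh_eq.
have Lrho := HL _ Hrho.
have Lfh := HL _ (VH _ _ Vfh).
have LfT : L2 Omega (f tau) by apply: fL2; rewrite (ltW tau0).
apply: (ip_residual_le (e := aform Omega A (rho tau) (rho tau)) mO (is_caputo_L2 cw)
  (is_caputo_L2 cw') Lell (HL _ Ll1) (LAh _ m_le) Lfh LfT Lrho).
- by apply: le_trans (coercive _ Hrho); apply: mulr_ge0; [exact: ltW|exact: sqr_ge0].
- exact: l2norm_ge0.
- rewrite -(w_eq _ Hrho) -(ell_eq _ Hrho); congr (_ + _).
  rewrite -(aformD oO bO cA (H10_H1 HURtau) (H10_H1 Hrho) (H10_H1 Hrho)).
  by rewrite [in RHS](_ : u tau = UR tau + rho tau)// rhoD addrC subrK.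
- have Lsum := L2D mO (HL _ Ll1) (LAh _ m_le).
  rewrite -(ip_ae_eql mO Lsum Lfh Lrho (scheme _ mN)).
  by rewrite (ipDl mO (HL _ Ll1) (LAh _ m_le) Lrho).
Qed.
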